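(* Let $R$ be a commutative ring and let $M$ be an $R$-module. Then $\mathcal M$ is an $\mathcal R$-module quasi-compact and quasi-separated scheme if and only if $M$ is a finitely generated projective $R$-module.
   Context: All functors are covariant functors on the category of commutative $R$-algebras. $\mathcal R$ is the functor of rings $\mathcal R(R'):=R'$. An $\mathcal R$-module $\mathbb M$ is a functor of abelian groups with a morphism of functors $\mathcal R\times\mathbb M\to\mathbb M$ making each $\mathbb M(R')$ an $R'$-module; morphisms of $\mathcal R$-modules are natural transformations that are $R'$-linear for every $R'$. For an $R$-module $M$, $\mathcal M$ denotes the $\mathcal R$-module $\mathcal M(R'):=M\otimes_RR'$. For an $R$-scheme $X$, $X^{\cdot}(R'):=\mathrm{Hom}_{R\text{-}sch}(\mathrm{Spec}\,R',X)$. An $R$-module scheme is a commutative group $R$-scheme $X$ with a morphism $\mathbb A^1_R\times_R X\to X$ satisfying the module axioms. An $\mathcal R$-module $\mathbb M$ is an $\mathcal R$-module quasi-compact and quasi-separated scheme if $\mathbb M\simeq X^{\cdot}$ as $\mathcal R$-modules for some $R$-module scheme $X$ which is quasi-compact and quasi-separated. *)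

(* Defs.v *)
From HB Require Import structures.
From mathcomp Require Import all_boot all_algebra generic_quotient ring.
From mathcomp Require Import boolp classical_sets topology_structure compact.

Set Implicit Arguments.
Unset Strict Implicit.
Unset Printing Implicit Defensive.

Import GRing.Theory.
Local Open Scope ring_scope.
Local Open Scope quotient_scope.
Local Open Scope classical_set_scope.

Lemma rmorph_ext (A B : pzSemiRingType) (f g : {rmorphism A -> B}) :
  (forall a, f a = g a) -> f = g.
Proof.
case: f => f [[fD] [fM]]; case: g => g [[gD] [gM]] /= e.
have {}e : f = g by apply: funext.
move: fD fM gD gM; rewrite e => fD fM gD gM.
by rewrite (Prop_irrelevance fD gD) (Prop_irrelevance fM gM).
Qed.

(* Commutative R-algebras. The library's comAlgType only has nontrivial rings
   as carriers; here R and its algebras may be zero rings, so an R-algebra is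
   a commutative ring A with a structure morphism R -> A. *)

Record calg (R : comPzRingType) := Calg {
  calg_sort :> comPzRingType;
  calg_str : {rmorphism R -> calg_sort} }.

Record calg_hom (R : comPzRingType) (A B : calg R) := CalgHom {
  calg_fun :> {rmorphism A -> B};
  calg_funP : forall r, calg_fun (calg_str A r) = calg_str B r }.

Definition calg_id (R : comPzRingType) (A : calg R) : calg_hom A A :=
  @CalgHom R A A (idfun : {rmorphism A -> A}) (fun r => erefl).

Lemma calg_comp_subproof (R : comPzRingType) (A B C : calg R)
    (g : calg_hom B C) (f : calg_hom A B) r :
  (g \o f) (calg_str A r) = calg_str C r.
Proof. by rewrite /= !calg_funP. Qed.

Definition calg_comp (R : comPzRingType) (A B C : calg R)
    (g : calg_hom B C) (f : calg_hom A B) : calg_hom A C :=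
  @CalgHom R A C (g \o f : {rmorphism A -> C}) (calg_comp_subproof g f).

(* Modules over the functor of rings R' |-> R'. The R'-linear structures on
   the groups F(R') form a morphism of functors exactly when the maps F(phi)
   are semilinear (mf_mapZ). *)

Record module_functor (R : comPzRingType) := ModuleFunctor {
  mf_obj :> forall A : calg R, lmodType A;
  mf_map : forall A B : calg R, calg_hom A B -> mf_obj A -> mf_obj B;
  mf_mapD : forall A B (phi : calg_hom A B) x y,
    mf_map phi (x + y) = mf_map phi x + mf_map phi y;
  mf_mapZ : forall A B (phi : calg_hom A B) (a : A) x,
    mf_map phi (a *: x) = phi a *: mf_map phi x;
  mf_map_id : forall A x, mf_map (calg_id A) x = x;
  mf_map_comp : forall A B C (psi : calg_hom B C) (phi : calg_hom A B) x,
    mf_map (calg_comp psi phi) x = mf_map psi (mf_map phi x) }.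

Definition mf_iso (R : comPzRingType) (F G : module_functor R) : Prop :=
  exists theta : forall A : calg R, {linear F A -> G A},
    (forall A, bijective (theta A)) /\
    (forall A B (phi : calg_hom A B) x,
       theta B (mf_map phi x) = mf_map phi (theta A x)).

(* The tensor product of M and A over R: formal sums of pure tensors modulo the
   congruence generated by the bilinearity relations. *)

Section Tensor.
Variables (R : comPzRingType) (M : lmodType R) (A : calg R).

Inductive tensor_rel : seq (M * A) -> seq (M * A) -> Prop :=
| tensor_refl s : tensor_rel s s
| tensor_sym s t : tensor_rel s t -> tensor_rel t s
| tensor_trans s t u : tensor_rel s t -> tensor_rel t u -> tensor_rel s u
| tensor_cat s s' t t' :
    tensor_rel s s' -> tensor_rel t t' -> tensor_rel (s ++ t) (s' ++ t')
| tensor_catC s t : tensor_rel (s ++ t) (t ++ s)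
| tensor_0l a : tensor_rel [:: (0, a)] [::]
| tensor_Dl m m' a : tensor_rel [:: (m + m', a)] [:: (m, a); (m', a)]
| tensor_Dr m a a' : tensor_rel [:: (m, a + a')] [:: (m, a); (m, a')]
| tensor_balanced r m a :
    tensor_rel [:: (r *: m, a)] [:: (m, calg_str A r * a)].

Definition formal_tensor : Type := seq (M * A).
HB.instance Definition _ := Choice.on formal_tensor.

Definition tensor_relb (s t : formal_tensor) : bool := `[< tensor_rel s t >].

Lemma tensor_relb_refl : reflexive tensor_relb.
Proof. by move=> s; apply/asboolP; exact: tensor_refl. Qed.

Lemma tensor_relb_sym : symmetric tensor_relb.
Proof. by move=> s t; apply/asboolP/asboolP; exact: tensor_sym. Qed.

Lemma tensor_relb_trans : transitive tensor_relb.
Proof.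
by move=> t s u /asboolP st /asboolP tu; apply/asboolP; exact: tensor_trans tu.
Qed.

Canonical tensor_equiv :=
  EquivRel tensor_relb tensor_relb_refl tensor_relb_sym tensor_relb_trans.

Definition tensor : Type := {eq_quot tensor_relb}.
HB.instance Definition _ := Choice.on tensor.
HB.instance Definition _ := EqQuotient.on tensor.

Definition tensor_class (s : seq (M * A)) : tensor := \pi_tensor s.

Lemma tensor_eq s t : tensor_class s = tensor_class t <-> tensor_rel s t.
Proof.
split=> [e|st]; last by apply/eqmodP/asboolP.
by move: e => /eqmodP /asboolP.
Qed.

Lemma tensor_ind (P : tensor -> Prop) :
  (forall s, P (tensor_class s)) -> forall x, P x.
Proof. by move=> Pc; elim/quotW => s; exact: Pc. Qed.

Lemma tensor_repr s : tensor_rel (repr (tensor_class s)) s.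
Proof. by apply/tensor_eq; rewrite /tensor_class reprK. Qed.

Definition opp_term (p : M * A) : M * A := (- p.1, p.2).
Definition scale_term (a : A) (p : M * A) : M * A := (p.1, a * p.2).

Definition tensor_add (x y : tensor) := tensor_class (repr x ++ repr y).
Definition tensor_opp (x : tensor) := tensor_class (map opp_term (repr x)).
Definition tensor_scale (a : A) (x : tensor) :=
  tensor_class (map (scale_term a) (repr x)).

Lemma tensor_addE s t :
  tensor_add (tensor_class s) (tensor_class t) = tensor_class (s ++ t).
Proof. by apply/tensor_eq; apply: tensor_cat; exact: tensor_repr. Qed.

Lemma tensor_oppE s :
  tensor_opp (tensor_class s) = tensor_class (map opp_term s).
Proof.
apply/tensor_eq; move: (tensor_repr s); move: (repr _) => t.
elim=> {s t}; rewrite /opp_term /=.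
- by move=> s; exact: tensor_refl.
- by move=> s t _; exact: tensor_sym.
- by move=> s t u _ h _; exact: tensor_trans.
- by move=> s s' t t' _ h _ k; rewrite !map_cat; exact: tensor_cat.
- by move=> s t; rewrite !map_cat; exact: tensor_catC.
- by move=> a; rewrite oppr0; exact: tensor_0l.
- by move=> m m' a; rewrite opprD; exact: tensor_Dl.
- by move=> m a a'; exact: tensor_Dr.
- by move=> r m a; rewrite -scalerN; exact: tensor_balanced.
Qed.

Lemma tensor_scaleE a s :
  tensor_scale a (tensor_class s) = tensor_class (map (scale_term a) s).
Proof.
apply/tensor_eq; move: (tensor_repr s); move: (repr _) => t.
elim=> {s t}; rewrite /scale_term /=.
- by move=> s; exact: tensor_refl.
- by move=> s t _; exact: tensor_sym.
- by move=> s t u _ h _; exact: tensor_trans.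
- by move=> s s' t t' _ h _ k; rewrite !map_cat; exact: tensor_cat.
- by move=> s t; rewrite !map_cat; exact: tensor_catC.
- by move=> b; exact: tensor_0l.
- by move=> m m' b; exact: tensor_Dl.
- by move=> m b b'; rewrite mulrDr; exact: tensor_Dr.
- by move=> r m b; rewrite mulrCA; exact: tensor_balanced.
Qed.

Lemma tensor_addA : associative tensor_add.
Proof.
elim/tensor_ind=> s; elim/tensor_ind=> t; elim/tensor_ind=> u.
by rewrite !tensor_addE catA.
Qed.

Lemma tensor_addC : commutative tensor_add.
Proof.
elim/tensor_ind=> s; elim/tensor_ind=> t; rewrite !tensor_addE.
by apply/tensor_eq; exact: tensor_catC.
Qed.

Lemma tensor_add0 : left_id (tensor_class [::]) tensor_add.
Proof. by elim/tensor_ind=> s; rewrite tensor_addE. Qed.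

Lemma tensor_addN : left_inverse (tensor_class [::]) tensor_opp tensor_add.
Proof.
elim/tensor_ind=> s; rewrite tensor_oppE tensor_addE; apply/tensor_eq.
elim: s => [|[m a] s IHs]; first exact: tensor_refl.
have -> : [seq opp_term p | p <- (m, a) :: s] ++ (m, a) :: s =
  [:: opp_term (m, a)] ++ ([seq opp_term p | p <- s] ++ [:: (m, a)]) ++ s.
  by rewrite /= -catA.
apply: tensor_trans (_ : tensor_rel _ ([:: opp_term (m, a); (m, a)] ++
  ([seq opp_term p | p <- s] ++ s))) _.
  rewrite -[_ ++ _ ++ s in X in tensor_rel _ X]
    /([:: opp_term (m, a)] ++ ([:: (m, a)] ++ ([seq opp_term p | p <- s] ++ s))).
  apply: tensor_cat; first exact: tensor_refl.
  rewrite [X in tensor_rel _ X]catA.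
  by apply: tensor_cat; [exact: tensor_catC | exact: tensor_refl].
rewrite -[X in tensor_rel _ X]/([::] ++ [::] : seq (M * A)).
apply: tensor_cat => //; apply: tensor_trans (tensor_0l a).
by apply: tensor_sym; rewrite /opp_term /= -(addNr m); exact: tensor_Dl.
Qed.

HB.instance Definition _ := GRing.isZmodule.Build tensor
  tensor_addA tensor_addC tensor_add0 tensor_addN.

Lemma tensor_scaleA a b x :
  tensor_scale a (tensor_scale b x) = tensor_scale (a * b) x.
Proof.
elim/tensor_ind: x => s; rewrite !tensor_scaleE -map_comp; congr tensor_class.
by apply: eq_map => -[m c]; rewrite /scale_term /= mulrA.
Qed.

Lemma tensor_scale1 : left_id 1 tensor_scale.
Proof.
elim/tensor_ind=> s; rewrite tensor_scaleE -[in RHS](map_id s).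
by congr tensor_class; apply: eq_map => -[m c]; rewrite /scale_term /= mul1r.
Qed.

Lemma tensor_scaleDr : right_distributive tensor_scale +%R.
Proof.
move=> a; elim/tensor_ind=> s; elim/tensor_ind=> t.
by rewrite {}[LHS](congr1 _ (tensor_addE s t)) !tensor_scaleE map_cat
  [RHS]tensor_addE.
Qed.

Lemma tensor_scaleDl x : {morph tensor_scale^~ x : a b / a + b}.
Proof.
move=> a b; elim/tensor_ind: x => s; rewrite !tensor_scaleE [RHS]tensor_addE.
apply/tensor_eq; elim: s => [|[m c] s IHs]; first exact: tensor_refl.
apply: (@tensor_trans _ ([:: (m, a * c); (m, b * c)] ++
  (map (scale_term a) s ++ map (scale_term b) s))).
  apply: (@tensor_cat [:: (m, (a + b) * c)]) => //.
  by rewrite mulrDl; exact: tensor_Dr.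
apply: (@tensor_cat [:: (m, a * c)] [:: (m, a * c)]
  ([:: (m, b * c)] ++ (map (scale_term a) s ++ map (scale_term b) s))
  (map (scale_term a) s ++ ([:: (m, b * c)] ++ map (scale_term b) s))).
  exact: tensor_refl.
rewrite ![X in tensor_rel _ X]catA ![X in tensor_rel X _]catA.
by apply: tensor_cat; [exact: tensor_catC | exact: tensor_refl].
Qed.

HB.instance Definition _ := GRing.Zmodule_isLmodule.Build A tensor
  tensor_scaleA tensor_scale1 tensor_scaleDr tensor_scaleDl.

End Tensor.

Section QuasiCoherent.
Variables (R : comPzRingType) (M : lmodType R).

Definition tensor_map_term (A B : calg R) (phi : calg_hom A B) (p : M * A) :
  M * B := (p.1, phi p.2).

Definition tensor_map (A B : calg R) (phi : calg_hom A B) (x : tensor M A) :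
  tensor M B := tensor_class (map (tensor_map_term phi) (repr x)).

Lemma tensor_mapE A B (phi : calg_hom A B) s :
  tensor_map phi (tensor_class s) = tensor_class (map (tensor_map_term phi) s).
Proof.
apply/tensor_eq; move: (tensor_repr s); move: (repr _) => t.
elim=> {s t}; rewrite /tensor_map_term /=.
- by move=> s; exact: tensor_refl.
- by move=> s t _; exact: tensor_sym.
- by move=> s t u _ h _; exact: tensor_trans.
- by move=> s s' t t' _ h _ k; rewrite !map_cat; exact: tensor_cat.
- by move=> s t; rewrite !map_cat; exact: tensor_catC.
- by move=> b; exact: tensor_0l.
- by move=> m m' b; exact: tensor_Dl.
- by move=> m b b'; rewrite rmorphD; exact: tensor_Dr.
- by move=> r m b; rewrite rmorphM calg_funP; exact: tensor_balanced.
Qed.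

Lemma tensor_mapD A B (phi : calg_hom A B) x y :
  tensor_map phi (x + y) = tensor_map phi x + tensor_map phi y.
Proof.
elim/tensor_ind: x => s; elim/tensor_ind: y => t.
rewrite [LHS](congr1 _ (tensor_addE s t)) !tensor_mapE map_cat.
by rewrite [RHS]tensor_addE.
Qed.

Lemma tensor_mapZ A B (phi : calg_hom A B) (a : A) x :
  tensor_map phi (a *: x) = phi a *: tensor_map phi x.
Proof.
elim/tensor_ind: x => s.
rewrite [LHS](congr1 _ (tensor_scaleE a s)) !tensor_mapE [RHS]tensor_scaleE.
congr tensor_class; rewrite -!map_comp; apply: eq_map => -[m c].
by rewrite /tensor_map_term /scale_term /= rmorphM.
Qed.

Lemma tensor_map_id A x : tensor_map (calg_id A) x = x.
Proof.
elim/tensor_ind: x => s; rewrite tensor_mapE -[in RHS](map_id s).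
by congr tensor_class; apply: eq_map => -[m c].
Qed.

Lemma tensor_map_comp A B C (psi : calg_hom B C) (phi : calg_hom A B) x :
  tensor_map (calg_comp psi phi) x = tensor_map psi (tensor_map phi x).
Proof. by elim/tensor_ind: x => s; rewrite !tensor_mapE -map_comp. Qed.

Definition quasi_coherent : module_functor R :=
  @ModuleFunctor R (fun A => tensor M A) tensor_map tensor_mapD tensor_mapZ
    tensor_map_id tensor_map_comp.

End QuasiCoherent.

Definition finitely_generated (R : comPzRingType) (M : lmodType R) : Prop :=
  exists (n : nat) (v : 'I_n -> M),
    forall m, exists c : 'I_n -> R, m = \sum_i c i *: v i.

Definition projective (R : comPzRingType) (M : lmodType R) : Prop :=
  forall (N P : lmodType R) (g : {linear N -> P}) (f : {linear M -> P}),
    (forall p, exists n, g n = p) ->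
    exists h : {linear M -> N}, forall m, g (h m) = f m.

Record opens (T : topologicalType) := Opens {
  opens_set :> set T;
  opens_open : open opens_set }.

Lemma opensI_subproof (T : topologicalType) (U V : opens T) :
  open ((U : set T) `&` (V : set T)).
Proof. by apply: openI; exact: opens_open. Qed.

Definition opensI (T : topologicalType) (U V : opens T) : opens T :=
  Opens (opensI_subproof U V).

Definition opensT (T : topologicalType) : opens T := Opens (@openT T).

Lemma preim_subproof (S T : topologicalType) (f : S -> T) (fc : continuous f)
  (U : opens T) : open (f @^-1` U).
Proof. by apply: open_comp => [x _|]; [exact: fc | exact: opens_open]. Qed.

Definition preim (S T : topologicalType) (f : S -> T) (fc : continuous f)
  (U : opens T) : opens S := Opens (preim_subproof fc U).

Record presheaf (T : topologicalType) := Presheaf {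
  sec :> opens T -> comPzRingType;
  res : forall U V : opens T, V `<=` U -> {rmorphism sec U -> sec V};
  res_id : forall (U : opens T) (h : U `<=` U) s, res h s = s;
  res_comp : forall (U V W : opens T) (VU : V `<=` U) (WV : W `<=` V)
    (WU : W `<=` U) s, res WV (res VU s) = res WU s }.

Arguments res {T} p {U V} h.
Arguments res_id {T} p {U} h s.
Arguments res_comp {T} p {U V W} VU WV WU s.

Lemma res_trans (T : topologicalType) (F : presheaf T) (U V W : opens T)
    (VU : V `<=` U) (WV : W `<=` V) (s : F U) :
  res F WV (res F VU s) = res F (fun x Wx => VU x (WV x Wx)) s.
Proof. exact: res_comp. Qed.

Lemma res_irr (T : topologicalType) (F : presheaf T) (U V : opens T)
    (h h' : V `<=` U) (s : F U) : res F h s = res F h' s.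
Proof. by rewrite (Prop_irrelevance h h'). Qed.

Definition is_sheaf (T : topologicalType) (F : presheaf T) : Prop :=
  forall (I : Type) (U : opens T) (V : I -> opens T)
    (VU : forall i, V i `<=` U), U `<=` \bigcup_i V i ->
  forall s : forall i, F (V i),
    (forall i j (hi : opensI (V i) (V j) `<=` V i)
       (hj : opensI (V i) (V j) `<=` V j), res F hi (s i) = res F hj (s j)) ->
  exists! t : F U, forall i, res F (VU i) t = s i.

Record rspace := Rspace {
  rs_top :> topologicalType;
  rs_sh : presheaf rs_top;
  rs_shP : is_sheaf rs_sh }.

Notation "\O_ X" := (rs_sh X) (at level 8, X at level 2, format "\O_ X").

(* The germ at x of the section s is a unit of the stalk of F at x. *)
Definition unit_at (T : topologicalType) (F : presheaf T) (x : T) (U : opens T)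
    (s : F U) : Prop :=
  exists (V : opens T) (h : V `<=` U) (t : F V),
    opens_set V x /\ res F h s * t = 1.

Lemma preim_sub (X Y : topologicalType) (f : X -> Y) (fc : continuous f)
  (U V : opens Y) : V `<=` U -> preim fc V `<=` preim fc U.
Proof. by move=> h x; exact: h. Qed.

(* Morphisms of ringed spaces whose stalk maps are local: a germ whose
   pullback is a unit is a unit. Between schemes these are the morphisms of
   schemes. *)
Record mor (X Y : rspace) := Mor {
  mor_fun :> X -> Y;
  mor_cont : continuous mor_fun;
  mor_sh : forall V : opens Y, {rmorphism \O_Y V -> \O_X (preim mor_cont V)};
  mor_nat : forall (V W : opens Y) (h : W `<=` V) s,
    res \O_X (preim_sub h) (mor_sh V s) = mor_sh W (res \O_Y h s);
  mor_local : forall (x : X) (V : opens Y) (s : \O_Y V),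
    opens_set V (mor_fun x) ->
    unit_at x (mor_sh V s) -> unit_at (mor_fun x) s }.

Arguments mor_cont {X Y} m.
Arguments mor_nat {X Y} m {V W} h s.
Arguments mor_local {X Y} m {x V s}.

Lemma mor_ext (X Y : rspace) (f g : mor X Y) :
  (forall x, f x = g x) ->
  (forall (V : opens Y) (h : preim (mor_cont g) V `<=` preim (mor_cont f) V) s,
     res \O_X h (mor_sh f V s) = mor_sh g V s) ->
  f = g.
Proof.
case: f => f fc fs fn fl; case: g => g gc gs gn gl /= /funext e.
move: gc gs gn gl; rewrite -{}e => gc.
rewrite (Prop_irrelevance gc fc) => gs gn gl e.
have {}e : fs = gs.
  apply: functional_extensionality_dep => V; apply: rmorph_ext => s.
  by rewrite -(e _ (fun x => id)) res_id.
move: gn gl; rewrite -{}e => gn gl.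
by rewrite (Prop_irrelevance gn fn) (Prop_irrelevance gl fl).
Qed.

Section MorComp.
Variables (X Y Z : rspace) (g : mor Y Z) (f : mor X Y).

Lemma mor_comp_cont : continuous (g \o f).
Proof. by move=> x; apply: continuous_comp; exact: mor_cont. Qed.

Lemma mor_comp_sub (V : opens Z) :
  preim mor_comp_cont V `<=` preim (mor_cont f) (preim (mor_cont g) V).
Proof. by []. Qed.

Definition mor_comp_sh (V : opens Z) :
    {rmorphism \O_Z V -> \O_X (preim mor_comp_cont V)} :=
  res \O_X (@mor_comp_sub V) \o (mor_sh f (preim (mor_cont g) V) \o mor_sh g V).

Lemma mor_comp_nat (V W : opens Z) (h : W `<=` V) s :
  res \O_X (preim_sub h) (mor_comp_sh V s) = mor_comp_sh W (res \O_Z h s).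
Proof.
rewrite /mor_comp_sh /= -(mor_nat g h) -(mor_nat f (preim_sub h)).
by rewrite !res_trans; exact: res_irr.
Qed.

Lemma unit_at_res (U V : opens X) (h : V `<=` U) (s : \O_X U) x :
  unit_at x (res \O_X h s) -> unit_at x s.
Proof.
case=> W [k [t [Wx e]]]; exists W, (fun y Wy => h y (k y Wy)), t; split=> //.
by rewrite -res_trans.
Qed.

Lemma mor_comp_local (x : X) (V : opens Z) (s : \O_Z V) : opens_set V (g (f x)) ->
  unit_at x (mor_comp_sh V s) -> unit_at (g (f x)) s.
Proof.
move=> Vx /unit_at_res us; apply: (mor_local g Vx).
exact: (@mor_local _ _ f _ (preim (mor_cont g) V) _ Vx us).
Qed.

Definition mor_comp : mor X Z := Mor mor_comp_nat mor_comp_local.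
End MorComp.

Lemma mor_compA (W X Y Z : rspace) (h : mor Y Z) (g : mor X Y) (f : mor W X) :
  mor_comp h (mor_comp g f) = mor_comp (mor_comp h g) f.
Proof.
apply: mor_ext => // V k s; rewrite /= -(mor_nat f (@mor_comp_sub _ _ _ h g V)).
by rewrite !res_trans; exact: res_irr.
Qed.

Record spec (A : comPzRingType) := Prime {
  prime_set :> set A;
  prime0 : prime_set 0;
  primeD : forall a b, prime_set a -> prime_set b -> prime_set (a + b);
  primeM : forall a b, prime_set b -> prime_set (a * b);
  prime1 : ~ prime_set 1;
  primeP : forall a b, prime_set (a * b) -> prime_set a \/ prime_set b }.

Arguments prime_set {A} s a.

Lemma prime_ext (A : comPzRingType) (p q : spec A) :
  (forall a, prime_set p a <-> prime_set q a) -> p = q.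
Proof.
case: p => p p0 pD pM p1 pP; case: q => q q0 qD qM q1 qP /= e.
have {}e : p = q by apply/funext => a; apply/propext.
move: p0 pD pM p1 pP q0 qD qM q1 qP; rewrite e => p0 pD pM p1 pP q0 qD qM q1 qP.
by rewrite (Prop_irrelevance p0 q0) (Prop_irrelevance pD qD)
  (Prop_irrelevance pM qM) (Prop_irrelevance p1 q1) (Prop_irrelevance pP qP).
Qed.

HB.instance Definition _ (A : comPzRingType) := gen_eqMixin (spec A).
HB.instance Definition _ (A : comPzRingType) := gen_choiceMixin (spec A).

(* The open sets are the complements of the sets V(E). *)
Definition zariski_open (A : comPzRingType) (U : set (spec A)) : Prop :=
  exists E : set A,
    U = [set p : spec A | exists f, E f /\ ~ prime_set p f].

Lemma prime_mul (A : comPzRingType) (p : spec A) a b :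
  ~ prime_set p a -> ~ prime_set p b -> ~ prime_set p (a * b).
Proof. by move=> na nb /primeP[]. Qed.

Lemma zariski_openT (A : comPzRingType) : @zariski_open A setT.
Proof.
exists [set 1]; rewrite predeqE => p; split=> // _.
by exists 1; split=> //; exact: prime1.
Qed.

Lemma zariski_openI (A : comPzRingType) : setI_closed (@zariski_open A).
Proof.
move=> _ _ [E ->] [F ->].
exists [set h | exists f g, [/\ E f, F g & h = f * g] ].
rewrite predeqE => p; split.
  case=> -[f [Ef nf]] [g [Fg ng]]; exists (f * g).
  by split; [exists f, g | exact: prime_mul].
case=> _ [[f [g [Ef Fg ->]]] n]; split.
  by exists f; split=> // pf; apply: n; rewrite mulrC; exact: primeM.
by exists g; split=> // pg; apply: n; exact: primeM.
Qed.

Lemma zariski_open_bigU (A : comPzRingType) (I : Type) (f : I -> set (spec A)) :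
  (forall i, zariski_open (f i)) -> zariski_open (\bigcup_i f i).
Proof.
move=> /choice[E fE]; exists (\bigcup_i E i); rewrite predeqE => p; split.
  by case=> i _; rewrite fE => -[a [Ea na]]; exists a; split=> //; exists i.
by case=> a [[i _ Ea] na]; exists i => //; rewrite fE; exists a.
Qed.

HB.instance Definition _ (A : comPzRingType) :=
  isOpenTopological.Build (spec A)
    (@zariski_openT A) (@zariski_openI A) (@zariski_open_bigU A).

Section Localization.
Variables (A : comPzRingType) (p : spec A).

Record fraction := Fraction {
  num : A;
  den : A;
  den_ok : ~ prime_set p den }.

HB.instance Definition _ := gen_eqMixin fraction.
HB.instance Definition _ := gen_choiceMixin fraction.

Definition frac_eq (x y : fraction) : bool :=
  `[< exists u, ~ prime_set p u /\
        u * (num x * den y) = u * (num y * den x) >].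

Lemma frac_eq_refl : reflexive frac_eq.
Proof. by move=> x; apply/asboolP; exists 1; split=> //; exact: prime1. Qed.

Lemma frac_eq_sym : symmetric frac_eq.
Proof.
by move=> x y; apply/asboolP/asboolP; case=> u [nu e]; exists u.
Qed.

Lemma frac_eq_trans : transitive frac_eq.
Proof.
move=> y x z /asboolP[u [nu e]] /asboolP[v [nv e']]; apply/asboolP.
exists (u * v * den y); split.
  by apply: prime_mul; [exact: prime_mul | exact: den_ok].
transitivity (v * den z * (u * (num x * den y))); first by ring.
rewrite e; transitivity (u * den x * (v * (num y * den z))); first by ring.
by rewrite e'; ring.
Qed.

Canonical frac_equiv :=
  EquivRel frac_eq frac_eq_refl frac_eq_sym frac_eq_trans.

Definition loc : Type := {eq_quot frac_eq}.
HB.instance Definition _ := Choice.on loc.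

Definition loc_class (x : fraction) : loc := \pi_({eq_quot frac_eq}) x.
Definition frac (a s : A) (ns : ~ prime_set p s) : loc :=
  loc_class (Fraction a ns).

Lemma frac_eqP (a s b t : A) (ns : ~ prime_set p s) (nt : ~ prime_set p t) :
  frac a ns = frac b nt <->
  exists u, ~ prime_set p u /\ u * (a * t) = u * (b * s).
Proof.
by split=> [/eqmodP/asboolP // | e]; apply/eqmodP/asboolP.
Qed.

Lemma frac_eqI (a s b t : A) (ns : ~ prime_set p s) (nt : ~ prime_set p t) :
  a * t = b * s -> frac a ns = frac b nt.
Proof.
by move=> e; apply/frac_eqP; exists 1; rewrite e; split=> //; exact: prime1.
Qed.

Lemma loc_ind (P : loc -> Prop) :
  (forall a s (ns : ~ prime_set p s), P (frac a ns)) -> forall x, P x.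
Proof. by move=> Pf; elim/quotW => -[a s ns]; exact: Pf. Qed.

Lemma frac_repr (a s : A) (ns : ~ prime_set p s) :
  exists u, ~ prime_set p u /\
    u * (num (repr (frac a ns)) * s) = u * (a * den (repr (frac a ns))).
Proof.
apply/frac_eqP; [exact: den_ok | move=> nd].
by rewrite -[RHS]reprK; case: (repr _) nd => b t nt nd; exact: frac_eqI.
Qed.

Definition loc_opp (x : loc) : loc :=
  frac (- num (repr x)) (@den_ok (repr x)).
Definition loc_add (x y : loc) : loc :=
  frac (num (repr x) * den (repr y) + num (repr y) * den (repr x))
    (prime_mul (@den_ok (repr x)) (@den_ok (repr y))).
Definition loc_mul (x y : loc) : loc :=
  frac (num (repr x) * num (repr y))
    (prime_mul (@den_ok (repr x)) (@den_ok (repr y))).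

Lemma loc_oppE a s (ns : ~ prime_set p s) :
  loc_opp (frac a ns) = frac (- a) ns.
Proof.
have [u [nu e]] := frac_repr a ns; apply/frac_eqP; exists u; split=> //.
by rewrite !mulNr !mulrN e.
Qed.

Lemma loc_addE a s b t (ns : ~ prime_set p s) (nt : ~ prime_set p t) :
  loc_add (frac a ns) (frac b nt) = frac (a * t + b * s) (prime_mul ns nt).
Proof.
have [u [nu e]] := frac_repr a ns; have [v [nv e']] := frac_repr b nt.
apply/frac_eqP; exists (u * v); split; first exact: prime_mul.
move: (num _) (den _) e => c w e; move: (num _) (den _) e' => d z e'.
transitivity (v * z * t * (u * (c * s)) + u * w * s * (v * (d * t))).
  by ring.
by rewrite e e'; ring.
Qed.

Lemma loc_mulE a s b t (ns : ~ prime_set p s) (nt : ~ prime_set p t) :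
  loc_mul (frac a ns) (frac b nt) = frac (a * b) (prime_mul ns nt).
Proof.
have [u [nu e]] := frac_repr a ns; have [v [nv e']] := frac_repr b nt.
apply/frac_eqP; exists (u * v); split; first exact: prime_mul.
move: (num _) (den _) e => c w e; move: (num _) (den _) e' => d z e'.
transitivity ((u * (c * s)) * (v * (d * t))); first by ring.
by rewrite e e'; ring.
Qed.

Lemma loc_addA : associative loc_add.
Proof.
elim/loc_ind=> a s ns; elim/loc_ind=> b t nt; elim/loc_ind=> c w nw.
by rewrite !loc_addE; apply: frac_eqI; ring.
Qed.

Lemma loc_addC : commutative loc_add.
Proof.
elim/loc_ind=> a s ns; elim/loc_ind=> b t nt.
by rewrite !loc_addE; apply: frac_eqI; ring.
Qed.

Lemma loc_add0 : left_id (frac 0 (@prime1 A p)) loc_add.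
Proof.
by elim/loc_ind=> a s ns; rewrite loc_addE; apply: frac_eqI; ring.
Qed.

Lemma loc_addN : left_inverse (frac 0 (@prime1 A p)) loc_opp loc_add.
Proof.
by elim/loc_ind=> a s ns; rewrite loc_oppE loc_addE; apply: frac_eqI; ring.
Qed.

HB.instance Definition _ := GRing.isZmodule.Build loc
  loc_addA loc_addC loc_add0 loc_addN.

Lemma loc_mulA : associative loc_mul.
Proof.
elim/loc_ind=> a s ns; elim/loc_ind=> b t nt; elim/loc_ind=> c w nw.
by rewrite !loc_mulE; apply: frac_eqI; ring.
Qed.

Lemma loc_mulC : commutative loc_mul.
Proof.
elim/loc_ind=> a s ns; elim/loc_ind=> b t nt.
by rewrite !loc_mulE; apply: frac_eqI; ring.
Qed.

Lemma loc_mul1 : left_id (frac 1 (@prime1 A p)) loc_mul.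
Proof.
by elim/loc_ind=> a s ns; rewrite loc_mulE; apply: frac_eqI; ring.
Qed.

Lemma loc_mulDl : left_distributive loc_mul loc_add.
Proof.
elim/loc_ind=> a s ns; elim/loc_ind=> b t nt; elim/loc_ind=> c w nw.
by rewrite !(loc_mulE, loc_addE); apply: frac_eqI; ring.
Qed.

HB.instance Definition _ := GRing.Zmodule_isComPzRing.Build loc
  loc_mulA loc_mulC loc_mul1 loc_mulDl.

Lemma frac0 s (ns : ~ prime_set p s) : frac 0 ns = 0.
Proof. by apply: frac_eqI; rewrite !mul0r. Qed.

Lemma frac1 s (ns : ~ prime_set p s) : frac s ns = 1.
Proof. by apply: frac_eqI; rewrite mulrC. Qed.

Lemma fracN a s (ns : ~ prime_set p s) : frac (- a) ns = - frac a ns.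
Proof. exact/esym/loc_oppE. Qed.

Lemma fracD a s b t (ns : ~ prime_set p s) (nt : ~ prime_set p t)
    (nst : ~ prime_set p (s * t)) :
  frac (a * t + b * s) nst = frac a ns + frac b nt.
Proof. by rewrite (loc_addE a b ns nt : _ + _ = _); apply: frac_eqI. Qed.

Lemma fracM a s b t (ns : ~ prime_set p s) (nt : ~ prime_set p t)
    (nst : ~ prime_set p (s * t)) :
  frac (a * b) nst = frac a ns * frac b nt.
Proof. by rewrite (loc_mulE a b ns nt : _ * _ = _); apply: frac_eqI. Qed.

End Localization.

Section LocMap.
Variables (A B : comPzRingType) (phi : {rmorphism A -> B}).

Section Def.
Variables (p : spec A) (q : spec B).
Hypothesis pq : forall a, ~ prime_set p a -> ~ prime_set q (phi a).

Definition loc_map_fun (x : loc p) : loc q :=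
  frac (phi (num (repr x))) (pq (@den_ok _ _ (repr x))).

Lemma loc_map_funE a s (ns : ~ prime_set p s) :
  loc_map_fun (frac a ns) = frac (phi a) (pq ns).
Proof.
have [u [nu e]] := frac_repr a ns; apply/frac_eqP.
by exists (phi u); split; [exact: pq | rewrite -!rmorphM e].
Qed.

Lemma loc_map_zmod : zmod_morphism loc_map_fun.
Proof.
elim/loc_ind=> a s ns; elim/loc_ind=> b t nt.
rewrite -fracN -(fracD _ _ _ _ (prime_mul ns nt)) !loc_map_funE -fracN.
rewrite -(fracD _ _ _ _ (prime_mul (pq ns) (pq nt))).
by apply: frac_eqI; rewrite !(rmorphD, rmorphM, rmorphN).
Qed.

Lemma loc_map_monoid : monoid_morphism loc_map_fun.
Proof.
split; first by rewrite -(frac1 (@prime1 _ p)) loc_map_funE frac1.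
elim/loc_ind=> a s ns; elim/loc_ind=> b t nt.
rewrite -(fracM _ _ _ _ (prime_mul ns nt)) !loc_map_funE.
rewrite -(fracM _ _ _ _ (prime_mul (pq ns) (pq nt))).
by apply: frac_eqI; rewrite !rmorphM.
Qed.

HB.instance Definition _ := GRing.isZmodMorphism.Build (loc p) (loc q)
  loc_map_fun loc_map_zmod.
HB.instance Definition _ := GRing.isMonoidMorphism.Build (loc p) (loc q)
  loc_map_fun loc_map_monoid.

Definition loc_map : {rmorphism loc p -> loc q} := loc_map_fun.

Lemma loc_mapE a s (ns : ~ prime_set p s) :
  loc_map (frac a ns) = frac (phi a) (pq ns).
Proof. exact: loc_map_funE. Qed.

End Def.
End LocMap.

(* A section over U is a function on U with values in the localizations that is
   locally given by a fraction. *)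
Section StructureSheaf.
Variable A : comPzRingType.

Definition locally_fraction (U : opens (spec A))
    (s : forall p, opens_set U p -> loc p) : Prop :=
  forall p, opens_set U p ->
    exists (V : opens (spec A)) (VU : V `<=` U) (a f : A),
      opens_set V p /\
      forall q (Vq : opens_set V q),
        exists nf : ~ prime_set q f, s q (VU q Vq) = frac a nf.

Section Ring.
Variable U : opens (spec A).

Record regular := Regular {
  reg_fun :> forall p, opens_set U p -> loc p;
  regP : locally_fraction reg_fun }.

Lemma regular_ext (s t : regular) :
  (forall p (Up : opens_set U p), s p Up = t p Up) -> s = t.
Proof.
case: s => s sP; case: t => t tP /= e.
have {}e : s = t.
  by do 2![apply: functional_extensionality_dep => ?]; exact: e.
by move: tP; rewrite -e => tP; rewrite (Prop_irrelevance sP tP).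
Qed.

Lemma reg_irr (s : regular) p (h h' : opens_set U p) : s p h = s p h'.
Proof. by rewrite (Prop_irrelevance h h'). Qed.

HB.instance Definition _ := gen_eqMixin regular.
HB.instance Definition _ := gen_choiceMixin regular.

Lemma reg_cst_subproof (a : A) :
  locally_fraction (fun p (_ : opens_set U p) => frac a (@prime1 _ p)).
Proof.
by move=> p Up; exists U, (fun _ => id), a, 1; split=> // q _; exists (@prime1 _ q).
Qed.

Definition reg_cst (a : A) : regular := Regular (reg_cst_subproof a).

Lemma reg_opp_subproof (s : regular) :
  locally_fraction (fun p (Up : opens_set U p) => - s p Up).
Proof.
move=> p /(regP s)[V [VU [a [f [Vp e]]]]]; exists V, VU, (- a), f.
by split=> // q Vq; have [nf ->] := e q Vq; exists nf; rewrite fracN.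
Qed.

Lemma reg_add_subproof (s t : regular) :
  locally_fraction (fun p (Up : opens_set U p) => s p Up + t p Up).
Proof.
move=> p Up; have [V [VU [a [f [Vp e]]]]] := regP s Up.
have [W [WU [b [g [Wp e']]]]] := regP t Up.
exists (opensI V W), (fun q Vq => VU q (proj1 Vq)), (a * g + b * f), (f * g).
split=> // q [Vq Wq]; have [nf ef] := e q Vq; have [ng eg] := e' q Wq.
exists (prime_mul nf ng); rewrite (fracD _ _ nf ng) -ef -eg.
by congr (_ + _); exact: reg_irr.
Qed.

Lemma reg_mul_subproof (s t : regular) :
  locally_fraction (fun p (Up : opens_set U p) => s p Up * t p Up).
Proof.
move=> p Up; have [V [VU [a [f [Vp e]]]]] := regP s Up.
have [W [WU [b [g [Wp e']]]]] := regP t Up.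
exists (opensI V W), (fun q Vq => VU q (proj1 Vq)), (a * b), (f * g).
split=> // q [Vq Wq]; have [nf ef] := e q Vq; have [ng eg] := e' q Wq.
exists (prime_mul nf ng); rewrite (fracM _ _ nf ng) -ef -eg.
by congr (_ * _); exact: reg_irr.
Qed.

Definition reg_opp (s : regular) : regular := Regular (reg_opp_subproof s).
Definition reg_add (s t : regular) : regular := Regular (reg_add_subproof s t).
Definition reg_mul (s t : regular) : regular := Regular (reg_mul_subproof s t).

Lemma reg_addA : associative reg_add.
Proof. by move=> s t u; apply: regular_ext => p Up /=; rewrite addrA. Qed.

Lemma reg_addC : commutative reg_add.
Proof. by move=> s t; apply: regular_ext => p Up /=; rewrite addrC. Qed.

Lemma reg_add0 : left_id (reg_cst 0) reg_add.
Proof. by move=> s; apply: regular_ext => p Up /=; rewrite frac0 add0r. Qed.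

Lemma reg_addN : left_inverse (reg_cst 0) reg_opp reg_add.
Proof. by move=> s; apply: regular_ext => p Up /=; rewrite frac0 addNr. Qed.

HB.instance Definition _ := GRing.isZmodule.Build regular
  reg_addA reg_addC reg_add0 reg_addN.

Lemma reg_mulA : associative reg_mul.
Proof. by move=> s t u; apply: regular_ext => p Up /=; rewrite mulrA. Qed.

Lemma reg_mulC : commutative reg_mul.
Proof. by move=> s t; apply: regular_ext => p Up /=; rewrite mulrC. Qed.

Lemma reg_mul1 : left_id (reg_cst 1) reg_mul.
Proof. by move=> s; apply: regular_ext => p Up /=; rewrite frac1 mul1r. Qed.

Lemma reg_mulDl : left_distributive reg_mul reg_add.
Proof. by move=> s t u; apply: regular_ext => p Up /=; rewrite mulrDl. Qed.

HB.instance Definition _ := GRing.Zmodule_isComPzRing.Build regular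
  reg_mulA reg_mulC reg_mul1 reg_mulDl.

Lemma regDE (s t : regular) p (Up : opens_set U p) :
  (s + t) p Up = s p Up + t p Up.
Proof. by []. Qed.

Lemma regNE (s : regular) p (Up : opens_set U p) : (- s) p Up = - s p Up.
Proof. by []. Qed.

Lemma regME (s t : regular) p (Up : opens_set U p) :
  (s * t) p Up = s p Up * t p Up.
Proof. by []. Qed.

Lemma reg1E p (Up : opens_set U p) : (1 : regular) p Up = 1.
Proof. exact: frac1. Qed.

End Ring.

Section Restriction.
Variables (U V : opens (spec A)) (VU : V `<=` U).

Lemma reg_res_subproof (s : regular U) :
  locally_fraction (fun p (Vp : opens_set V p) => s p (VU Vp)).
Proof.
move=> p Vp; have [W [WU [a [f [Wp e]]]]] := regP s (VU Vp).
exists (opensI V W), (fun q Vq => proj1 Vq), a, f; split=> // q [Vq Wq].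
have [nf ef] := e q Wq; exists nf; rewrite -ef.
exact: reg_irr.
Qed.

Definition reg_res_fun (s : regular U) : regular V :=
  Regular (reg_res_subproof s).

Lemma reg_res_zmod : zmod_morphism reg_res_fun.
Proof. by move=> s t; apply: regular_ext. Qed.

Lemma reg_res_monoid : monoid_morphism reg_res_fun.
Proof. by split=> [|s t]; apply: regular_ext. Qed.

HB.instance Definition _ := GRing.isZmodMorphism.Build (regular U) (regular V)
  reg_res_fun reg_res_zmod.
HB.instance Definition _ := GRing.isMonoidMorphism.Build (regular U) (regular V)
  reg_res_fun reg_res_monoid.

Definition reg_res : {rmorphism regular U -> regular V} := reg_res_fun.

End Restriction.

Lemma reg_res_id (U : opens (spec A)) (h : U `<=` U) s : reg_res h s = s.
Proof.
apply: regular_ext => p Up /=.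
exact: reg_irr.
Qed.

Lemma reg_res_comp (U V W : opens (spec A)) (VU : V `<=` U) (WV : W `<=` V)
  (WU : W `<=` U) s : reg_res WV (reg_res VU s) = reg_res WU s.
Proof.
apply: regular_ext => p Up /=.
exact: reg_irr.
Qed.

Definition spec_presheaf : presheaf (spec A) := Presheaf reg_res_id reg_res_comp.

Lemma spec_sheafP : is_sheaf spec_presheaf.
Proof.
move=> I U V VU UV s compat.
have cover p (Up : opens_set U p) : {i | opens_set (V i) p}.
  by apply: cid; have [i _ Vi] := UV p Up; exists i.
pose t p (Up : opens_set U p) : loc p :=
  reg_fun (s (projT1 (cover p Up))) (projT2 (cover p Up)).
have tE i p (Vp : opens_set (V i) p) (Up : opens_set U p) :
    t p Up = reg_fun (s i) Vp.
  rewrite /t; case: (cover p Up) => j Vj /=.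
  have Vji : opens_set (opensI (V j) (V i)) p by split.
  have := compat j i (@subIsetl _ _ _) (@subIsetr _ _ _).
  move/(congr1 (fun r : regular (opensI (V j) (V i)) => r p Vji)) => /= e.
  by apply: etrans (etrans e _); exact: reg_irr.
have tP : locally_fraction t.
  move=> p Up; have [i Vi] := cover p Up.
  have [W [WV [a [f [Wp e]]]]] := regP (s i) Vi.
  exists W, (fun q Wq => VU i q (WV q Wq)), a, f; split=> // q Wq.
  have [nf ef] := e q Wq; exists nf; rewrite -ef; exact: tE.
exists (Regular tP); split.
  by move=> i; apply: regular_ext => p Vp /=; exact: tE.
move=> t' t'E; apply: regular_ext => p Up /=.
have [i Vi] := cover p Up; rewrite (tE i p Vi) -(t'E i) /=.
exact: reg_irr.
Qed.

Definition Spec : rspace := Rspace spec_sheafP.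

End StructureSheaf.

Section SpecMap.
Variables (A B : comPzRingType) (phi : {rmorphism A -> B}).

Lemma spec_fun_subproof (q : spec B) :
  [/\ prime_set q (phi 0),
    (forall a b, prime_set q (phi a) -> prime_set q (phi b) ->
       prime_set q (phi (a + b))),
    (forall a b, prime_set q (phi b) -> prime_set q (phi (a * b))),
    ~ prime_set q (phi 1) &
    (forall a b, prime_set q (phi (a * b)) ->
       prime_set q (phi a) \/ prime_set q (phi b))].
Proof.
split=> [|a b|a b||a b].
- by rewrite rmorph0; exact: prime0.
- by rewrite rmorphD; exact: primeD.
- by rewrite rmorphM; exact: primeM.
- by rewrite rmorph1; exact: prime1.
- by rewrite rmorphM; exact: primeP.
Qed.

Definition spec_fun (q : spec B) : spec A :=
  let: And5 q0 qD qM q1 qP := spec_fun_subproof q in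
  @Prime A (phi @^-1` q) q0 qD qM q1 qP.

Lemma spec_funE q a : prime_set (spec_fun q) a = prime_set q (phi a).
Proof. by rewrite /spec_fun; case: (spec_fun_subproof q). Qed.

Lemma spec_fun_cont : continuous spec_fun.
Proof.
apply/continuousP => _ [E ->]; exists (phi @` E); rewrite predeqE => q; split.
  by case=> f [Ef nf]; exists (phi f); split; [exists f | rewrite -spec_funE].
by case=> _ [[f Ef <-] nf]; exists f; rewrite spec_funE.
Qed.

Lemma spec_fun_compl (q : spec B) a :
  ~ prime_set (spec_fun q) a -> ~ prime_set q (phi a).
Proof. by rewrite spec_funE. Qed.

Section Pullback.
Variable V : opens (spec A).

Lemma spec_sh_subproof (s : regular V) :
  locally_fraction
    (fun q (Vq : opens_set (preim spec_fun_cont V) q) =>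
       loc_map (@spec_fun_compl q) (s (spec_fun q) Vq)).
Proof.
move=> q Vq; have [W [WV [a [f [Wq e]]]]] := regP s Vq.
exists (preim spec_fun_cont W), (fun r => WV (spec_fun r)), (phi a), (phi f).
split=> // r Wr; have [nf ->] := e _ Wr.
by exists (spec_fun_compl nf); rewrite loc_mapE.
Qed.

Definition spec_sh_fun (s : regular V) : regular (preim spec_fun_cont V) :=
  Regular (spec_sh_subproof s).

Lemma spec_sh_zmod : zmod_morphism spec_sh_fun.
Proof. by move=> s t; apply: regular_ext => q Vq /=; rewrite rmorphB. Qed.

Lemma spec_sh_monoid : monoid_morphism spec_sh_fun.
Proof.
split=> [|s t]; apply: regular_ext => q Vq; last by rewrite /= rmorphM.
apply: etrans (esym (reg1E Vq)); rewrite /=.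
by rewrite -(rmorph1 (loc_map (@spec_fun_compl q))); congr loc_map_fun; exact: reg1E.
Qed.

HB.instance Definition _ := GRing.isZmodMorphism.Build
  (regular V) (regular (preim spec_fun_cont V)) spec_sh_fun spec_sh_zmod.
HB.instance Definition _ := GRing.isMonoidMorphism.Build
  (regular V) (regular (preim spec_fun_cont V)) spec_sh_fun spec_sh_monoid.

Definition spec_sh :
  {rmorphism \O_(Spec A) V -> \O_(Spec B) (preim spec_fun_cont V)} :=
  spec_sh_fun.

End Pullback.

Lemma spec_sh_nat (V W : opens (Spec A)) (h : W `<=` V) s :
  res \O_(Spec B) (preim_sub h) (spec_sh V s) = spec_sh W (res \O_(Spec A) h s).
Proof.
by apply: regular_ext => q Wq; congr loc_map_fun; exact: reg_irr.
Qed.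

Lemma spec_sh_local (q : Spec B) (V : opens (Spec A)) (s : \O_(Spec A) V) :
  opens_set V (spec_fun q) -> unit_at q (spec_sh V s) ->
  unit_at (spec_fun q) s.
Proof.
move=> Vq [W [WV [t [Wq /(congr1 (fun r : regular W => r q Wq)) st]]]].
have [W1 [W1V [a [f [W1q e]]]]] := regP s Vq.
have na : ~ prime_set (spec_fun q) a.
  rewrite spec_funE => qa; move: st; rewrite reg1E /=.
  have [nf ef] := e _ W1q.
  rewrite (Prop_irrelevance (WV q Wq) (W1V _ W1q)) ef loc_mapE.
  elim/loc_ind: (reg_fun t Wq) => b g ng.
  rewrite -(fracM _ _ _ _ (prime_mul (spec_fun_compl nf) ng)) -(frac1 (@prime1 _ q)).
  case/frac_eqP => u [nu]; rewrite mulr1 mul1r => eu.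
  have : prime_set q (u * (phi f * g)).
    by rewrite -eu; apply: primeM; rewrite mulrC; exact: primeM.
  by case/primeP => //; apply: prime_mul => //; exact: spec_fun_compl.
have Do : open [set p : spec A | ~ prime_set p a].
  exists [set a]; rewrite predeqE => p; split=> [np|[_ [-> ]//]].
  by exists a.
pose D := opensI W1 (Opens Do).
have inv_subproof : locally_fraction (fun p (Dp : opens_set D p) =>
    frac f (proj2 Dp : ~ prime_set p a)).
  move=> p Dp; exists D, (fun _ => id), f, a; split=> // r Dr.
  by exists (proj2 Dr).
exists D, (fun p Dp => W1V p (proj1 Dp)), (Regular inv_subproof); split=> //.
apply: regular_ext => p Dp; rewrite reg1E /=.
have [nf ef] := e p (proj1 Dp); rewrite ef.
rewrite -(fracM _ _ _ _ (prime_mul nf (proj2 Dp : ~ prime_set p a))).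
by rewrite -(frac1 (@prime1 _ p)); apply: frac_eqI; ring.
Qed.

Definition Spec_map : mor (Spec B) (Spec A) :=
  @Mor (Spec B) (Spec A) spec_fun spec_fun_cont spec_sh spec_sh_nat spec_sh_local.

End SpecMap.

Lemma loc_map_reg (A B : comPzRingType) (phi : {rmorphism A -> B})
    (U : opens (spec A)) (s : regular U) (p p' : spec A) (q : spec B)
    (Up : opens_set U p) (Up' : opens_set U p')
    (h : forall a, ~ prime_set p a -> ~ prime_set q (phi a))
    (h' : forall a, ~ prime_set p' a -> ~ prime_set q (phi a)) :
  p = p' -> loc_map h (s p Up) = loc_map h' (s p' Up').
Proof.
move=> e; move: Up' h'; rewrite -e => Up' h'.
by rewrite (Prop_irrelevance Up Up') (Prop_irrelevance h h').
Qed.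

Lemma Spec_map_comp (A B C : comPzRingType) (psi : {rmorphism B -> C})
    (phi : {rmorphism A -> B}) (chi : {rmorphism A -> C}) :
  (forall a, chi a = psi (phi a)) ->
  Spec_map chi = mor_comp (Spec_map phi) (Spec_map psi).
Proof.
move=> e; have ef q : spec_fun chi q = spec_fun phi (spec_fun psi q).
  by apply: prime_ext => a; rewrite !spec_funE e.
apply: mor_ext => // V h s; apply: regular_ext => q Vq /=.
have [V' [V'V [a [f [V'q es]]]]] := regP s Vq.
have hq (p : spec A) : p = spec_fun phi (spec_fun psi q) ->
    forall b, ~ prime_set p b -> ~ prime_set q (chi b).
  by move=> -> b; rewrite !spec_funE e.
apply: etrans (loc_map_reg s _ Vq _ (hq _ erefl) (ef q)) _.
have [nf ef'] := es _ V'q; rewrite (reg_irr s Vq (V'V _ V'q)) ef' loc_mapE.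
set Vq' := (X in loc_map _ (loc_map _ (reg_fun s X))).
rewrite (reg_irr s Vq' (V'V _ V'q)) ef' [X in _ = loc_map _ X]loc_mapE loc_mapE.
by apply: frac_eqI; rewrite !e.
Qed.

Lemma Spec_map_id (A : comPzRingType) (X : rspace) (f : mor (Spec A) X)
    (phi : {rmorphism A -> A}) :
  (forall a, phi a = a) -> mor_comp f (Spec_map phi) = f.
Proof.
move=> e; have ef q : spec_fun phi q = q.
  by apply: prime_ext => a; rewrite !spec_funE e.
have fe q : f (spec_fun phi q) = f q by rewrite ef.
apply: mor_ext => // V h s; apply: regular_ext => q Vq /=.
have [V' [V'V [a [g [V'q es]]]]] := regP (mor_sh f V s) Vq.
have hq (p : spec A) : p = q ->
    forall b, ~ prime_set p b -> ~ prime_set q (phi b).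
  by move=> -> b; rewrite !e.
apply: etrans (loc_map_reg (mor_sh f V s) _ Vq _ (hq _ erefl) (ef q)) _.
have [ng eg] := es _ V'q.
rewrite (reg_irr (mor_sh f V s) Vq (V'V _ V'q)) eg !loc_mapE.
by apply: frac_eqI; rewrite !e.
Qed.

(* j is a homeomorphism onto an open subset U of Y, and it identifies the
   structure sheaf of X with the restriction of that of Y to U. *)
Definition open_immersion (X Y : rspace) (j : mor X Y) : Prop :=
  [/\ injective j,
      (forall U : set X, open U -> open (j @` U)) &
      (forall V : opens Y, V `<=` range j -> bijective (mor_sh j V))].

(* Every point has an open neighbourhood isomorphic to an affine scheme. The
   stalks of such a ringed space are local rings. *)
Definition is_scheme (X : rspace) : Prop :=
  forall x : X, exists (A : comPzRingType) (j : mor (Spec A) X),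
    open_immersion j /\ range j x.

(* For a morphism to an affine base these absolute notions agree with the
   relative ones. *)
Definition quasi_compact (X : rspace) : Prop := cover_compact [set: X].

Definition quasi_separated (X : rspace) : Prop :=
  forall U V : set X, open U -> open V ->
    cover_compact U -> cover_compact V -> cover_compact (U `&` V).

Record rscheme (R : comPzRingType) := Rscheme {
  rsch_space :> rspace;
  rsch_scheme : is_scheme rsch_space;
  rsch_str : mor rsch_space (Spec R) }.

Section RHom.
Variable R : comPzRingType.

Record rhom (T X : rscheme R) := Rhom {
  rhom_mor :> mor T X;
  rhomP : mor_comp (rsch_str X) rhom_mor = rsch_str T }.

Lemma rhom_ext (T X : rscheme R) (f g : rhom T X) :
  rhom_mor f = rhom_mor g -> f = g.
Proof.
case: f => f fP; case: g => g gP /= e; move: gP; rewrite -e => gP.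
by rewrite (Prop_irrelevance fP gP).
Qed.

Lemma rhom_comp_subproof (S T X : rscheme R) (f : rhom T X) (g : rhom S T) :
  mor_comp (rsch_str X) (mor_comp f g) = rsch_str S.
Proof. by rewrite mor_compA !rhomP. Qed.

Definition rhom_comp (S T X : rscheme R) (f : rhom T X) (g : rhom S T) :
  rhom S X := Rhom (rhom_comp_subproof f g).

Lemma rhom_compA (S T X Y : rscheme R) (f : rhom X Y) (g : rhom T X)
    (h : rhom S T) :
  rhom_comp f (rhom_comp g h) = rhom_comp (rhom_comp f g) h.
Proof. by apply: rhom_ext; exact: mor_compA. Qed.

End RHom.

Section MorId.
Variable X : rspace.

Lemma mor_id_cont : continuous (fun x : X => x).
Proof. by move=> x; exact: cvg_id. Qed.

Lemma mor_id_sub (V : opens X) : preim mor_id_cont V `<=` V.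
Proof. by []. Qed.

Definition mor_id_sh (V : opens X) : {rmorphism \O_X V -> \O_X (preim mor_id_cont V)} :=
  res \O_X (@mor_id_sub V).

Lemma mor_id_nat (V W : opens X) (h : W `<=` V) s :
  res \O_X (preim_sub h) (mor_id_sh V s) = mor_id_sh W (res \O_X h s).
Proof. by rewrite !res_trans; exact: res_irr. Qed.

Lemma mor_id_local (x : X) (V : opens X) (s : \O_X V) :
  opens_set V x -> unit_at x (mor_id_sh V s) -> unit_at x s.
Proof. by move=> _; exact: unit_at_res. Qed.

Definition mor_id : mor X X := Mor mor_id_nat mor_id_local.

Lemma open_immersion_id : open_immersion mor_id.
Proof.
split=> [x y // | U oU | V _].
  by rewrite (_ : _ @` U = U) // predeqE => x; split=> [[y ? <-] // | Ux]; exists x.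
have h : V `<=` preim mor_id_cont V by [].
by exists (res \O_X h) => s; rewrite /= res_trans res_id.
Qed.

End MorId.

Lemma mor_id_l (X Y : rspace) (f : mor X Y) : mor_comp (mor_id Y) f = f.
Proof.
apply: mor_ext => // V h s.
by rewrite /= -(mor_nat f (@mor_id_sub _ V)) !res_trans res_id.
Qed.

Lemma Spec_scheme (A : comPzRingType) : is_scheme (Spec A).
Proof.
move=> p; exists A, (mor_id (Spec A)).
by split; [exact: open_immersion_id | exists p].
Qed.

Definition rspec (R : comPzRingType) (A : calg R) : rscheme R :=
  Rscheme (@Spec_scheme A) (Spec_map (calg_str A)).

Lemma rspec_map_subproof (R : comPzRingType) (A B : calg R)
    (phi : calg_hom A B) :
  mor_comp (rsch_str (rspec A)) (Spec_map phi) = rsch_str (rspec B).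
Proof. by apply/esym/Spec_map_comp => r; rewrite calg_funP. Qed.

Definition rspec_map (R : comPzRingType) (A B : calg R) (phi : calg_hom A B) :
  rhom (rspec B) (rspec A) :=
  @Rhom R (rspec B) (rspec A) (Spec_map phi) (rspec_map_subproof phi).

Definition rbase (R : comPzRingType) : rscheme R :=
  Rscheme (@Spec_scheme R) (mor_id (Spec R)).

Definition rhom_base (R : comPzRingType) (T : rscheme R) : rhom T (rbase R) :=
  @Rhom R T (rbase R) (rsch_str T) (mor_id_l (rsch_str T)).

Lemma rhom_baseE (R : comPzRingType) (T : rscheme R) (f : rhom T (rbase R)) :
  f = rhom_base T.
Proof. by apply: rhom_ext; rewrite /= -(rhomP f) mor_id_l. Qed.

Definition glob (X : rspace) : comPzRingType := \O_X (opensT X).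

Lemma glob_sub (X Y : rspace) (f : mor X Y) :
  opensT X `<=` preim (mor_cont f) (opensT Y).
Proof. by []. Qed.

Definition pullback (X Y : rspace) (f : mor X Y) : {rmorphism glob Y -> glob X} :=
  res \O_X (@glob_sub _ _ f) \o mor_sh f (opensT Y).

Lemma pullback_comp (X Y Z : rspace) (g : mor Y Z) (f : mor X Y) s :
  pullback (mor_comp g f) s = pullback f (pullback g s).
Proof.
rewrite /pullback /= -(mor_nat f (@glob_sub _ _ g)) !res_trans.
exact: res_irr.
Qed.

(* The fibre product of X and Y over Spec R, by its universal property. *)
Record product (R : comPzRingType) (X Y : rscheme R) := Product {
  prod_sch :> rscheme R;
  prod_fst : rhom prod_sch X;
  prod_snd : rhom prod_sch Y;
  prod_pair : forall T : rscheme R, rhom T X -> rhom T Y -> rhom T prod_sch;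
  prod_fstK : forall T (f : rhom T X) (g : rhom T Y),
    rhom_comp prod_fst (prod_pair f g) = f;
  prod_sndK : forall T (f : rhom T X) (g : rhom T Y),
    rhom_comp prod_snd (prod_pair f g) = g;
  prod_uniq : forall T (h : rhom T prod_sch),
    h = prod_pair (rhom_comp prod_fst h) (rhom_comp prod_snd h) }.

Lemma prod_pair_comp (R : comPzRingType) (X Y : rscheme R) (P : product X Y)
    (S T : rscheme R) (f : rhom T X) (g : rhom T Y) (h : rhom S T) :
  rhom_comp (prod_pair P f g) h = prod_pair P (rhom_comp f h) (rhom_comp g h).
Proof. by rewrite [LHS]prod_uniq !rhom_compA prod_fstK prod_sndK. Qed.

(* The affine line Spec R[t], by its universal property: an R-morphism from T
   to it is the same as a global function on T, the pullback of t. *)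
Record affine_line (R : comPzRingType) := AffineLine {
  al_sch :> rscheme R;
  al_coord : glob al_sch;
  al_mor : forall T : rscheme R, glob T -> rhom T al_sch;
  al_morK : forall (T : rscheme R) (a : glob T), pullback (al_mor a) al_coord = a;
  al_uniq : forall (T : rscheme R) (h : rhom T al_sch), h = al_mor (pullback h al_coord) }.

Lemma al_mor_comp (R : comPzRingType) (L : affine_line R) (S T : rscheme R)
    (a : glob T) (h : rhom S T) :
  rhom_comp (al_mor L a) h = al_mor L (pullback h a).
Proof. by rewrite [LHS]al_uniq pullback_comp al_morK. Qed.

Section ModuleLaws.
Variables (R : comPzRingType) (X : rscheme R) (L : affine_line R).
Variables (XX : product X X) (LX : product L X).
Variables (add : rhom XX X) (zero : rhom (rbase R) X) (opp : rhom X X).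
Variable act : rhom LX X.

Definition pt_add (T : rscheme R) (x y : rhom T X) : rhom T X :=
  rhom_comp add (prod_pair XX x y).
Definition pt_zero (T : rscheme R) : rhom T X := rhom_comp zero (rhom_base T).
Definition pt_opp (T : rscheme R) (x : rhom T X) : rhom T X := rhom_comp opp x.
Definition pt_act (T : rscheme R) (a : glob T) (x : rhom T X) : rhom T X :=
  rhom_comp act (prod_pair LX (al_mor L a) x).

(* The commutative diagrams of a commutative group scheme with a linear action
   of the ring scheme L, evaluated on T-valued points for all T. *)
Record module_laws : Prop := ModuleLaws {
  pt_addA : forall T (x y z : rhom T X),
    pt_add x (pt_add y z) = pt_add (pt_add x y) z;
  pt_addC : forall T (x y : rhom T X), pt_add x y = pt_add y x;
  pt_add0 : forall T (x : rhom T X), pt_add (pt_zero T) x = x;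
  pt_addN : forall T (x : rhom T X), pt_add (pt_opp x) x = pt_zero T;
  pt_actA : forall (T : rscheme R) (a b : glob T) (x : rhom T X),
    pt_act a (pt_act b x) = pt_act (a * b) x;
  pt_act1 : forall T (x : rhom T X), pt_act 1 x = x;
  pt_actDr : forall (T : rscheme R) (a : glob T) (x y : rhom T X),
    pt_act a (pt_add x y) = pt_add (pt_act a x) (pt_act a y);
  pt_actDl : forall (T : rscheme R) (a b : glob T) (x : rhom T X),
    pt_act (a + b) x = pt_add (pt_act a x) (pt_act b x) }.

Lemma pt_add_comp (S T : rscheme R) (x y : rhom T X) (h : rhom S T) :
  rhom_comp (pt_add x y) h = pt_add (rhom_comp x h) (rhom_comp y h).
Proof. by rewrite /pt_add -rhom_compA prod_pair_comp. Qed.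

Lemma pt_act_comp (S T : rscheme R) (a : glob T) (x : rhom T X) (h : rhom S T) :
  rhom_comp (pt_act a x) h = pt_act (pullback h a) (rhom_comp x h).
Proof. by rewrite /pt_act -rhom_compA prod_pair_comp al_mor_comp. Qed.

End ModuleLaws.

Record module_scheme (R : comPzRingType) := ModuleScheme {
  ms_sch :> rscheme R;
  ms_line : affine_line R;
  ms_XX : product ms_sch ms_sch;
  ms_LX : product ms_line ms_sch;
  ms_add : rhom ms_XX ms_sch;
  ms_zero : rhom (rbase R) ms_sch;
  ms_opp : rhom ms_sch ms_sch;
  ms_act : rhom ms_LX ms_sch;
  ms_laws : module_laws ms_add ms_zero ms_opp ms_act }.

(* On X(A) = Hom_R(Spec A, X), an element of A acts as the corresponding
   global function on Spec A. *)

Definition spec_const (A : comPzRingType) (a : A) : glob (Spec A) :=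
  reg_cst (opensT (Spec A)) a.

Lemma spec_const1 (A : comPzRingType) : spec_const (1 : A) = 1.
Proof. by []. Qed.

Lemma spec_constD (A : comPzRingType) (a b : A) :
  spec_const (a + b) = spec_const a + spec_const b.
Proof.
apply: regular_ext => p Up /=.
rewrite -(fracD _ _ _ _ (prime_mul (@prime1 _ p) (@prime1 _ p))).
by apply: frac_eqI; ring.
Qed.

Lemma spec_constM (A : comPzRingType) (a b : A) :
  spec_const (a * b) = spec_const a * spec_const b.
Proof.
apply: regular_ext => p Up /=.
rewrite -(fracM _ _ _ _ (prime_mul (@prime1 _ p) (@prime1 _ p))).
by apply: frac_eqI; ring.
Qed.

Lemma pullback_spec_const (A B : comPzRingType) (phi : {rmorphism A -> B}) a :
  pullback (Spec_map phi) (spec_const a) = spec_const (phi a).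
Proof.
apply: regular_ext => p Up; rewrite /= loc_mapE.
by apply: frac_eqI; rewrite rmorph1.
Qed.

Section Points.
Variables (R : comPzRingType) (X : module_scheme R).

Definition points (A : calg R) : Type := rhom (rspec A) X.

Section Module.
Variable A : calg R.

HB.instance Definition _ := gen_eqMixin (points A).
HB.instance Definition _ := gen_choiceMixin (points A).

Definition points_zero : points A := pt_zero (ms_zero X) (rspec A).
Definition points_opp (x : points A) : points A := pt_opp (ms_opp X) x.
Definition points_add (x y : points A) : points A := pt_add (ms_add X) x y.
Definition points_scale (a : A) (x : points A) : points A :=
  pt_act (T := rspec A) (ms_act X) (spec_const a) x.

Lemma points_addA : associative points_add.
Proof. exact: (pt_addA (ms_laws X)). Qed.

Lemma points_addC : commutative points_add.
Proof. exact: (pt_addC (ms_laws X)). Qed.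

Lemma points_add0 : left_id points_zero points_add.
Proof. exact: (pt_add0 (ms_laws X)). Qed.

Lemma points_addN : left_inverse points_zero points_opp points_add.
Proof. exact: (pt_addN (ms_laws X)). Qed.

HB.instance Definition _ := GRing.isZmodule.Build (points A)
  points_addA points_addC points_add0 points_addN.

Lemma points_scaleA a b x :
  points_scale a (points_scale b x) = points_scale (a * b) x.
Proof. by rewrite /points_scale (pt_actA (ms_laws X)) spec_constM. Qed.

Lemma points_scale1 : left_id 1 points_scale.
Proof. by move=> x; rewrite /points_scale spec_const1 (pt_act1 (ms_laws X)). Qed.

Lemma points_scaleDr : right_distributive points_scale +%R.
Proof. by move=> a x y; exact: (pt_actDr (ms_laws X)). Qed.

Lemma points_scaleDl x : {morph points_scale^~ x : a b / a + b}.
Proof.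
by move=> a b; rewrite /points_scale spec_constD (pt_actDl (ms_laws X)).
Qed.

HB.instance Definition _ := GRing.Zmodule_isLmodule.Build A (points A)
  points_scaleA points_scale1 points_scaleDr points_scaleDl.

End Module.

Definition points_map (A B : calg R) (phi : calg_hom A B) (x : points A) :
  points B := rhom_comp x (rspec_map phi).

Lemma points_mapD (A B : calg R) (phi : calg_hom A B) (x y : points A) :
  points_map phi (x + y) = points_map phi x + points_map phi y.
Proof. exact: pt_add_comp. Qed.

Lemma points_mapZ (A B : calg R) (phi : calg_hom A B) (a : A) (x : points A) :
  points_map phi (a *: x) = phi a *: points_map phi x.
Proof.
apply: etrans (pt_act_comp _ _ _ _) _.
by rewrite [pullback _ _]pullback_spec_const.
Qed.

Lemma points_map_id (A : calg R) (x : points A) :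
  points_map (calg_id A) x = x.
Proof. by apply: rhom_ext; exact: Spec_map_id. Qed.

Lemma points_map_comp (A B C : calg R) (psi : calg_hom B C)
    (phi : calg_hom A B) (x : points A) :
  points_map (calg_comp psi phi) x = points_map psi (points_map phi x).
Proof.
apply: rhom_ext; rewrite /= -mor_compA; congr mor_comp.
exact: Spec_map_comp.
Qed.

Definition functor_of_points : module_functor R :=
  @ModuleFunctor R (fun A => points A) points_map points_mapD points_mapZ
    points_map_id points_map_comp.

End Points.

Definition is_qcqs_module_scheme (R : comPzRingType) (F : module_functor R) :
  Prop :=
  exists X : module_scheme R,
    [/\ quasi_compact X, quasi_separated X & mf_iso F (functor_of_points X)].

(* Main.v *)
(* If M is the image of an idempotent matrix E, then M (x) A is the module of
   fixed vectors of E in A^n, which is represented by an affine scheme.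

   Conversely let X represent A |-> M (x) A; only the underlying functors of sets
   matter.  For an injection N -> P of R-modules, Spec (R + P) -> Spec (R + N),
   for the square-zero extensions, is an epimorphism of ringed spaces, so that
   M (x) (R + N) -> M (x) (R + P) is injective: M is flat.  Take a finite affine
   cover of X by U_i = Spec B_i, and write the universal elements in M (x) B_i as
   sum_a v_a (x) x_ia with common elements v_a of M.  The vanishing of
   sum_a v_a (x) (x_ia - x_ja) over U_i and U_j, the equational criterion of
   flatness, and the quasi-compactness of the intersections of the U_i allow one
   to choose the v_a so that x_ia = x_ja on these intersections.  Then
   the x_ia glue to global functions Y_a on X, and every m in M (x) A = X(A) is
   sum_a v_a (x) Y_a(m).  Taking derivatives of the Y_a at 0, with the help of dual
   numbers, turns this identity into a finite dual basis of M. *)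

From HB Require Import structures.
From mathcomp Require Import all_boot all_algebra generic_quotient ring finmap.
From mathcomp Require Import boolp classical_sets topology_structure compact.
Require Import Defs.

Set Implicit Arguments.
Unset Strict Implicit.
Unset Printing Implicit Defensive.

Import GRing.Theory.
Local Open Scope ring_scope.
Local Open Scope quotient_scope.
Local Open Scope classical_set_scope.

(** * Prime ideals and localization *)

(** Equal tensors need not have equal coefficients: over U_i and U_j the universal elements agree
    while the x_ia and x_ja are unrelated. Flatness repairs this by rewriting the v_a in new
    elements, but only for one vanishing sum at a time, and a later rewriting must not destroy an
    earlier gain. As the coefficients change by R-linear combinations only and the conditions on
    them are R-linear, what has been achieved persists; quasi-separatedness leaves finitely many
    conditions. The functions Y_a need not be linear in the points of M (x) A, which is why they are
    differentiated: the derivative at 0 is linear because it can be computed at m (x) eps_1 + m' (x)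
    eps_2 over the square-zero extension R + R^2. In the other direction, products and the affine
    line are given by universal properties among all R-schemes T, so morphisms T -> Spec B must be
    matched with ring morphisms B -> O(T) for every scheme T. *)

Definition ideal (A : comPzRingType) (I : set A) : Prop :=
  [/\ I 0, (forall a b, I a -> I b -> I (a + b)) &
      (forall a b, I b -> I (a * b))].

Lemma prime_avoidance (A : comPzRingType) (I : set A) (h : A) :
  ideal I -> (forall n, ~ I (h ^+ n)) ->
  exists p : spec A, I `<=` prime_set p /\ ~ prime_set p h.
Proof.
move=> [I0 ID IM] hI.
(* The empty chain has empty union, so the empty set must satisfy [P]: containing [I] is required of
   nonempty [J] only, and maximality excludes the empty set afterwards. *)
pose P (J : set A) := [/\ (forall a b, J a -> J b -> J (a + b)),
  (forall a b, J b -> J (a * b)), (forall a, J a -> I `<=` J) &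
  forall n, ~ J (h ^+ n)].
have [|J [[JD JM JI Jh] Jmax]] := @Zorn_bigcup A P.
  move=> F FP Ftot; split=> [a b [X FX Xa] [Y FY Yb]|a b [X FX Xb]|a [X FX Xa]|n [X FX]].
  - have [XY|YX] := Ftot X Y FX FY.
    + by exists Y => //; have [+ _ _ _] := FP Y FY; apply=> //; exact: XY.
    + by exists X => //; have [+ _ _ _] := FP X FX; apply=> //; exact: YX.
  - by exists X => //; have [_ + _ _] := FP X FX; apply.
  - move=> b Ib; exists X => //; have [_ _ + _] := FP X FX; apply; first exact: Xa.
    by [].
  - by have [_ _ _] := FP X FX; apply.
have IJ : I `<=` J.
  apply: contrapT => nIJ; apply: (Jmax I); last by split=> // a Ia.
  split; last by move=> IJ; apply: nIJ; apply: JI (IJ _ I0).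
  by move=> a Ja; case: nIJ; exact: JI Ja.
have big a : ~ J a -> exists n b c, J b /\ h ^+ n = b + c * a.
  move=> Ja; pose K := [set x | exists b c, J b /\ x = b + c * a].
  have JK : J `<=` K by move=> b Jb; exists b, 0; split=> //; rewrite mul0r addr0.
  apply: contrapT => nh; apply: (Jmax K).
    split=> // KJ; apply: Ja; apply: KJ; exists 0, 1.
    by split; [exact: IJ | rewrite mul1r add0r].
  split=> [_ _ [b [c [Jb ->]]] [b' [c' [Jb' ->]]]|r _ [b [c [Jb ->]]]|x _ y Iy|n [b [c [Jb
    e]]]].
  - by exists (b + b'), (c + c'); split; [exact: JD | ring].
  - by exists (r * b), (r * c); split; [exact: JM | ring].
  - by apply/JK/IJ.
  - by apply: nh; exists n, b, c.
have JP a b : J (a * b) -> J a \/ J b.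
  move=> Jab; apply: contrapT => /not_orP[/big[n [x [y [Jx e]]]] /big[m [z [t [Jz e']]]]].
  apply: (Jh (n + m)%N); rewrite exprD e e'.
  have -> : (x + y * a) * (z + t * b) = (z + t * b) * x + (y * a * z + y * t * (a * b)).
    by ring.
  by apply: (JD); [exact: JM | apply: (JD); exact: JM].
have J1 : ~ J 1 by have := Jh 0%N; rewrite expr0.
exists (@Prime A J (IJ _ I0) JD JM J1 JP); split=> //=.
by have := Jh 1%N; rewrite expr1.
Qed.

(** The substitute for partitions of unity: the [b] for which a statement holds after multiplication
    by [b], or on the basic open set of [b], form an ideal, and local solutions at all primes force
    it to contain 1. *)
Lemma ideal_full (A : comPzRingType) (I : set A) :
  ideal I -> (forall p : spec A, exists2 u, I u & ~ prime_set p u) -> I 1.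
Proof.
move=> idI Ip; apply: contrapT => nI1.
have [n|p [Isub _]] := prime_avoidance (h := 1) idI; first by rewrite expr1n.
by have [u Iu] := Ip p; apply; exact: Isub.
Qed.

Lemma ideal_power (A : comPzRingType) (I : set A) (h : A) : ideal I ->
  (forall p : spec A, ~ prime_set p h -> exists2 u, I u & ~ prime_set p u) ->
  exists n, I (h ^+ n).
Proof.
move=> idI Ip; apply: contrapT => /forallNP nI.
have [p [Isub nph]] := prime_avoidance idI nI.
by have [u Iu] := Ip p nph; apply; exact: Isub.
Qed.

Lemma ideal_ann (A : comPzRingType) (V : lmodType A) (x : V) :
  ideal [set a : A | a *: x = 0].
Proof.
split=> [|a b /= ax bx|a b /= bx]; first by rewrite /= scale0r.
  by rewrite scalerDl ax bx addr0.
by rewrite -scalerA bx scaler0.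
Qed.

Lemma prime_exp (A : comPzRingType) (p : spec A) a n :
  ~ prime_set p a -> ~ prime_set p (a ^+ n).
Proof.
move=> na; elim: n => [|n IHn]; first by rewrite expr0; exact: prime1.
by rewrite exprS; exact: prime_mul.
Qed.

Lemma frac_eq0 (A : comPzRingType) (p : spec A) (a s : A) (ns : ~ prime_set p s) :
  frac a ns = 0 <-> exists2 u, ~ prime_set p u & u * a = 0.
Proof.
rewrite -(frac0 ns); split.
  case/frac_eqP=> u [nu]; rewrite mul0r mulr0 => e.
  by exists (u * s); [exact: prime_mul | rewrite -mulrA (mulrC s)].
by case=> u nu e; apply/frac_eqP; exists u; rewrite mulrA e !mul0r mulr0.
Qed.

Section Stalk.
Variables (A : comPzRingType) (p : spec A).

Definition loc_in (a : A) : loc p := frac a (@prime1 A p).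

Lemma loc_in_zmod : zmod_morphism loc_in.
Proof.
move=> a b; rewrite /loc_in -fracN -(fracD _ _ _ _ (prime_mul (@prime1 A p) (@prime1 A p))).
by apply: frac_eqI; ring.
Qed.

Lemma loc_in_monoid : monoid_morphism loc_in.
Proof.
split=> [|a b]; first exact: frac1.
rewrite /loc_in -(fracM _ _ _ _ (prime_mul (@prime1 A p) (@prime1 A p))).
by apply: frac_eqI; ring.
Qed.

HB.instance Definition _ := GRing.isZmodMorphism.Build A (loc p) loc_in loc_in_zmod.
HB.instance Definition _ := GRing.isMonoidMorphism.Build A (loc p) loc_in loc_in_monoid.

Lemma loc_in_frac a s (ns : ~ prime_set p s) : loc_in s * frac a ns = loc_in a.
Proof.
rewrite /loc_in -(fracM _ _ _ _ (prime_mul (@prime1 A p) ns)).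
by apply: frac_eqI; ring.
Qed.

Lemma loc_in_unit s : ~ prime_set p s -> exists t, loc_in s * t = 1.
Proof. by move=> ns; exists (frac 1 ns); rewrite loc_in_frac rmorph1. Qed.

Lemma loc_in_reg s x y : ~ prime_set p s -> loc_in s * x = loc_in s * y -> x = y.
Proof.
move=> /loc_in_unit[t st] e; rewrite -[x]mul1r -[y]mul1r -st.
by rewrite ![_ * t]mulrC -!mulrA e.
Qed.

Lemma loc_in_eq0 a : loc_in a = 0 <-> exists2 u, ~ prime_set p u & u * a = 0.
Proof. exact: frac_eq0. Qed.

Lemma frac_unit a s (ns : ~ prime_set p s) y : frac a ns * y = 1 -> ~ prime_set p a.
Proof.
move=> e pa; have {e} : loc_in a * y = loc_in s by rewrite -(loc_in_frac a ns) -mulrA e mulr1.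
elim/loc_ind: y => b t nt e.
have /esym/eqP : loc_in t * (loc_in a * frac b nt) = loc_in t * loc_in s by rewrite e.
rewrite mulrCA loc_in_frac -!rmorphM -subr_eq0 -rmorphB => /eqP/loc_in_eq0[u nu].
rewrite mulrBr => /eqP; rewrite subr_eq0 => /eqP e'.
apply: (prime_mul nu (prime_mul nt ns)); rewrite e'; apply: primeM.
by rewrite mulrC; exact: primeM.
Qed.

End Stalk.

Definition loc_alg (R : comPzRingType) (A : calg R) (p : spec A) : calg R :=
  @Calg R (loc p) (@loc_in A p \o calg_str A).

Definition loc_hom (R : comPzRingType) (A : calg R) (p : spec A) :
  calg_hom A (loc_alg p) := @CalgHom R A (loc_alg p) (@loc_in A p) (fun r => erefl).

(** * Tensor products *)

Section LocRepr.
Variables (A : comPzRingType) (p : spec A).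
Implicit Types x y : loc p.

Lemma frac_reprE x : frac (num (repr x)) (@den_ok _ p (repr x)) = x.
Proof. by rewrite -[RHS]reprK /frac; congr loc_class; case: (repr x). Qed.

(** Chosen representatives of fractions respect sums only up to a factor outside [p]. The
    denominators are cleared in the form in which additivity is checked in [tensor_loc_eq0]. *)
Lemma repr_locD x y : exists2 u, ~ prime_set p u &
  u * (den (repr x) * den (repr y)) * num (repr (x + y)) =
  u * den (repr (x + y)) * (den (repr y) * num (repr x) + den (repr x) * num (repr y)).
Proof.
have /frac_eqP[u [nu e]] : frac (num (repr (x + y))) (@den_ok _ p (repr (x + y))) =
    frac (num (repr x) * den (repr y) + num (repr y) * den (repr x))
      (prime_mul (@den_ok _ p (repr x)) (@den_ok _ p (repr y))).
  rewrite frac_reprE (fracD _ _ (@den_ok _ p (repr x)) (@den_ok _ p (repr y))).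
  by rewrite !frac_reprE.
exists u => //; transitivity (u * (num (repr (x + y)) * (den (repr x) * den (repr y)))).
  by ring.
by rewrite e; ring.
Qed.

Lemma repr_locM a x : exists2 u, ~ prime_set p u &
  u * den (repr (loc_in p a * x)) * (a * num (repr x)) =
  u * den (repr x) * num (repr (loc_in p a * x)).
Proof.
have /frac_eqP[u [nu e]] : frac (num (repr (loc_in p a * x)))
    (@den_ok _ p (repr (loc_in p a * x))) =
    frac (a * num (repr x)) (prime_mul (@prime1 _ p) (@den_ok _ p (repr x))).
  by rewrite frac_reprE (fracM _ _ (@prime1 _ p) (@den_ok _ p (repr x))) frac_reprE.
exists u => //; transitivity (u * (a * num (repr x) * den (repr (loc_in p a * x)))).
  by ring.
by rewrite -e; ring.
Qed.

End LocRepr.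

Section TensorTheory.
Variables (R : comPzRingType) (M : lmodType R).
Implicit Types A B C : calg R.

Definition pure A (m : M) (a : A) : tensor M A := tensor_class [:: (m, a)].

Lemma tensor_class0 A : tensor_class [::] = 0 :> tensor M A.
Proof. by []. Qed.

Lemma tensor_class_cat A (s t : seq (M * A)) :
  tensor_class (s ++ t) = tensor_class s + tensor_class t.
Proof. exact/esym/tensor_addE. Qed.

Lemma tensor_classE A (s : seq (M * A)) :
  tensor_class s = \sum_(i < size s) pure (tnth (in_tuple s) i).1 (tnth (in_tuple s) i).2.
Proof.
rewrite -(big_tuple _ _ (in_tuple s) xpredT (fun p => pure p.1 p.2)) /=.
elim: s => [|[m a] s IHs]; first by rewrite big_nil.
by rewrite big_cons -IHs -tensor_class_cat.
Qed.

Lemma tensor_pureP A (x : tensor M A) : exists (I : finType) (v : I -> M) (c : I -> A),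
  x = \sum_i pure (v i) (c i).
Proof.
elim/tensor_ind: x => s.
exists 'I_(size s), (fun i => (tnth (in_tuple s) i).1), (fun i => (tnth (in_tuple s) i).2).
exact: tensor_classE.
Qed.

Lemma pureDl A m m' (a : A) : pure (m + m') a = pure m a + pure m' a.
Proof. by rewrite /pure -tensor_class_cat; apply/tensor_eq/tensor_Dl. Qed.

Lemma pureDr A m (a a' : A) : pure m (a + a') = pure m a + pure m a'.
Proof. by rewrite /pure -tensor_class_cat; apply/tensor_eq/tensor_Dr. Qed.

Lemma pureZ A r m (a : A) : pure (r *: m) a = pure m (calg_str A r * a).
Proof. exact/tensor_eq/tensor_balanced. Qed.

Lemma pure0l A (a : A) : pure 0 a = 0.
Proof. exact/tensor_eq/tensor_0l. Qed.

Lemma pure0r A m : pure m (0 : A) = 0.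
Proof. by rewrite -[0](mul0r 0) -(rmorph0 (calg_str A)) -pureZ scale0r pure0l. Qed.

Lemma scale_pure A (b : A) m a : b *: pure m a = pure m (b * a).
Proof. exact: tensor_scaleE. Qed.

Lemma pureBr A m (a a' : A) : pure m (a - a') = pure m a - pure m a'.
Proof. by rewrite pureDr -[- a']mulN1r -scale_pure scaleN1r. Qed.

Lemma pure_suml A (I : finType) (v : I -> M) (a : A) :
  pure (\sum_i v i) a = \sum_i pure (v i) a.
Proof.
by apply: (big_morph (fun m => pure m a)) => [m m'|]; [exact: pureDl | exact: pure0l].
Qed.

Lemma pure_sumr A (I : finType) m (c : I -> A) :
  pure m (\sum_i c i) = \sum_i pure m (c i).
Proof.
by apply: (big_morph (pure m)) => [a a'|]; [exact: pureDr | exact: pure0r].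
Qed.

Lemma tensor_map_pure A B (phi : calg_hom A B) m a :
  tensor_map phi (pure m a) = pure m (phi a).
Proof. exact: tensor_mapE. Qed.

Lemma tensor_map0 A B (phi : calg_hom A B) : tensor_map phi (0 : tensor M A) = 0.
Proof. exact: tensor_mapE. Qed.

Lemma tensor_map_sum A B (phi : calg_hom A B) (I : finType) (F : I -> tensor M A) :
  tensor_map phi (\sum_i F i) = \sum_i tensor_map phi (F i).
Proof.
by apply: (big_morph (tensor_map phi)) => [x y|]; [exact: tensor_mapD | exact: tensor_map0].
Qed.

Lemma tensor_map_pure_sum A B (phi : calg_hom A B) (I : finType) (v : I -> M) (c : I -> A) :
  tensor_map phi (\sum_i pure (v i) (c i)) = \sum_i pure (v i) (phi (c i)).
Proof. by rewrite tensor_map_sum; apply: eq_bigr => i _; exact: tensor_map_pure. Qed.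

(* The universal property, with values in a commutative monoid given up to an
   equivalence relation: this avoids forming the quotients that appear as targets. *)
Lemma tensor_rel_fold A (E : Type) (eqE : E -> E -> Prop) (add : E -> E -> E) (e0 : E)
    (f : M -> A -> E) (F := fun s : seq (M * A) => foldr (fun p => add (f p.1 p.2)) e0 s) :
  (forall x, eqE x x) -> (forall x y, eqE x y -> eqE y x) ->
  (forall x y z, eqE x y -> eqE y z -> eqE x z) ->
  (forall x x' y y', eqE x x' -> eqE y y' -> eqE (add x y) (add x' y')) ->
  (forall x y z, eqE (add x (add y z)) (add (add x y) z)) ->
  (forall x y, eqE (add x y) (add y x)) -> (forall x, eqE (add e0 x) x) ->
  (forall a, eqE (f 0 a) e0) ->
  (forall m m' a, eqE (f (m + m') a) (add (f m a) (f m' a))) ->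
  (forall m a a', eqE (f m (a + a')) (add (f m a) (f m a'))) ->
  (forall r m a, eqE (f (r *: m) a) (f m (calg_str A r * a))) ->
  forall s t, tensor_rel s t -> eqE (F s) (F t).
Proof.
move=> erefl' esym' etr econg eA eC e0E f0 fDl fDr fZ.
have F_cat s t : eqE (F (s ++ t)) (add (F s) (F t)).
  elim: s => [|p s IHs] /=; first exact: esym'.
  by apply: (etr) (eA _ _ _); apply: (econg).
have eD x y z : eqE x (add y z) -> eqE (add x e0) (add y (add z e0)).
  by move=> e; apply: (etr) (esym' _ _ (eA _ _ _)); apply: (econg).
have eD0 x y : eqE x y -> eqE (add x e0) (add y e0) by move=> e; apply: (econg).
move=> s t; elim=> {s t}; rewrite /F /=.
- by [].
- by move=> s t _; exact: esym'.
- by move=> s t u _ h _; exact: etr.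
- move=> s s' t t' _ h _ k.
  by apply: (etr) (F_cat _ _) _; apply: (etr) (esym' _ _ (F_cat _ _)); apply: (econg).
- move=> s t; apply: (etr) (F_cat _ _) _; apply: (etr) (eC _ _) _; exact/esym'/F_cat.
- by move=> a; apply: (etr) (e0E e0); apply: (econg).
- by move=> m m' a; exact: eD.
- by move=> m a a'; exact: eD.
- by move=> r m a; exact: eD0.
Qed.

Lemma tensor_lift A (V : zmodType) (f : M -> A -> V) :
  (forall m m' a, f (m + m') a = f m a + f m' a) ->
  (forall m a a', f m (a + a') = f m a + f m a') ->
  (forall r m a, f (r *: m) a = f m (calg_str A r * a)) ->
  exists g : {additive tensor M A -> V}, forall m a, g (pure m a) = f m a.
Proof.
move=> fDl fDr fZ.
have f0 a : f 0 a = 0 by apply: (addIr (f 0 a)); rewrite -fDl !add0r.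
pose F (s : seq (M * A)) := foldr (fun p => +%R (f p.1 p.2)) 0 s.
have Frel s t : tensor_rel s t -> F s = F t.
  apply: (@tensor_rel_fold A V eq) => //.
  - by move=> x y z ->.
  - by move=> x x' y y' -> ->.
  - exact: addrA.
  - exact: addrC.
  - exact: add0r.
have F_cat s t : F (s ++ t) = F s + F t.
  by elim: s => [|p s IHs] /=; rewrite ?add0r // IHs addrA.
pose g (x : tensor M A) := F (repr x).
have gE s : g (tensor_class s) = F s by apply: Frel; exact: tensor_repr.
have gB : zmod_morphism g.
  move=> x y; apply: (addIr (g y)); rewrite subrK.
  have gD u v : g (u + v) = g u + g v.
    elim/tensor_ind: u => s; elim/tensor_ind: v => t.
    by rewrite -tensor_class_cat !gE F_cat.
  by rewrite -gD subrK.
pose gm := GRing.isZmodMorphism.Build _ _ g gB.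
exists (HB.pack_for {additive tensor M A -> V} g gm).
by move=> m a /=; rewrite gE /= addr0.
Qed.

(* The target is the localized module M (x) A_p, whose elements are represented by
   pairs of a denominator and an element of M (x) A. *)
Lemma tensor_loc_eq0 A (p : spec A) (x : tensor M A) :
  tensor_map (loc_hom p) x = 0 -> exists2 u, ~ prime_set p u & u *: x = 0.
Proof.
pose E := {k : A * tensor M A | ~ prime_set p k.1}.
pose eqE (x y : E) := exists2 u, ~ prime_set p u &
  (u * (sval y).1) *: (sval x).2 = (u * (sval x).1) *: (sval y).2.
have mkE k (y : tensor M A) : ~ prime_set p k -> E by move=> nk; exists (k, y).
pose add (x y : E) : E := exist (fun k => ~ prime_set p k.1)
  ((sval x).1 * (sval y).1, (sval y).1 *: (sval x).2 + (sval x).1 *: (sval y).2)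
  (prime_mul (svalP x) (svalP y)).
pose e0 : E := exist (fun k => ~ prime_set p k.1) (1, 0) (@prime1 _ p).
pose f m (a : loc_alg p) : E := exist (fun k => ~ prime_set p k.1)
  (den (repr (a : loc p)), pure m (num (repr (a : loc p)))) (@den_ok _ p _).
have eE x' y : (sval y).1 *: (sval x').2 = (sval x').1 *: (sval y).2 -> eqE x' y.
  by move=> e; exists 1; rewrite ?mul1r //; exact: prime1.
have etr x' y z : eqE x' y -> eqE y z -> eqE x' z.
  case: x' y z => [[a u] na] [[b v] nb] [[c w] nc]; rewrite /eqE /=.
  move=> [r nr e] [t nt e']; exists (r * t * b); first by do ?apply: prime_mul.
  transitivity ((t * c) *: ((r * b) *: u)); first by rewrite scalerA; congr (_ *: _); ring.
  rewrite e scalerA; transitivity ((r * a) *: ((t * c) *: v)).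
    by rewrite scalerA; congr (_ *: _); ring.
  by rewrite e' scalerA; congr (_ *: _); ring.
have esm x' y : eqE x' y -> eqE y x' by case=> u nu e; exists u.
have econg x1 x2 y1 y2 : eqE x1 x2 -> eqE y1 y2 -> eqE (add x1 y1) (add x2 y2).
  case: x1 x2 y1 y2 => [[a u] na] [[b v] nb] [[c w] nc] [[d z] nd]; rewrite /eqE /=.
  move=> [r nr e] [t nt e']; exists (r * t); first exact: prime_mul.
  rewrite !scalerDr !scalerA; congr (_ + _).
    transitivity ((t * c * d) *: ((r * b) *: u)); first by rewrite scalerA; congr (_ *: _);
      ring.
    by rewrite e scalerA; congr (_ *: _); ring.
  transitivity ((r * a * b) *: ((t * d) *: w)); first by rewrite scalerA; congr (_ *: _); ring.
  by rewrite e' scalerA; congr (_ *: _); ring.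
have rel s t := @tensor_rel_fold (loc_alg p) E eqE add e0 f _ _ _ _ _ _ _ _ _ _ _ s t.
have {}rel s t : tensor_rel s t ->
    eqE (foldr (fun q => add (f q.1 q.2)) e0 s) (foldr (fun q => add (f q.1 q.2)) e0 t).
  apply: rel => //.
  - by move=> y; apply: eE.
  - by move=> y z w; apply: eE; rewrite /= !scalerDr !scalerA !addrA;
      congr (_ *: _ + _ *: _ + _ *: _); ring.
  - by move=> y z; apply: eE; rewrite /= !scalerDr !scalerA addrC; congr (_ *: _ + _ *: _);
      ring.
  - by move=> y; apply: eE; rewrite /= scaler0 add0r !scalerA; congr (_ *: _); ring.
  - by move=> a; apply: eE; rewrite /= pure0l !scaler0.
  - by move=> m m' a; apply: eE; rewrite /= pureDl !scalerDr !scalerA.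
  - move=> m a a'; have [u nu e] := repr_locD (a : loc p) (a' : loc p).
    by exists u => //=; rewrite !scale_pure -pureDr scale_pure e.
  - move=> r m a; have [u nu e] := repr_locM (calg_str A r) (a : loc p).
    by exists u => //=; rewrite pureZ !scale_pure e.
have PhiE s : eqE (foldr (fun q => add (f q.1 q.2)) e0 (map (tensor_map_term (loc_hom p)) s))
    (exist (fun k => ~ prime_set p k.1) (1, tensor_class s) (@prime1 _ p)).
  elim: s => [|[m a] s IHs] /=; first exact: eE.
  apply: (etr) (_ : eqE _ (add (exist (fun k =>
    ~ prime_set p k.1) (1, pure m a) (@prime1 _ p)) _)) _.
    apply: (econg) IHs; have := frac_reprE (loc_in p a); case/frac_eqP=> u [nu e].
    exists u => //=; rewrite !scale_pure; congr pure; move: e.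
    by rewrite !mulr1 => ->; ring.
  by apply: eE; rewrite /= !scale1r mulr1 scale1r -(tensor_class_cat [:: _]).
elim/tensor_ind: x => s; rewrite tensor_mapE => /tensor_eq/rel e.
have [u nu] := etr _ _ _ (esm _ _ (PhiE s)) e.
by rewrite /= !mulr1 scaler0 => ux; exists u.
Qed.

End TensorTheory.

(** * The spectrum of a ring *)

Section CoverCompact.
Variable T : topologicalType.

(** Compactness as an induction principle, so that its users never handle finite subcovers. Heredity
    enters because the finite union of good open sets only contains [A]. *)
Lemma cover_compact_ind (A : set T) (P : set T -> Prop) :
  cover_compact A -> P set0 -> (forall U V, P U -> P V -> P (U `|` V)) ->
  (forall U V, U `<=` V -> P V -> P U) ->
  (forall x, A x -> exists U, [/\ open U, U x & P U]) -> P A.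
Proof.
move=> cA P0 PU Psub Ploc.
have /choice[f fP] x : exists U, A x -> [/\ open U, U x & P U].
  by have [/Ploc[U UP]|nAx] := pselect (A x); [exists U | exists set0].
have [|x Ax|D' D'A AD'] := cA T A f; first by move=> x /fP[].
  by exists x => //; have [] := fP x Ax.
apply: Psub AD' _; rewrite /cover.
have sA x : x \in enum_fset D' -> A x by move=> /D'A; rewrite inE.
have -> : [set` D'] = [set x | x \in enum_fset D'] by [].
elim: (enum_fset D') sA => [|y s IHs] sA; first by rewrite bigcup0.
have -> : \bigcup_(i in [set x | x \in y :: s]) f i =
    f y `|` \bigcup_(i in [set x | x \in s]) f i.
  rewrite predeqE => z; split.
    move=> [i /= ]; rewrite inE => /orP[/eqP -> |si] fi; [by left|by right; exists i].
  case=> [fy|[i /= si fi]]; first by exists y => //=; rewrite inE eqxx.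
  by exists i => //=; rewrite inE si orbT.
apply: PU; last first.
  by apply: IHs => x xs; apply: sA; rewrite inE xs orbT.
by have [|//] := fP y; apply: sA; rewrite inE eqxx.
Qed.

Lemma cover_compact0 : cover_compact (@set0 T).
Proof. by move=> I D f _ _; exists fset0. Qed.

Lemma cover_compactU (A B : set T) :
  cover_compact A -> cover_compact B -> cover_compact (A `|` B).
Proof.
move=> cA cB I D f fo ABf.
have [D1 D1D AD1] := cA I D f fo (fun x Ax => ABf x (or_introl Ax)).
have [D2 D2D BD2] := cB I D f fo (fun x Bx => ABf x (or_intror Bx)).
exists (D1 `|` D2)%fset.
  by move=> i; rewrite inE => /orP[/D1D|/D2D].
by move=> x [/AD1|/BD2] [i /= iD fx]; exists i => //=; rewrite inE iD ?orbT.
Qed.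

End CoverCompact.

Lemma cover_compact_image (S T : topologicalType) (f : S -> T) :
  continuous f -> cover_compact [set: S] -> cover_compact (range f).
Proof.
move=> fc cS I D F Fo RF.
have [||D' D'D SD'] := cS I D (fun i => f @^-1` F i).
- by move=> i Di; apply: open_comp => [x _|]; [exact: fc | exact: Fo].
- by move=> x _; have [|i Di Fi] := RF (f x); [exists x | exists i].
by exists D' => // _ [x _ <-]; have [//|i D'i Fi] := SD' x; exists i.
Qed.

Section SpecTopology.
Variable A : comPzRingType.
Implicit Types p q : spec A.

Lemma basic_open (f : A) : open [set p : spec A | ~ prime_set p f].
Proof.
exists [set f]; rewrite predeqE => p; split=> [np|[_ [-> ]//]].
by exists f.
Qed.

Definition basic (f : A) : opens (spec A) := Opens (basic_open f).

Lemma basicP (U : set (spec A)) p : open U -> U p ->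
  exists2 f, ~ prime_set p f & basic f `<=` U.
Proof. by move=> [E ->] [f [Ef nf]]; exists f => // q nq; exists f. Qed.

Lemma basicM (f g : A) : basic (f * g) = (basic f : set _) `&` basic g :> set _.
Proof.
rewrite predeqE => p; split=> [n|[nf ng]]; last exact: prime_mul.
by split=> h; apply: n; [rewrite mulrC|]; exact: primeM.
Qed.

Lemma primeD_or p a b : ~ prime_set p (a + b) -> ~ prime_set p a \/ ~ prime_set p b.
Proof.
by move=> n; apply/not_andP => -[pa pb]; apply: n; exact: primeD.
Qed.

Lemma primeM_r p a b : ~ prime_set p (a * b) -> ~ prime_set p b.
Proof. by move=> n pb; apply: n; exact: primeM. Qed.

Lemma primeM_l p a b : ~ prime_set p (a * b) -> ~ prime_set p a.
Proof. by rewrite mulrC; exact: primeM_r. Qed.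

(** The [k] such that D(k) has a finite subcover form an ideal, since D(a + b) lies in the union of
    D(a) and D(b). This ideal contains some f^n, and D(f) lies in D(f^n). *)
Lemma basic_compact (f : A) : cover_compact (basic f).
Proof.
move=> I D F Fo fF; pose K := [set k | finite_subset_cover D F (basic k)].
have [||n [D' D'D fD']] := @ideal_power _ K f.
- split=> [|a b [D1 D1D aD1] [D2 D2D bD2]|a b [D1 D1D bD1]].
  + by exists fset0 => // p []; exact: prime0.
  + exists (D1 `|` D2)%fset; first by move=> i; rewrite inE => /orP[/D1D|/D2D].
    by move=> p /primeD_or[/aD1|/bD2] [i /= iD Fp]; exists i => //=;
      rewrite inE iD ?orbT.
  + by exists D1 => // p /primeM_r/bD1.
- move=> p nf; have [i Di Fip] := fF p nf.
  have [k nk kF] := basicP (Fo i Di) Fip; exists k => //.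
  exists [fset i]%fset; first by move=> j; rewrite inE => /eqP ->; rewrite inE.
  by move=> q /kF Fq; exists i => //=; rewrite inE.
by exists D' => // p nf; apply: fD'; exact: prime_exp.
Qed.

Lemma Spec_quasi_compact : quasi_compact (Spec A).
Proof.
have e : basic 1 = setT :> set _ by rewrite predeqE => p; split=> // _; exact: prime1.
by have := @basic_compact 1; rewrite e.
Qed.

Lemma Spec_quasi_separated : quasi_separated (Spec A).
Proof.
move=> U V Uo Vo cU cV.
(* Compactness of an intersection is not hereditary, as the induction principle demands. The
   existence of a compact [C] that contains the part of [W] in [W0] and stays inside [Z] is; for
   [W = U], [W0 = V] and [Z] their intersection it forces [C] to be that intersection. *)
pose between (W C Z : set (spec A)) := [/\ W `<=` C, C `<=` Z & cover_compact C].
pose P Z W0 (W : set (spec A)) := exists C, between (W `&` W0) C Z.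
have P0 Z W0 : P Z W0 set0.
  by exists set0; split; [rewrite set0I | | exact: cover_compact0].
have PU Z W0 W1 W2 : P Z W0 W1 -> P Z W0 W2 -> P Z W0 (W1 `|` W2).
  move=> [C1 [s1 t1 c1]] [C2 [s2 t2 c2]]; exists (C1 `|` C2); split.
  - by rewrite setIUl; exact: setUSS.
  - by rewrite subUset.
  - exact: cover_compactU.
have Psub Z W0 W1 W2 : W1 `<=` W2 -> P Z W0 W2 -> P Z W0 W1.
  by move=> s [C [sC tC cC]]; exists C; split=> // x [/s ? ?]; exact: sC.
suff [C [s t cC]] : P (U `&` V) V U by have <- : C = U `&` V by apply/seteqP.
apply: cover_compact_ind cU (P0 _ _) (@PU _ _) (@Psub _ _) _ => p Up.
have [f nf fU] := basicP Uo Up.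
exists (basic f); split=> //; first exact: basic_open.
suff [C [s t cC]] : P (U `&` V) (basic f) V by exists C; split=> //; rewrite setIC.
apply: cover_compact_ind cV (P0 _ _) (@PU _ _) (@Psub _ _) _ => q Vq.
have [g ng gV] := basicP Vo Vq.
exists (basic g); split=> //; first exact: basic_open.
exists (basic (g * f)); rewrite basicM; split=> //; first by move=> x [/gV ? /fU].
by rewrite -basicM; exact: basic_compact.
Qed.

End SpecTopology.

(** * Global functions on an affine scheme *)

Section SpecSections.
Variable A : comPzRingType.
Implicit Types p q : spec A.

Lemma reg_local (U : opens (spec A)) (s : regular U) p : opens_set U p ->
  exists f a, [/\ ~ prime_set p f, basic f `<=` U &
    forall q (nf : ~ prime_set q f) (Uq : opens_set U q), s q Uq = frac a nf].
Proof.
move=> Up; have [V [VU [a [k [Vp e]]]]] := regP s Up.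
have [g ng gV] := basicP (opens_open V) Vp; have [nk _] := e _ Vp.
exists (k * g), (a * g); split=> [||q nf Uq]; first exact: prime_mul.
  by move=> q /primeM_r/gV/VU.
have [nk' e'] := e q (gV q (primeM_r nf));
  rewrite (reg_irr _ _ (VU _ (gV q (primeM_r nf)))) e'.
by apply: frac_eqI; ring.
Qed.

Lemma spec_const_zmod : zmod_morphism (@spec_const A).
Proof.
by move=> a b; apply: (addIr (spec_const b)); rewrite -spec_constD !subrK.
Qed.

Lemma spec_const_monoid : monoid_morphism (@spec_const A).
Proof. by split; [exact: spec_const1 | exact: spec_constM]. Qed.

HB.instance Definition _ := GRing.isZmodMorphism.Build A (glob (Spec A))
  (@spec_const A) spec_const_zmod.
HB.instance Definition _ := GRing.isMonoidMorphism.Build A (glob (Spec A))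
  (@spec_const A) spec_const_monoid.

Lemma spec_constE a p (Up : opens_set (opensT (spec A)) p) :
  reg_fun (spec_const a) Up = loc_in p a.
Proof. by []. Qed.

Lemma loc_in_eq0_global (a : A) : (forall p, loc_in p a = 0) -> a = 0.
Proof.
move=> a0; rewrite -[a](@scale1r _ A^o).
apply: (ideal_full (ideal_ann (a : A^o))) => p.
by have /loc_in_eq0[u nu ua] := a0 p; exists u.
Qed.

Lemma spec_const_inj : injective (@spec_const A).
Proof.
move=> a b e; apply/eqP; rewrite -subr_eq0; apply/eqP/loc_in_eq0_global => p.
have ab : loc_in p a = loc_in p b :=
  congr1 (fun r : regular (opensT (spec A)) => reg_fun r (I : opens_set (opensT _) p)) e.
by rewrite rmorphB; apply/eqP; rewrite subr_eq0; apply/eqP.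
Qed.

(** If g = b / k on D(k), then b vanishes at the primes of D(fk), so (fk)^n b = 0 and f^n kills g on
    D(k). The exponents for two basic open sets are added, which makes [K] an ideal. *)
Lemma basic_vanish (g : glob (Spec A)) (f : A) :
  (forall q, ~ prime_set q f -> reg_fun g (I : opens_set (opensT _) q) = 0) ->
  exists n, spec_const (f ^+ n) * g = 0.
Proof.
move=> gf.
pose K := [set k : A | exists n, forall q, ~ prime_set q k ->
  loc_in q (f ^+ n) * reg_fun g (I : opens_set (opensT _) q) = 0].
have idK : ideal K.
  split=> [|a b [n an] [m bm]|a b [n bn]].
  - by exists 0%N => q []; exact: prime0.
  - exists (n + m)%N => q; rewrite exprD rmorphM => /primeD_or[/an|/bm] e.
      by rewrite mulrAC e mul0r.
    by rewrite -mulrA e mulr0.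
  - by exists n => q /primeM_r/bn.
suff [n nP] : K 1.
  exists n; apply: regular_ext => q Uq; rewrite regME /= frac0 -(nP q (@prime1 _ q)).
  by congr (_ * _); exact: reg_irr.
apply: ideal_full idK _ => p.
have [k [b [nk _ e]]] := reg_local g (I : opens_set (opensT _) p).
exists k => //; have [|n nP] := ideal_power (h := f * k) (ideal_ann (b : A^o)).
  move=> q n; have := gf q (primeM_l n); rewrite (e q (primeM_r n)).
  by move/frac_eq0 => [u nu ub]; exists u.
exists n => q nq; rewrite (e q nq).
apply: (@loc_in_reg _ q (k ^+ n.+1)); first exact: prime_exp.
rewrite mulr0 exprSr rmorphM mulrACA loc_in_frac -!rmorphM -exprMn.
by rewrite [k * f]mulrC [_ * b]nP rmorph0.
Qed.

(** If s = a / f on D(f), then f s - a vanishes there and f^n (f s - a) = 0, so f^(n+1) multiplies s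
    into the constants. The ideal [J] of such multipliers therefore contains 1. *)
Lemma glob_spec_surj (s : glob (Spec A)) : exists a, s = spec_const a.
Proof.
pose J := [set b : A | exists c, spec_const b * s = spec_const c].
suff [c] : J 1 by rewrite rmorph1 mul1r => ->; exists c.
apply: ideal_full => [|p].
  split=> [|a b [c ac] [d bd]|a b [c bc]].
  - by exists 0; rewrite rmorph0 mul0r.
  - by exists (c + d); rewrite !rmorphD mulrDl ac bd.
  - by exists (a * c); rewrite !rmorphM -mulrA bc.
have [f [a [nf _ e]]] := reg_local s (I : opens_set (opensT _) p).
have [q nq|n fn] := @basic_vanish (spec_const f * s - spec_const a) f.
  rewrite regDE regNE regME !spec_constE.
  by rewrite (e q nq) loc_in_frac subrr.
exists (f ^+ n * f); last by apply: prime_mul => //; exact: prime_exp.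
exists (f ^+ n * a); apply/eqP; rewrite !rmorphM -subr_eq0; apply/eqP.
by rewrite -fn; ring.
Qed.

Definition glob_spec (s : glob (Spec A)) : A := projT1 (cid (glob_spec_surj s)).

Lemma glob_specK : cancel glob_spec (@spec_const A).
Proof. by move=> s; rewrite /glob_spec; case: cid. Qed.

Lemma spec_constK : cancel (@spec_const A) glob_spec.
Proof. by move=> a; apply: spec_const_inj; rewrite glob_specK. Qed.

Lemma glob_spec_zmod : zmod_morphism glob_spec.
Proof. by move=> s t; apply: spec_const_inj; rewrite rmorphB /= !glob_specK. Qed.

Lemma glob_spec_monoid : monoid_morphism glob_spec.
Proof.
by split=> [|s t]; apply: spec_const_inj; rewrite (rmorph1, rmorphM) /= !glob_specK.
Qed.

HB.instance Definition _ := GRing.isZmodMorphism.Build (glob (Spec A)) A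
  glob_spec glob_spec_zmod.
HB.instance Definition _ := GRing.isMonoidMorphism.Build (glob (Spec A)) A
  glob_spec glob_spec_monoid.

Lemma spec_unit_at (U : opens (Spec A)) (s : \O_(Spec A) U) p (Up : opens_set U p) a f
    (nf : ~ prime_set p f) :
  reg_fun s Up = frac a nf -> unit_at p s <-> ~ prime_set p a.
Proof.
move=> e; split.
  move=> [V [VU [t [Vp st]]]]; apply: (@frac_unit _ _ _ _ nf (reg_fun t Vp)).
  move: st => /(congr1 (fun r : regular V => reg_fun r Vp)); rewrite reg1E /= => <-.
  by rewrite -e; congr (_ * _); exact: reg_irr.
move=> na; have [g [b [ng gU e']]] := reg_local s Up.
have nb : ~ prime_set p b.
  have [y ay] : exists y, frac a nf * y = 1.
    by exists (frac f na); rewrite -(fracM _ _ _ _ (prime_mul nf na)) mulrC frac1.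
  by apply: (@frac_unit _ _ _ _ ng y); rewrite -(e' p ng Up) e.
have inv_subproof : locally_fraction (fun q (Dq : opens_set (opensI (basic g) (basic b)) q) =>
    frac g (proj2 Dq : ~ prime_set q b)).
  by move=> q Dq; exists (opensI (basic g) (basic b)), (fun _ => id), g, b; split=> // r Dr;
    exists (proj2 Dr).
exists (opensI (basic g) (basic b)), (fun q Dq => gU q (proj1 Dq)), (Regular inv_subproof).
split=> //; apply: regular_ext => q Dq; rewrite reg1E /=.
rewrite (e' q (proj1 Dq)) -(fracM _ _ _ _ (prime_mul (proj1 Dq) (proj2 Dq : ~ prime_set q b))).
by rewrite mulrC frac1.
Qed.

End SpecSections.

(** * Morphisms into affine schemes *)

Section Sections.
Variable X : rspace.

Lemma sec_ext (U : opens X) (s t : \O_X U) :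
  (forall x, opens_set U x -> exists (V : opens X) (h : V `<=` U),
     opens_set V x /\ res \O_X h s = res \O_X h t) -> s = t.
Proof.
move=> loc_eq.
pose I := {V : opens X | exists h : V `<=` U, res \O_X h s = res \O_X h t}.
have VU (i : I) : sval i `<=` U by case: i => V [].
have [|i j hi hj|u [_ uniq]] := @rs_shP X I U (fun i => sval i) VU _
    (fun i => res \O_X (VU i) s).
- move=> x /loc_eq[V [h [Vx e]]]; have hV : exists h : V `<=` U, res \O_X h s = res \O_X h t.
    by exists h.
  by exists (exist _ V hV).
- by rewrite !res_trans; exact: res_irr.
rewrite -(uniq s) // (uniq t) // => -[V [h e]] /=.
by apply: etrans (etrans (esym e) _); exact: res_irr.
Qed.

Lemma opensI_l (U V : opens X) : opensI U V `<=` U. Proof. by move=> x []. Qed.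
Lemma opensI_r (U V : opens X) : opensI U V `<=` V. Proof. by move=> x []. Qed.

Lemma unit_at_res_iff (U V : opens X) (h : V `<=` U) (s : \O_X U) x :
  opens_set V x -> unit_at x (res \O_X h s) <-> unit_at x s.
Proof.
move=> Vx; split; first exact: unit_at_res.
case=> [W [k [t [Wx e]]]]; exists (opensI V W), (@opensI_l V W).
exists (res \O_X (@opensI_r V W) t); split=> //.
rewrite res_trans -(rmorph1 (res \O_X (@opensI_r V W))) -e rmorphM res_trans.
by congr (_ * _); exact: res_irr.
Qed.

Lemma unit_at_mul (U : opens X) (s t : \O_X U) x :
  unit_at x s -> unit_at x t -> unit_at x (s * t).
Proof.
move=> [V [h [a [Vx ea]]]] [W [k [b [Wx eb]]]].
exists (opensI V W), (fun y Dy => h y (proj1 Dy)).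
exists (res \O_X (@opensI_l V W) a * res \O_X (@opensI_r V W) b); split=> //.
rewrite rmorphM mulrACA -[1]mulr1; congr (_ * _).
  rewrite -(rmorph1 (res \O_X (@opensI_l V W))) -ea rmorphM res_trans.
  by congr (_ * _); exact: res_irr.
rewrite -(rmorph1 (res \O_X (@opensI_r V W))) -eb rmorphM res_trans.
by congr (_ * _); exact: res_irr.
Qed.

Lemma unit_at_reg (U : opens X) (k s t : \O_X U) x : unit_at x k -> opens_set U x ->
  k * s = k * t -> exists (V : opens X) (h : V `<=` U),
    opens_set V x /\ res \O_X h s = res \O_X h t.
Proof.
move=> [V [h [a [Vx ea]]]] Ux e; exists V, h; split=> //.
by rewrite -[LHS]mul1r -[RHS]mul1r -ea !(mulrAC _ a) -!rmorphM e.
Qed.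

End Sections.

Section Pull.
Variables (X Y : rspace) (f : mor X Y).

(** Two descriptions of one preimage need not be convertible as [opens]. An arbitrary [O] inside the
    preimage, with its own inclusion proof, lets sections pulled back along different paths be
    compared in one ring. *)
Definition pull (V : opens Y) (O : opens X) (h : O `<=` preim (mor_cont f) V) :
  {rmorphism \O_Y V -> \O_X O} := res \O_X h \o mor_sh f V.

Arguments pull : simpl never.

Lemma pull_res (V W : opens Y) (k : W `<=` V) (O : opens X)
    (h : O `<=` preim (mor_cont f) W) (h' : O `<=` preim (mor_cont f) V) s :
  pull h (res \O_Y k s) = pull h' s.
Proof. by rewrite /pull /= -mor_nat res_trans; exact: res_irr. Qed.

Lemma res_pull (V : opens Y) (O O' : opens X) (k : O' `<=` O)
    (h : O `<=` preim (mor_cont f) V) (h' : O' `<=` preim (mor_cont f) V) s :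
  res \O_X k (pull h s) = pull h' s.
Proof. by rewrite /pull /= res_trans; exact: res_irr. Qed.

Lemma unit_at_pull (V : opens Y) (O : opens X) (h : O `<=` preim (mor_cont f) V) s x :
  opens_set O x -> unit_at x (pull h s) <-> unit_at (f x) s.
Proof.
move=> Ox; rewrite /pull /= (unit_at_res_iff _ _ Ox); split.
  by apply: mor_local; exact: h.
case=> [W [k [t [Wx e]]]].
exists (preim (mor_cont f) W), (preim_sub k), (mor_sh f W t); split=> //.
by rewrite mor_nat -rmorphM e rmorph1.
Qed.

End Pull.

Lemma pull_comp (X Y Z : rspace) (g : mor Y Z) (f : mor X Y) (V : opens Z) (W : opens Y)
    (O : opens X) (h : O `<=` preim (mor_cont (mor_comp g f)) V)
    (hf : O `<=` preim (mor_cont f) W) (hg : W `<=` preim (mor_cont g) V) s :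
  pull h s = pull hf (pull hg s).
Proof. by rewrite /pull /= -mor_nat !res_trans; exact: res_irr. Qed.

Lemma pull_eq (X Y : rspace) (f g : mor X Y) (V : opens Y) (O : opens X)
    (h : O `<=` preim (mor_cont f) V) (h' : O `<=` preim (mor_cont g) V) s :
  f = g -> pull h s = pull h' s.
Proof. by move=> e; move: h'; rewrite -e => h'; rewrite (Prop_irrelevance h h'). Qed.

Lemma mor_ext_local (X Y : rspace) (f g : mor X Y) : (forall x, f x = g x) ->
  (forall (V : opens Y) (s : \O_Y V) x, opens_set V (f x) ->
     exists (O : opens X) (h : O `<=` preim (mor_cont f) V)
       (h' : O `<=` preim (mor_cont g) V), opens_set O x /\ pull h s = pull h' s) ->
  f = g.
Proof.
move=> fg loc_eq; apply: mor_ext => // V h s; apply: sec_ext => x Vx.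
have [|O [k [k' [Ox e]]]] := loc_eq V s x; first exact: h.
exists O, k'; split=> //; rewrite res_trans.
by apply: etrans e; exact: res_irr.
Qed.

Lemma pullbackE (X Y : rspace) (f : mor X Y) s (h : opensT X `<=` preim (mor_cont f)
  (opensT Y)) :
  pullback f s = pull h s.
Proof. exact: res_irr. Qed.

Lemma unit_at_spec_const (A : comPzRingType) (a : A) (p : Spec A) :
  unit_at p (spec_const a) <-> ~ prime_set p a.
Proof. exact: (@spec_unit_at _ _ (spec_const a) p I a 1 (@prime1 _ p)). Qed.

(** * Affine open charts of a ringed space *)

Section AffineOpen.
Variables (X : rspace) (B : comPzRingType) (j : mor (Spec B) X).
Hypothesis jo : open_immersion j.

Lemma chart_open : open (range j).
Proof. by have [_ + _] := jo; apply; exact: openT. Qed.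

Definition chart_set : opens X := Opens chart_open.

Lemma chart_sub (O : opens (Spec B)) : O `<=` preim (mor_cont j) chart_set.
Proof. by move=> q _; exists q. Qed.

Definition chart_image (O : opens (Spec B)) : opens X :=
  Opens (let: And3 _ oj _ := jo in oj O (opens_open O)).

Lemma chart_image_sub (O : opens (Spec B)) : chart_image O `<=` chart_set.
Proof. by move=> _ [q _ <-]; exists q. Qed.

Lemma pull_chart_inj (V : opens X) (O : opens (Spec B))
    (h : O `<=` preim (mor_cont j) V) (s t : \O_X V) :
  V `<=` j @` O -> pull h s = pull h t -> s = t.
Proof.
have [ij _ bij] := jo => VO e.
have [|g gK _] := bij V; first by move=> x /VO[q _ <-]; exists q.
have k : preim (mor_cont j) V `<=` O by move=> q /VO[q' Oq' /ij <-].
apply: (can_inj gK).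
have pullK r : mor_sh j V r = res \O_(Spec B) k (pull h r).
  by apply: esym; apply: etrans (res_trans _ _ _) _; exact: res_id.
by rewrite !pullK e.
Qed.

Lemma chart_section_subproof (b : B) : exists s : \O_X chart_set,
  pull (@chart_sub (opensT _)) s = spec_const b.
Proof.
have [_ _ bij] := jo; have [|g _ gK] := bij chart_set; first by [].
have k : preim (mor_cont j) chart_set `<=` opensT (Spec B) by [].
exists (g (res \O_(Spec B) k (spec_const b))).
by apply: etrans (congr1 _ (gK _)) _; apply: etrans (res_trans _ _ _) _; exact: res_id.
Qed.

Definition chart_section (b : B) : \O_X chart_set := projT1 (cid (chart_section_subproof b)).

Lemma pull_chart_section (O : opens (Spec B)) (h : O `<=` preim (mor_cont j) chart_set) b :
  pull h (chart_section b) = reg_cst O b.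
Proof.
have e := projT2 (cid (chart_section_subproof b)).
have k : O `<=` opensT (Spec B) by [].
by rewrite -(res_pull k (@chart_sub _)) e; apply: regular_ext.
Qed.

Lemma pull_chart_section_inj (s t : \O_X chart_set) :
  pull (@chart_sub (opensT _)) s = pull (@chart_sub (opensT _)) t -> s = t.
Proof. by apply: pull_chart_inj. Qed.

Lemma chart_section_zmod : zmod_morphism chart_section.
Proof.
move=> a b; apply: pull_chart_section_inj.
by rewrite rmorphB !pull_chart_section -[LHS]/(spec_const _) rmorphB.
Qed.

Lemma chart_section_monoid : monoid_morphism chart_section.
Proof.
split=> [|a b]; apply: pull_chart_section_inj.
  by rewrite rmorph1 pull_chart_section.
by rewrite rmorphM !pull_chart_section -[LHS]/(spec_const _) rmorphM.
Qed.

HB.instance Definition _ := GRing.isZmodMorphism.Build B (\O_X chart_set)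
  chart_section chart_section_zmod.
HB.instance Definition _ := GRing.isMonoidMorphism.Build B (\O_X chart_set)
  chart_section chart_section_monoid.

Lemma unit_at_chart_section b q : unit_at (j q) (chart_section b) <-> ~ prime_set q b.
Proof.
rewrite -(unit_at_pull (@chart_sub (opensT _))) // pull_chart_section.
exact: unit_at_spec_const.
Qed.

Lemma chart_section_local (V : opens X) (s : \O_X V) q : opens_set V (j q) ->
  exists (k a : B) (W : opens X) (hV : W `<=` V) (hU : W `<=` chart_set),
    [/\ ~ prime_set q k, opens_set W (j q) &
      res \O_X hU (chart_section k) * res \O_X hV s = res \O_X hU (chart_section a)].
Proof.
move=> Vq; pose s' := mor_sh j V s.
have [f [a [nf fV e]]] := reg_local s' Vq.
have hV : chart_image (basic f) `<=` V by move=> _ [r /fV Vr <-].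
have hj : basic f `<=` preim (mor_cont j) (chart_image (basic f)) by move=> r fr; exists r.
exists f, a, (chart_image (basic f)), hV, (@chart_image_sub _).
split=> //; first by exists q.
apply: (pull_chart_inj (h := hj)) => //.
rewrite rmorphM !(pull_res _ _ (@chart_sub _)) (@pull_res _ _ j _ _ hV _ _ fV).
rewrite !pull_chart_section.
apply: regular_ext => r fr; rewrite regME /= (e r fr).
exact: loc_in_frac.
Qed.

(** On points, the prime of f(t) consists of the [b] whose chart section is not a unit at f(t), and
    pullback along a local morphism detects units. On sections, k s = a holds near f(t) with [k] a
    unit there, so the pullback of [s] is determined by those of [k] and [a]. *)
Lemma mor_chart_ext (T : rspace) (f g : mor T X)
    (hf : opensT T `<=` preim (mor_cont f) chart_set)
    (hg : opensT T `<=` preim (mor_cont g) chart_set) :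
  (forall b, pull hf (chart_section b) = pull hg (chart_section b)) -> f = g.
Proof.
move=> e; have fg t : f t = g t.
  have [q _ jq] := hf t I; have [r _ jr] := hg t I.
  rewrite -jq -jr; congr (j _); apply: prime_ext => b.
  suff: ~ prime_set q b <-> ~ prime_set r b by move=> /not_iff_compat; rewrite !notK.
  rewrite -!unit_at_chart_section jq jr.
  by rewrite -(unit_at_pull hf) // -(unit_at_pull hg) // e.
apply: mor_ext_local => // V s t Vt; have [q _ jq] := hf t I.
have [|k [a [W [hV [hU [nk Wq es]]]]]] := @chart_section_local V s q; first by rewrite jq.
pose O := preim (mor_cont f) W.
have fW : O `<=` preim (mor_cont f) W by [].
have gW : O `<=` preim (mor_cont g) W by move=> x; rewrite /= -fg.
have fV : O `<=` preim (mor_cont f) V by move=> x /fW/hV.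
have gV : O `<=` preim (mor_cont g) V by move=> x /gW/hV.
have fU : O `<=` preim (mor_cont f) chart_set by move=> x /fW/hU.
have gU : O `<=` preim (mor_cont g) chart_set by move=> x /gW/hU.
have Ot : opens_set O t by rewrite /= -jq.
have eU b : pull fU (chart_section b) = pull gU (chart_section b).
  have h : O `<=` opensT T by [].
  by rewrite -(res_pull h hf) e res_pull.
have [|||O' [h [O't e']]] :=
  @unit_at_reg _ O (pull fU (chart_section k)) (pull fV s) (pull gV s) t.
- by rewrite unit_at_pull // -jq unit_at_chart_section.
- by [].
- rewrite -(pull_res hV fW) {2}eU -(pull_res hV gW) -(pull_res hU fW) -(pull_res hU gW).
  by rewrite -!rmorphM es (pull_res hU fW fU) (pull_res hU gW gU) eU.
exists O', (fun x O'x => fV x (h x O'x)), (fun x O'x => gV x (h x O'x)).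
by split=> //; rewrite -!(res_pull h).
Qed.

End AffineOpen.

Lemma res_eq (X : rspace) (U U' V W : opens X) (k : W `<=` V) (h : V `<=` U) (h' : V `<=` U')
    (g : W `<=` U) (g' : W `<=` U') (s : \O_X U) (t : \O_X U') :
  res \O_X h s = res \O_X h' t -> res \O_X g s = res \O_X g' t.
Proof.
move=> /(congr1 (res \O_X k)); rewrite !res_trans => e.
by apply: etrans (etrans _ e) _; exact: res_irr.
Qed.

Lemma affine_factor (X : rspace) (A B : comPzRingType) (j : mor (Spec B) X)
    (jo : open_immersion j) (f : mor (Spec A) X)
    (hf : opensT (Spec A) `<=` preim (mor_cont f) (chart_set jo)) :
  exists2 chi : {rmorphism B -> A}, f = mor_comp j (Spec_map chi) &
    forall b, pull hf (chart_section jo b) = spec_const (chi b).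
Proof.
pose chi : {rmorphism B -> A} := @glob_spec A \o (pull hf \o chart_section jo).
have chiE b : spec_const (chi b) = pull hf (chart_section jo b) by exact: glob_specK.
exists chi => //.
have hg : opensT (Spec A) `<=` preim (mor_cont (mor_comp j (Spec_map chi))) (chart_set jo).
  by move=> p _; exists (spec_fun chi p).
have hc : opensT (Spec A) `<=` preim (mor_cont (Spec_map chi)) (opensT (Spec B)) by [].
apply: (mor_chart_ext (hf := hf) (hg := hg)) => b.
rewrite (pull_comp _ hc (@chart_sub _ _ _ jo _)) pull_chart_section -chiE.
rewrite -pullback_spec_const.
exact: (@pullbackE _ _ (Spec_map chi) (spec_const b) hc).
Qed.

(** Spec B is a chart of itself through the identity, which makes this a case of [mor_chart_ext]. *)
Lemma spec_mor_ext (T : rspace) (B : comPzRingType) (f g : mor T (Spec B)) :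
  (forall b, pullback f (spec_const b) = pullback g (spec_const b)) -> f = g.
Proof.
move=> e; pose U := chart_set (@open_immersion_id (Spec B)).
have UE b : chart_section (@open_immersion_id (Spec B)) b = reg_cst U b.
  apply: pull_chart_section_inj; rewrite pull_chart_section.
  by apply: regular_ext.
have UT : U `<=` opensT (Spec B) by [].
have hU (h : mor T (Spec B)) : opensT T `<=` preim (mor_cont h) U by move=> t _; exists (h t).
have pullU (h : mor T (Spec B)) b : pull (hU h) (reg_cst U b) = pullback h (spec_const b).
  have hT : opensT T `<=` preim (mor_cont h) (opensT (Spec B)) by [].
  rewrite (pullbackE _ hT) -(pull_res UT (hU h)); congr (pull _ _).
  exact: regular_ext.
apply: (mor_chart_ext (hf := hU f) (hg := hU g)) => b.
by rewrite UE !pullU.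
Qed.

Lemma affine_full (A B : comPzRingType) (f : mor (Spec A) (Spec B)) :
  exists2 chi : {rmorphism B -> A}, f = Spec_map chi &
    forall b, pullback f (spec_const b) = spec_const (chi b).
Proof.
pose chi : {rmorphism B -> A} := @glob_spec A \o (pullback f \o @spec_const B).
have chiE b : spec_const (chi b) = pullback f (spec_const b) by exact: glob_specK.
exists chi => //; apply: spec_mor_ext => b.
by rewrite -chiE -pullback_spec_const.
Qed.

Section SchemeStalk.
Variables (T : rspace) (Tsch : is_scheme T).

Lemma unit_at_chart (B : comPzRingType) (j : mor (Spec B) T) (U : opens T) (s : \O_T U) q
    (Uq : opens_set (preim (mor_cont j) U) q) a f (nf : ~ prime_set q f) :
  reg_fun (mor_sh j U s) Uq = frac a nf -> unit_at (j q) s <-> ~ prime_set q a.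
Proof.
move=> e; have k : preim (mor_cont j) U `<=` preim (mor_cont j) U by [].
rewrite -(spec_unit_at e) -(unit_at_pull k) //.
by rewrite -[mor_sh j U s](res_id _ k).
Qed.

(** The stalk at x is that of an affine chart, hence local. This is what makes the ideal of
    [adj_prime_subproof] closed under sums. *)
Lemma unit_atD_or (U : opens T) (s t : \O_T U) x : opens_set U x ->
  unit_at x (s + t) -> unit_at x s \/ unit_at x t.
Proof.
move=> Ux; have [B [j [_ [q _ jq]]]] := Tsch x; rewrite -jq in Ux *.
have Uq : opens_set (preim (mor_cont j) U) q by [].
have locP (y : loc q) : exists a f (nf : ~ prime_set q f), y = frac a nf.
  by elim/loc_ind: y => a f nf; exists a, f, nf.
have [a [f [nf ea]]] := locP (reg_fun (mor_sh j U s) Uq).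
have [b [g [ng eb]]] := locP (reg_fun (mor_sh j U t) Uq).
rewrite (unit_at_chart ea) (unit_at_chart eb).
rewrite (@unit_at_chart _ _ _ _ _ Uq (a * g + b * f) (f * g) (prime_mul nf ng)).
  by case/primeD_or => /primeM_l; [left|right].
by rewrite rmorphD (fracD _ _ nf ng) -ea -eb.
Qed.

Lemma unit_at0 (U : opens T) x : opens_set U x -> ~ unit_at x (0 : \O_T U).
Proof.
move=> Ux; have [B [j [_ [q _ jq]]]] := Tsch x; rewrite -jq in Ux *.
have Uq : opens_set (preim (mor_cont j) U) q by [].
rewrite (@unit_at_chart _ _ _ _ _ Uq 0 1 (@prime1 _ q)).
  by apply; exact: prime0.
by rewrite rmorph0.
Qed.

End SchemeStalk.

Lemma unit_at_mul_l (X : rspace) (U : opens X) (s t : \O_X U) x :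
  unit_at x (s * t) -> unit_at x s.
Proof.
case=> [V [h [a [Vx e]]]]; exists V, h, (res \O_X h t * a); split=> //.
by rewrite mulrA -rmorphM.
Qed.

Lemma unit_at_open (X : rspace) (U : opens X) (s : \O_X U) : open [set x | unit_at x s].
Proof.
rewrite (_ : [set x | _] = \bigcup_(V in [set V : opens X | exists (h : V `<=` U) t,
    res \O_X h s * t = 1]) (V : set X)).
  by apply: bigcup_open => V _; exact: opens_open.
rewrite predeqE => x; split=> [[V [h [t [Vx e]]]]|[V [h [t e]] Vx]].
  by exists V => //; exists h, t.
by exists V, h, t.
Qed.

(** * The morphism T -> Spec B given by a ring morphism B -> O(T) *)

Section SpecAdjunction.
Variables (T : rspace) (B : comPzRingType) (phi : {rmorphism B -> glob T}).
Hypothesis Tsch : is_scheme T.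

(** The only possible image of t: locality of the stalk maps forces it to be the preimage under
    [phi] of the maximal ideal of the stalk at t. *)
Lemma adj_prime_subproof (t : T) : exists p : spec B,
  forall b, prime_set p b <-> ~ unit_at t (phi b).
Proof.
have unitM a b : unit_at t (phi (a * b)) <-> unit_at t (phi a) /\ unit_at t (phi b).
  rewrite rmorphM; split=> [u|[ua ub]]; last exact: unit_at_mul.
  by split; [|rewrite mulrC in u]; exact: unit_at_mul_l u.
have unit1 : unit_at t (phi 1).
  by exists (opensT T), (fun x => id), 1; rewrite !rmorph1 mulr1.
have p0 : ~ unit_at t (phi 0) by rewrite rmorph0; exact: unit_at0.
have pD a b : ~ unit_at t (phi a) -> ~ unit_at t (phi b) -> ~ unit_at t (phi (a + b)).
  by move=> na nb; rewrite rmorphD => /(unit_atD_or Tsch)[].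
have pM a b : ~ unit_at t (phi b) -> ~ unit_at t (phi (a * b)).
  by move=> nb /unitM[].
have p1 : ~ ~ unit_at t (phi 1) by [].
have pP a b : ~ unit_at t (phi (a * b)) -> ~ unit_at t (phi a) \/ ~ unit_at t (phi b).
  by move=> n; apply/not_andP => /unitM.
by exists (@Prime B [set b | ~ unit_at t (phi b)] p0 pD pM p1 pP).
Qed.

Definition adj_fun (t : T) : spec B := projT1 (cid (adj_prime_subproof t)).

Lemma adj_funP t b : ~ prime_set (adj_fun t) b <-> unit_at t (phi b).
Proof.
rewrite -[unit_at _ _]notP; apply: not_iff_compat.
exact: (projT2 (cid (adj_prime_subproof t))).
Qed.

Lemma adj_fun_cont : continuous adj_fun.
Proof.
apply/continuousP => _ [E ->].
rewrite (_ : _ @^-1` _ = \bigcup_(f in E) [set t | unit_at t (phi f)]).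
  by apply: bigcup_open => f _; exact: unit_at_open.
rewrite predeqE => t; split=> [[f [Ef /adj_funP uf]]|[f Ef /adj_funP uf]]; by exists f.
Qed.

(* [u] is the pullback of [s]: near each point [u phi(k) = phi(a)] for some
   fraction [a / k] representing the germ of [s]. *)
Definition adj_rel (V : opens (Spec B)) (s : regular V) (u : \O_T (preim adj_fun_cont V)) :=
  forall t (Vt : opens_set V (adj_fun t)), exists a k (nk : ~ prime_set (adj_fun t) k),
    reg_fun s Vt = frac a nk /\
    exists (O : opens T) (h : O `<=` preim adj_fun_cont V) (h' : O `<=` opensT T),
      opens_set O t /\ res \O_T h u * res \O_T h' (phi k) = res \O_T h' (phi a).

Lemma adj_rel_res (V : opens (Spec B)) (O W : opens T) (h : O `<=` preim adj_fun_cont V)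
    (h' : O `<=` opensT T) (k : W `<=` O) (g : W `<=` preim adj_fun_cont V)
    (g' : W `<=` opensT T) u a b :
  res \O_T h u * res \O_T h' (phi b) = res \O_T h' (phi a) ->
  res \O_T g u * res \O_T g' (phi b) = res \O_T g' (phi a).
Proof.
move=> /(congr1 (res \O_T k)); rewrite rmorphM !res_trans => e.
by apply: etrans (etrans _ e) _; [congr (_ * _)|]; exact: res_irr.
Qed.

Lemma adj_frac_eq t a k b l (nk : ~ prime_set (adj_fun t) k) (nl : ~ prime_set (adj_fun t) l) :
  frac a nk = frac b nl -> exists (O : opens T) (h : O `<=` opensT T),
    opens_set O t /\ res \O_T h (phi (a * l)) = res \O_T h (phi (b * k)).
Proof.
case/frac_eqP=> w [/adj_funP uw e]; apply: (unit_at_reg uw) => //.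
by rewrite -!rmorphM e.
Qed.

(** If the germ of [s] is a / k for [u] and b / l for [u'], then phi(kl) u = phi(kl) u' near t, and
    phi(kl) is a unit at t. *)
Lemma adj_rel_uniq V s u u' : @adj_rel V s u -> adj_rel s u' -> u = u'.
Proof.
move=> su su'; apply: sec_ext => t Vt.
have [a [k [nk [e1 [O1 [h1 [h1' [O1t r1]]]]]]]] := su t Vt.
have [b [l [nl [e2 [O2 [h2 [h2' [O2t r2]]]]]]]] := su' t Vt.
have [O3 [h3 [O3t r3]]] := adj_frac_eq (etrans (esym e1) e2).
pose W := opensI O1 (opensI O2 O3).
have WV : W `<=` preim adj_fun_cont V by move=> x [/h1].
have WT : W `<=` opensT T by [].
have {}r1 := adj_rel_res (fun x (Wx : opens_set W x) => proj1 Wx) WV WT r1.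
have {}r2 := adj_rel_res (fun x (Wx : opens_set W x) => proj1 (proj2 Wx)) WV WT r2.
have {}r3 : res \O_T WT (phi (a * l)) = res \O_T WT (phi (b * k)).
  have W3 : W `<=` O3 by move=> x [_ []].
  exact: (res_eq W3 _ _ r3).
have Wt : opens_set W t by split=> //; split.
have [|||W' [h [W't e]]] := @unit_at_reg _ W (res \O_T WT (phi (k * l)))
    (res \O_T WV u) (res \O_T WV u') t.
- rewrite unit_at_res_iff //; apply/adj_funP; exact: prime_mul.
- by [].
- move: r3; rewrite !rmorphM -r1 -r2.
  move: (res _ _ _) (res _ _ _) (res _ _ _) (res _ _ _) => x y z w r3.
  by transitivity (w * z * y); [ring | rewrite r3; ring].
exists W', (fun x W'x => WV x (h x W'x)); split=> //.
by rewrite -(res_trans WV h u) -(res_trans WV h u').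
Qed.

Section Pieces.
Variables (V : opens (Spec B)) (s : regular V).

(* The pieces from which the pullback of [s] is glued, as [phi(pc_num) pc_inv] on
   [pc_open]. *)
Record piece := Piece {
  pc_num : B;
  pc_den : B;
  pc_open : opens T;
  pc_inv : \O_T pc_open;
  pc_basic : basic pc_den `<=` V;
  pc_frac : forall q (nf : ~ prime_set q pc_den) (Vq : opens_set V q),
    reg_fun s Vq = frac pc_num nf;
  pc_top : pc_open `<=` opensT T;
  pc_invP : res \O_T pc_top (phi pc_den) * pc_inv = 1 }.

Lemma pc_nden (i : piece) t : opens_set (pc_open i) t ->
  ~ prime_set (adj_fun t) (pc_den i).
Proof.
move=> Ot; apply/adj_funP; exists (pc_open i), (@pc_top i), (pc_inv i).
by split=> //; exact: pc_invP.
Qed.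

Lemma pc_sub (i : piece) : pc_open i `<=` preim adj_fun_cont V.
Proof. by move=> t /pc_nden/pc_basic. Qed.

Lemma pc_cover : preim adj_fun_cont V `<=` \bigcup_i pc_open i.
Proof.
move=> t Vt; have [f [a [nf fV e]]] := reg_local s Vt.
have /adj_funP[O [h [v [Ot hv]]]] := nf.
by exists (@Piece a f O v fV e h hv).
Qed.

Definition pc_sec (i : piece) : \O_T (pc_open i) :=
  res \O_T (@pc_top i) (phi (pc_num i)) * pc_inv i.

Lemma pc_compat (i j : piece) (hi : opensI (pc_open i) (pc_open j) `<=` pc_open i)
    (hj : opensI (pc_open i) (pc_open j) `<=` pc_open j) :
  res \O_T hi (pc_sec i) = res \O_T hj (pc_sec j).
Proof.
apply: sec_ext => t [Oi Oj].
have [O [h [Ot e]]] := adj_frac_eq (etrans (esym (pc_frac (pc_nden Oi) (pc_sub Oi)))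
  (pc_frac (pc_nden Oj) (pc_sub Oi))).
pose W := opensI (opensI (pc_open i) (pc_open j)) O.
have WT : W `<=` opensT T by [].
have WO : W `<=` O by move=> x [].
have Wi : W `<=` pc_open i by move=> x [[]].
have Wj : W `<=` pc_open j by move=> x [[]].
have ri : res \O_T WT (phi (pc_den i)) * res \O_T Wi (pc_inv i) = 1.
  rewrite -(rmorph1 (res \O_T Wi)) -(pc_invP i) rmorphM res_trans.
  by congr (_ * _); exact: res_irr.
have rj : res \O_T WT (phi (pc_den j)) * res \O_T Wj (pc_inv j) = 1.
  rewrite -(rmorph1 (res \O_T Wj)) -(pc_invP j) rmorphM res_trans.
  by congr (_ * _); exact: res_irr.
have {}e : res \O_T WT (phi (pc_num i * pc_den j)) = res \O_T WT (phi (pc_num j * pc_den i)).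
  exact: (res_eq WO _ _ e).
exists W, (@opensI_l _ _ _); split=> //.
apply: etrans (_ : res \O_T Wi (pc_sec i) = _); first by rewrite res_trans; exact: res_irr.
apply: etrans (_ : _ = res \O_T Wj (pc_sec j)) _; last by rewrite res_trans; exact: res_irr.
apply: etrans (_ : res \O_T WT (phi (pc_num i)) * res \O_T Wi (pc_inv i) = _).
  by rewrite rmorphM res_trans; congr (_ * _); exact: res_irr.
apply: etrans (_ : _ = res \O_T WT (phi (pc_num j)) * res \O_T Wj (pc_inv j)) _; last first.
  by rewrite rmorphM res_trans; congr (_ * _); exact: res_irr.
move: e ri rj; rewrite !rmorphM.
move: (res _ WT _) (res _ WT _) (res _ WT _) (res _ WT _) (res _ Wi _) (res _ Wj _).
move=> fi b fj a vi vj e ri rj; rewrite -[a * vi]mulr1 -rj.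
by transitivity (a * fj * (vi * vj)); [ring | rewrite e -[RHS]mulr1 -ri; ring].
Qed.

End Pieces.

Lemma adj_rel_ex V s : exists u, @adj_rel V s u.
Proof.
have [u [uE _]] := rs_shP (@pc_sub V s) (@pc_cover V s) (@pc_compat V s).
exists u => t Vt; have [i _ Oi] := @pc_cover V s t Vt.
exists (pc_num i), (pc_den i), (pc_nden Oi); split; first exact: pc_frac.
exists (pc_open i), (@pc_sub V s i), (@pc_top V s i); split=> //.
by rewrite uE /pc_sec -mulrA [pc_inv i * _]mulrC pc_invP mulr1.
Qed.

Section Sheaf.
Variable V : opens (Spec B).

Definition adj_sh_fun (s : regular V) : \O_T (preim adj_fun_cont V) :=
  projT1 (cid (@adj_rel_ex V s)).

Lemma adj_sh_funP s : adj_rel s (adj_sh_fun s).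
Proof. exact: projT2 (cid (@adj_rel_ex V s)). Qed.

(** Together with uniqueness, compatibility of the relation with the ring operations makes
    [adj_sh_fun] a ring morphism although its values are obtained by choice. *)
Lemma adj_relD s s' u u' : @adj_rel V s u -> adj_rel s' u' -> adj_rel (s + s') (u + u').
Proof.
move=> su su' t Vt.
have [a [k [nk [e1 [O1 [h1 [h1' [O1t r1]]]]]]]] := su t Vt.
have [b [l [nl [e2 [O2 [h2 [h2' [O2t r2]]]]]]]] := su' t Vt.
exists (a * l + b * k), (k * l), (prime_mul nk nl); split.
  by rewrite (fracD _ _ nk nl) -e1 -e2.
have WV : opensI O1 O2 `<=` preim adj_fun_cont V by move=> x [/h1].
have WT : opensI O1 O2 `<=` opensT T by [].
exists (opensI O1 O2), WV, WT; split=> //.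
have {}r1 := adj_rel_res (@opensI_l _ O1 O2) WV WT r1.
have {}r2 := adj_rel_res (@opensI_r _ O1 O2) WV WT r2.
by rewrite !(rmorphD, rmorphM) -r1 -r2; ring.
Qed.

Lemma adj_relM s s' u u' : @adj_rel V s u -> adj_rel s' u' -> adj_rel (s * s') (u * u').
Proof.
move=> su su' t Vt.
have [a [k [nk [e1 [O1 [h1 [h1' [O1t r1]]]]]]]] := su t Vt.
have [b [l [nl [e2 [O2 [h2 [h2' [O2t r2]]]]]]]] := su' t Vt.
exists (a * b), (k * l), (prime_mul nk nl); split.
  by rewrite (fracM _ _ nk nl) -e1 -e2.
have WV : opensI O1 O2 `<=` preim adj_fun_cont V by move=> x [/h1].
have WT : opensI O1 O2 `<=` opensT T by [].
exists (opensI O1 O2), WV, WT; split=> //.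
have {}r1 := adj_rel_res (@opensI_l _ O1 O2) WV WT r1.
have {}r2 := adj_rel_res (@opensI_r _ O1 O2) WV WT r2.
by rewrite !rmorphM -r1 -r2; ring.
Qed.

Lemma adj_rel_cst b (h : preim adj_fun_cont V `<=` opensT T) :
  adj_rel (reg_cst V b) (res \O_T h (phi b)).
Proof.
move=> t Vt; exists b, 1, (@prime1 _ _); split=> //.
exists (preim adj_fun_cont V), (fun x => id), h; split=> //.
by rewrite rmorph1 rmorph1 mulr1 res_id.
Qed.

Lemma adj_sh_zmod : zmod_morphism adj_sh_fun.
Proof.
move=> s t; apply: (addIr (adj_sh_fun t)); rewrite subrK.
apply: (adj_rel_uniq (s := s)); last exact: adj_sh_funP.
rewrite -[s in adj_rel s _](subrK t).
by apply: adj_relD; exact: adj_sh_funP.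
Qed.

Lemma adj_sh_monoid : monoid_morphism adj_sh_fun.
Proof.
split=> [|s t]; apply: adj_rel_uniq (@adj_sh_funP _) _.
  have h : preim adj_fun_cont V `<=` opensT T by [].
  rewrite -(rmorph1 (res \O_T h)) -(rmorph1 phi).
  exact: adj_rel_cst.
by apply: adj_relM; exact: adj_sh_funP.
Qed.

HB.instance Definition _ := GRing.isZmodMorphism.Build (regular V)
  (\O_T (preim adj_fun_cont V)) adj_sh_fun adj_sh_zmod.
HB.instance Definition _ := GRing.isMonoidMorphism.Build (regular V)
  (\O_T (preim adj_fun_cont V)) adj_sh_fun adj_sh_monoid.

Definition adj_sh : {rmorphism \O_(Spec B) V -> \O_T (preim adj_fun_cont V)} := adj_sh_fun.

End Sheaf.

Lemma adj_sh_nat (V W : opens (Spec B)) (h : W `<=` V) s :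
  res \O_T (preim_sub h) (adj_sh V s) = adj_sh W (res \O_(Spec B) h s).
Proof.
apply: adj_rel_uniq (@adj_sh_funP _ _) => t Wt.
have [a [k [nk [e1 [O [h1 [h1' [Ot r]]]]]]]] := adj_sh_funP s (h _ Wt).
exists a, k, nk; split=> //.
have OW : opensI O (preim adj_fun_cont W) `<=` preim adj_fun_cont W by move=> x [].
have OT : opensI O (preim adj_fun_cont W) `<=` opensT T by [].
exists (opensI O (preim adj_fun_cont W)), OW, OT; split=> //.
by rewrite res_trans; exact: (adj_rel_res (@opensI_l _ O _) _ OT r).
Qed.

Lemma adj_sh_local (t : T) (V : opens (Spec B)) (s : \O_(Spec B) V) :
  opens_set V (adj_fun t) -> unit_at t (adj_sh V s) -> unit_at (adj_fun t) s.
Proof.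
move=> Vt us; have [a [k [nk [e1 [O [h1 [h1' [Ot r]]]]]]]] := adj_sh_funP s Vt.
rewrite (spec_unit_at e1); apply/adj_funP.
rewrite -(unit_at_res_iff h1') // -r; apply: unit_at_mul; apply/unit_at_res_iff => //.
exact/adj_funP.
Qed.

Lemma spec_mor_exists : exists f : mor T (Spec B),
  forall b, pullback f (spec_const b) = phi b.
Proof.
exists (@Mor T (Spec B) adj_fun adj_fun_cont adj_sh adj_sh_nat adj_sh_local) => b.
have h : preim adj_fun_cont (opensT (Spec B)) `<=` opensT T by [].
have e : adj_sh (opensT (Spec B)) (spec_const b) = res \O_T h (phi b).
  by apply: adj_rel_uniq (@adj_sh_funP _ _) _; exact: adj_rel_cst.
by apply: etrans (congr1 _ e) _; apply: etrans (res_trans _ _ _) _; exact: res_id.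
Qed.

End SpecAdjunction.

(** * Affine R-schemes and their products *)

Lemma calg_hom_ext (R : comPzRingType) (A B : calg R) (f g : calg_hom A B) :
  (forall a, f a = g a) -> f = g.
Proof.
case: f => f fP; case: g => g gP /= /rmorph_ext e.
by move: gP; rewrite -e => gP; rewrite (Prop_irrelevance fP gP).
Qed.

(* An algebra given by generators and relations, realized as the formal
   polynomial expressions in the generators modulo equality of their values in
   all algebras in which the relations hold. *)
Section Presentation.
Variables (R : comPzRingType) (G : Type).
Variable rel : forall C : calg R, (G -> C) -> Prop.

Inductive term :=
| Gen of G
| Cst of R
| Add of term & term
| Opp of term
| Mul of term & term.

HB.instance Definition _ := gen_eqMixin term.
HB.instance Definition _ := gen_choiceMixin term.

Fixpoint eval (C : calg R) (v : G -> C) (t : term) : C :=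
  match t with
  | Gen g => v g
  | Cst r => calg_str C r
  | Add s t => eval v s + eval v t
  | Opp s => - eval v s
  | Mul s t => eval v s * eval v t
  end.

Definition term_eq (s t : term) : bool :=
  `[< forall (C : calg R) (v : G -> C), rel v -> eval v s = eval v t >].

Lemma term_eq_refl : reflexive term_eq.
Proof. by move=> s; apply/asboolP. Qed.

Lemma term_eq_sym : symmetric term_eq.
Proof. by move=> s t; apply/asboolP/asboolP => e C v rv; rewrite e. Qed.

Lemma term_eq_trans : transitive term_eq.
Proof.
by move=> t s u /asboolP e /asboolP e'; apply/asboolP => C v rv; rewrite e // e'.
Qed.

Canonical term_equiv := EquivRel term_eq term_eq_refl term_eq_sym term_eq_trans.

Definition pres : Type := {eq_quot term_eq}.
HB.instance Definition _ := Choice.on pres.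

Definition pres_class (t : term) : pres := \pi_({eq_quot term_eq}) t.

Definition pres_eval (C : calg R) (v : G -> C) (x : pres) : C := eval v (repr x).

Lemma pres_evalE (C : calg R) (v : G -> C) t :
  rel v -> pres_eval v (pres_class t) = eval v t.
Proof.
move=> rv; rewrite /pres_eval.
suff /asboolP e : term_eq (repr (pres_class t)) t by exact: e.
by apply/eqmodP; rewrite /pres_class reprK.
Qed.

Lemma pres_ext (x y : pres) :
  (forall (C : calg R) (v : G -> C), rel v -> pres_eval v x = pres_eval v y) -> x = y.
Proof.
move=> e; rewrite -[x]reprK -[y]reprK; apply/eqmodP/asboolP => C v rv.
exact: e.
Qed.

Definition pres_add (x y : pres) := pres_class (Add (repr x) (repr y)).
Definition pres_opp (x : pres) := pres_class (Opp (repr x)).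
Definition pres_mul (x y : pres) := pres_class (Mul (repr x) (repr y)).

Section EvalOp.
Variables (C : calg R) (v : G -> C).
Hypothesis rv : rel v.

Lemma pres_evalD x y : pres_eval v (pres_add x y) = pres_eval v x + pres_eval v y.
Proof. exact: pres_evalE. Qed.

Lemma pres_evalN x : pres_eval v (pres_opp x) = - pres_eval v x.
Proof. exact: pres_evalE. Qed.

Lemma pres_evalM x y : pres_eval v (pres_mul x y) = pres_eval v x * pres_eval v y.
Proof. exact: pres_evalE. Qed.

Lemma pres_evalC r : pres_eval v (pres_class (Cst r)) = calg_str C r.
Proof. exact: pres_evalE. Qed.

Definition pres_evals := (pres_evalD, pres_evalN, pres_evalM, pres_evalC).

End EvalOp.

Lemma pres_addA : associative pres_add.
Proof.
move=> x y z; apply: pres_ext => C v rv; rewrite !(pres_evals rv) ?rmorph0 ?rmorph1; ring.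
Qed.
Lemma pres_addC : commutative pres_add.
Proof.
move=> x y; apply: pres_ext => C v rv; rewrite !(pres_evals rv) ?rmorph0 ?rmorph1; ring.
Qed.
Lemma pres_add0 : left_id (pres_class (Cst 0)) pres_add.
Proof.
move=> x; apply: pres_ext => C v rv; rewrite !(pres_evals rv) ?rmorph0 ?rmorph1; ring.
Qed.
Lemma pres_addN : left_inverse (pres_class (Cst 0)) pres_opp pres_add.
Proof.
move=> x; apply: pres_ext => C v rv; rewrite !(pres_evals rv) ?rmorph0 ?rmorph1; ring.
Qed.

HB.instance Definition _ := GRing.isZmodule.Build pres
  pres_addA pres_addC pres_add0 pres_addN.

Lemma pres_mulA : associative pres_mul.
Proof.
move=> x y z; apply: pres_ext => C v rv; rewrite !(pres_evals rv) ?rmorph0 ?rmorph1; ring.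
Qed.
Lemma pres_mulC : commutative pres_mul.
Proof.
move=> x y; apply: pres_ext => C v rv; rewrite !(pres_evals rv) ?rmorph0 ?rmorph1; ring.
Qed.
Lemma pres_mul1 : left_id (pres_class (Cst 1)) pres_mul.
Proof.
move=> x; apply: pres_ext => C v rv; rewrite !(pres_evals rv) ?rmorph0 ?rmorph1; ring.
Qed.
Lemma pres_mulDl : left_distributive pres_mul pres_add.
Proof.
move=> x y z; apply: pres_ext => C v rv; rewrite !(pres_evals rv) ?rmorph0 ?rmorph1; ring.
Qed.

HB.instance Definition _ := GRing.Zmodule_isComPzRing.Build pres
  pres_mulA pres_mulC pres_mul1 pres_mulDl.

Definition pres_str_fun (r : R) : pres := pres_class (Cst r).

Lemma pres_str_zmod : zmod_morphism pres_str_fun.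
Proof.
by move=> r s; apply: pres_ext => C v rv; rewrite !(pres_evals rv) rmorphB.
Qed.

Lemma pres_str_monoid : monoid_morphism pres_str_fun.
Proof.
by split=> // r s; apply: pres_ext => C v rv; rewrite !(pres_evals rv) rmorphM.
Qed.

HB.instance Definition _ := GRing.isZmodMorphism.Build R pres pres_str_fun pres_str_zmod.
HB.instance Definition _ := GRing.isMonoidMorphism.Build R pres pres_str_fun pres_str_monoid.

Definition pres_alg : calg R := @Calg R pres pres_str_fun.

Definition pres_gen (g : G) : pres_alg := pres_class (Gen g).

Section Lift.
Variables (C : calg R) (v : G -> C).
Hypothesis rv : rel v.

Lemma pres_eval_zmod : zmod_morphism (pres_eval v).
Proof.
by move=> x y; rewrite [LHS](pres_evalD rv) pres_evalN.
Qed.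

Lemma pres_eval_monoid : monoid_morphism (pres_eval v).
Proof.
split; first by rewrite [LHS](pres_evalE (Cst 1) rv) /= rmorph1.
by move=> x y; rewrite [LHS](pres_evalM rv).
Qed.

Definition pres_lift_zmod := GRing.isZmodMorphism.Build pres C (pres_eval v) pres_eval_zmod.
Definition pres_lift_monoid :=
  GRing.isMonoidMorphism.Build pres C (pres_eval v) pres_eval_monoid.

Definition pres_lift_fun : {rmorphism pres -> C} :=
  HB.pack_for {rmorphism pres -> C} (pres_eval v) pres_lift_zmod pres_lift_monoid.

Lemma pres_lift_subproof r : pres_lift_fun (calg_str pres_alg r) = calg_str C r.
Proof. exact: (pres_evalE (Cst r) rv). Qed.

Definition pres_lift : calg_hom pres_alg C :=
  @CalgHom R pres_alg C pres_lift_fun pres_lift_subproof.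

Lemma pres_liftE g : pres_lift (pres_gen g) = v g.
Proof. exact: (pres_evalE (Gen g) rv). Qed.

End Lift.

Lemma pres_hom_ext (C : calg R) (f h : calg_hom pres_alg C) :
  (forall g, f (pres_gen g) = h (pres_gen g)) -> f = h.
Proof.
move=> e; apply: calg_hom_ext => x.
suff cE t : f (pres_class t) = h (pres_class t) by rewrite -[x]reprK; exact: cE.
elim: t => [g|r|s IHs t IHt|s IHs|s IHs t IHt].
- exact: e.
- by rewrite [LHS](calg_funP f r) [RHS](calg_funP h r).
- have -> : pres_class (Add s t) = (pres_class s : pres_alg) + pres_class t.
    apply: pres_ext => C' v rv; rewrite pres_evalE //.
    by rewrite [RHS](pres_evalD rv) !pres_evalE.
  by rewrite !rmorphD IHs IHt.
- have -> : pres_class (Opp s) = - (pres_class s : pres_alg).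
    apply: pres_ext => C' v rv; rewrite pres_evalE //.
    by rewrite [RHS](pres_evalN rv) pres_evalE.
  by rewrite !rmorphN IHs.
- have -> : pres_class (Mul s t) = (pres_class s : pres_alg) * pres_class t.
    apply: pres_ext => C' v rv; rewrite pres_evalE //.
    by rewrite [RHS](pres_evalM rv) !pres_evalE.
  by rewrite !rmorphM IHs IHt.
Qed.

Lemma pres_alg_ext (x y : pres_alg) :
  (forall (C : calg R) (v : G -> C) (rv : rel v), pres_lift rv x = pres_lift rv y) -> x = y.
Proof. exact: pres_ext. Qed.

End Presentation.

(** * Tensor products of algebras *)

Section Coproduct.
Variables (R : comPzRingType) (A B : calg R).

(** All elements of [A] and of [B] serve as generators, and the relations ask that each side be
    mapped by an algebra morphism. The presented algebra is thus the tensor product of [A] and [B]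
    over [R]. *)
Definition coprod_rel (C : calg R) (v : A + B -> C) : Prop :=
  exists (f : calg_hom A C) (g : calg_hom B C),
    (forall a, v (inl a) = f a) /\ (forall b, v (inr b) = g b).

Definition coprod : calg R := pres_alg coprod_rel.

Section Injection.
Variables (D : calg R) (i : D -> A + B).
Hypothesis iP : forall (C : calg R) (v : A + B -> C), coprod_rel v ->
  exists f : calg_hom D C, forall d, v (i d) = f d.

Lemma coprod_in_subproof : exists f : calg_hom D coprod, forall d, f d =
  pres_gen coprod_rel (i d).
Proof.
pose f d : coprod := pres_gen coprod_rel (i d).
have fB : zmod_morphism f.
  move=> a b; apply: pres_alg_ext => C v rv; have [h hE] := iP rv.
  by rewrite rmorphB !pres_liftE !hE rmorphB.
have fM : monoid_morphism f.
  split=> [|a b]; apply: pres_alg_ext => C v rv; have [h hE] := iP rv.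
    by rewrite pres_liftE hE !rmorph1.
  by rewrite rmorphM !pres_liftE !hE rmorphM.
pose fz := GRing.isZmodMorphism.Build D coprod f fB.
pose fm := GRing.isMonoidMorphism.Build D coprod f fM.
pose fr : {rmorphism D -> coprod} := HB.pack_for {rmorphism D -> coprod} f fz fm.
have frP r : fr (calg_str D r) = calg_str coprod r.
  apply: pres_alg_ext => C v rv; have [h hE] := iP rv.
  by rewrite [LHS](pres_liftE rv) hE calg_funP calg_funP.
by exists (@CalgHom R D coprod fr frP).
Qed.

End Injection.

Lemma coprod_inl_exists : exists f : calg_hom A coprod, forall d, f d =
  pres_gen coprod_rel (inl d).
Proof. by apply: coprod_in_subproof => C v [f [g [vf vg]]]; exists f. Qed.

Lemma coprod_inr_exists : exists f : calg_hom B coprod, forall d, f d =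
  pres_gen coprod_rel (inr d).
Proof. by apply: coprod_in_subproof => C v [f [g [vf vg]]]; exists g. Qed.

Definition coprod_inl := projT1 (cid coprod_inl_exists).
Definition coprod_inr := projT1 (cid coprod_inr_exists).

Lemma coprod_inlE a : coprod_inl a = pres_gen coprod_rel (inl a).
Proof. exact: (projT2 (cid coprod_inl_exists)). Qed.

Lemma coprod_inrE b : coprod_inr b = pres_gen coprod_rel (inr b).
Proof. exact: (projT2 (cid coprod_inr_exists)). Qed.

Section Copair.
Variables (C : calg R) (f : calg_hom A C) (g : calg_hom B C).

Lemma copair_subproof : @coprod_rel C (fun x => match x with inl a => f a | inr b => g b end).
Proof. by exists f, g. Qed.

Definition copair : calg_hom coprod C := pres_lift copair_subproof.

Lemma copair_inl a : copair (coprod_inl a) = f a.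
Proof. by rewrite coprod_inlE /copair pres_liftE. Qed.

Lemma copair_inr b : copair (coprod_inr b) = g b.
Proof. by rewrite coprod_inrE /copair pres_liftE. Qed.

End Copair.

Lemma coprod_ext (C : calg R) (f g : calg_hom coprod C) :
  (forall a, f (coprod_inl a) = g (coprod_inl a)) ->
  (forall b, f (coprod_inr b) = g (coprod_inr b)) -> f = g.
Proof.
by move=> el er; apply: pres_hom_ext => -[a|b]; rewrite -?coprod_inlE -?coprod_inrE.
Qed.

End Coproduct.

Arguments pullback : simpl never.

Definition rglob (R : comPzRingType) (T : rscheme R) : calg R :=
  @Calg R (glob T) (pullback (rsch_str T) \o @spec_const R).

Section AffinePoints.
Variables (R : comPzRingType).
Implicit Types (A B : calg R) (T : rscheme R).

Lemma rhom_spec_exists T A (phi : calg_hom A (rglob T)) :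
  exists f : rhom T (rspec A), forall a, pullback f (spec_const a) = phi a.
Proof.
have [f fE] := spec_mor_exists phi (@rsch_scheme _ T).
have fP : mor_comp (rsch_str (rspec A)) f = rsch_str T.
  apply: spec_mor_ext => r; rewrite pullback_comp [pullback (rsch_str _)
    _]pullback_spec_const fE.
  exact: (calg_funP phi r).
by exists (@Rhom R T (rspec A) f fP).
Qed.

Definition rhom_spec T A (phi : calg_hom A (rglob T)) : rhom T (rspec A) :=
  projT1 (cid (rhom_spec_exists phi)).

Lemma rhom_specE T A (phi : calg_hom A (rglob T)) a :
  pullback (rhom_spec phi) (spec_const a) = phi a.
Proof. exact: (projT2 (cid (rhom_spec_exists phi))). Qed.

Lemma rhom_spec_ext T A (f g : rhom T (rspec A)) :
  (forall a, pullback f (spec_const a) = pullback g (spec_const a)) -> f = g.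
Proof. by move=> e; apply: rhom_ext; exact: spec_mor_ext. Qed.

Section Comorphism.
Variables (T : rscheme R) (A : calg R) (f : rhom T (rspec A)).

Definition rhom_pull_fun : {rmorphism A -> rglob T} := pullback f \o @spec_const A.

Lemma rhom_pull_subproof r : rhom_pull_fun (calg_str A r) = calg_str (rglob T) r.
Proof.
apply: etrans (congr1 (pullback f) (esym (pullback_spec_const (calg_str A) r))) _.
apply: etrans (esym (pullback_comp (rsch_str (rspec A)) f (spec_const r))) _.
by rewrite rhomP.
Qed.

Definition rhom_pull : calg_hom A (rglob T) :=
  @CalgHom R A (rglob T) rhom_pull_fun rhom_pull_subproof.

Lemma rhom_pullE a : rhom_pull a = pullback f (spec_const a). Proof. by []. Qed.

End Comorphism.

Lemma rhom_spec_map T A B (phi : calg_hom A B) (f : rhom T (rspec B)) a :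
  pullback (rhom_comp (rspec_map phi) f) (spec_const a) = pullback f (spec_const (phi a)).
Proof. by rewrite pullback_comp [pullback (rspec_map _) _]pullback_spec_const. Qed.

Section AffineProduct.
Variables A B : calg R.

Definition aprod_fst : rhom (rspec (coprod A B)) (rspec A) := rspec_map (coprod_inl A B).
Definition aprod_snd : rhom (rspec (coprod A B)) (rspec B) := rspec_map (coprod_inr A B).
Definition aprod_pair T (f : rhom T (rspec A)) (g : rhom T (rspec B)) :
  rhom T (rspec (coprod A B)) := rhom_spec (copair (rhom_pull f) (rhom_pull g)).

Lemma aprod_fstK T (f : rhom T (rspec A)) (g : rhom T (rspec B)) :
  rhom_comp aprod_fst (aprod_pair f g) = f.
Proof.
apply: rhom_spec_ext => a.
by rewrite rhom_spec_map rhom_specE copair_inl rhom_pullE.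
Qed.

Lemma aprod_sndK T (f : rhom T (rspec A)) (g : rhom T (rspec B)) :
  rhom_comp aprod_snd (aprod_pair f g) = g.
Proof.
apply: rhom_spec_ext => b.
by rewrite rhom_spec_map rhom_specE copair_inr rhom_pullE.
Qed.

Lemma aprod_uniq T (h : rhom T (rspec (coprod A B))) :
  h = aprod_pair (rhom_comp aprod_fst h) (rhom_comp aprod_snd h).
Proof.
suff e : rhom_pull h = copair (rhom_pull (rhom_comp aprod_fst h)) (rhom_pull (rhom_comp
  aprod_snd h)).
  by apply: rhom_spec_ext => x; rewrite rhom_specE -e rhom_pullE.
apply: coprod_ext => a.
  by rewrite copair_inl !rhom_pullE rhom_spec_map.
by rewrite copair_inr !rhom_pullE rhom_spec_map.
Qed.

Definition affine_product : product (rspec A) (rspec B) :=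
  Product aprod_fstK aprod_sndK aprod_uniq.

End AffineProduct.

Definition no_rel (C : calg R) (v : unit -> C) : Prop := True.

Definition poly_alg : calg R := pres_alg no_rel.

Definition line_coord : glob (rspec poly_alg) := spec_const (pres_gen no_rel tt).

Definition line_mor T (a : glob T) : rhom T (rspec poly_alg) :=
  rhom_spec (@pres_lift R unit no_rel (rglob T) (fun _ => a) I).

Lemma line_morK T (a : glob T) : pullback (line_mor a) line_coord = a.
Proof. by rewrite rhom_specE;
  exact: (@pres_liftE R unit no_rel (rglob T) (fun _ => a) I tt). Qed.

Lemma line_uniq T (h : rhom T (rspec poly_alg)) : h = line_mor (pullback h line_coord).
Proof.
suff e : rhom_pull h = @pres_lift R unit no_rel (rglob T) (fun _ => pullback h line_coord) I.
  by apply: rhom_spec_ext => x; rewrite rhom_specE -e rhom_pullE.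
by apply: pres_hom_ext => -[]; rewrite pres_liftE.
Qed.

Definition line : affine_line R := AffineLine line_morK line_uniq.

End AffinePoints.

(** * Representability of projective modules *)

(* A finitely generated projective M is the image of an idempotent matrix E, so
   that M (x) A is the module of fixed vectors of E in A^n. *)
Section FixedVectors.
Variables (R : comPzRingType) (n : nat) (E : 'I_n -> 'I_n -> R).

Definition fixed (C : calg R) (v : 'I_n -> C) : Prop :=
  forall k, v k = \sum_l calg_str C (E k l) * v l.

Definition fix_alg : calg R := pres_alg fixed.
Definition fix_sch : rscheme R := rspec fix_alg.

Lemma fixed_gen : @fixed fix_alg (pres_gen fixed).
Proof.
move=> k; apply: pres_alg_ext => C v rv; rewrite pres_liftE rmorph_sum rv.
by apply: eq_bigr => l _; rewrite rmorphM calg_funP pres_liftE.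
Qed.

Section Coordinates.
Variable T : rscheme R.

Definition coord (f : rhom T fix_sch) (k : 'I_n) : rglob T :=
  pullback f (spec_const (pres_gen fixed k)).

Lemma coord_fixed f : fixed (coord f).
Proof.
move=> k; rewrite /coord -!(rhom_pullE f) {1}fixed_gen rmorph_sum.
by apply: eq_bigr => l _; rewrite rmorphM calg_funP.
Qed.

Lemma coord_ext f g : (forall k, coord f k = coord g k) -> f = g.
Proof.
move=> e; suff eq_fg : rhom_pull f = rhom_pull g.
  by apply: rhom_spec_ext => a; rewrite -!(rhom_pullE f) eq_fg.
exact: pres_hom_ext.
Qed.

Definition of_coord (v : 'I_n -> rglob T) (rv : fixed v) : rhom T fix_sch :=
  rhom_spec (pres_lift rv).

Lemma coord_of (v : 'I_n -> rglob T) (rv : fixed v) k : coord (of_coord rv) k = v k.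
Proof. by rewrite /coord rhom_specE; exact: pres_liftE. Qed.

End Coordinates.

Lemma coord_comp (S T : rscheme R) (f : rhom T fix_sch) (h : rhom S T) k :
  coord (rhom_comp f h) k = pullback h (coord f k).
Proof. exact: pullback_comp. Qed.

Definition fix_XX := affine_product fix_alg fix_alg.
Definition fix_LX := affine_product (poly_alg R) fix_alg.

Lemma fixedD (C : calg R) (v w : 'I_n -> C) : fixed v -> fixed w -> fixed (fun k => v k + w k).
Proof.
by move=> rv rw k; rewrite rv rw -big_split; apply: eq_bigr => l _; rewrite mulrDr.
Qed.

Lemma fixedZ (C : calg R) a (v : 'I_n -> C) : fixed v -> fixed (fun k => a * v k).
Proof.
by move=> rv k; rewrite rv mulr_sumr; apply: eq_bigr => l _; rewrite mulrCA.
Qed.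

Lemma fixed0 (C : calg R) : @fixed C (fun=> 0).
Proof. by move=> k; rewrite big1 // => l _; rewrite mulr0. Qed.

Definition fix_add : rhom fix_XX fix_sch :=
  of_coord (fixedD (coord_fixed (prod_fst fix_XX)) (coord_fixed (prod_snd fix_XX))).
Definition fix_zero : rhom (rbase R) fix_sch := of_coord (@fixed0 _).
Definition fix_opp : rhom fix_sch fix_sch := rspec_map (pres_lift (fixedZ (-1) fixed_gen)).
Definition fix_act : rhom fix_LX fix_sch :=
  of_coord (fixedZ (pullback (prod_fst fix_LX) (al_coord (line R)) : rglob fix_LX)
    (coord_fixed (prod_snd fix_LX))).

Section PointOperations.
Variable T : rscheme R.
Implicit Types x y : rhom T fix_sch.

Lemma coord_add x y k : coord (pt_add fix_add x y) k = coord x k + coord y k.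
Proof.
rewrite /pt_add coord_comp coord_of rmorphD -!coord_comp.
by rewrite (prod_fstK fix_XX) (prod_sndK fix_XX).
Qed.

Lemma coord_zero k : coord (pt_zero fix_zero T) k = 0.
Proof. by rewrite /pt_zero coord_comp coord_of rmorph0. Qed.

Lemma coord_opp x k : coord (pt_opp fix_opp x) k = - coord x k.
Proof. by rewrite /coord rhom_spec_map pres_liftE mulN1r !rmorphN. Qed.

Lemma coord_act a x k : coord (pt_act (L := line R) (LX :=
  fix_LX) fix_act a x) k = (a : rglob T) * coord x k.
Proof.
rewrite /pt_act coord_comp coord_of rmorphM -coord_comp -pullback_comp.
rewrite (prod_sndK fix_LX); congr (_ * _).
rewrite -[RHS](al_morK (line R)).
exact: (congr1 (fun f : rhom T (line R) =>
  pullback f (al_coord (line R))) (prod_fstK fix_LX _ _)).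
Qed.

End PointOperations.

(** The T-points embed into n-tuples of functions on T by [coord_ext], and the operations are
    coordinatewise, so each law becomes a ring axiom of [rglob T]. *)
Lemma fix_laws : module_laws (L := line R) (XX := fix_XX) (LX := fix_LX)
  fix_add fix_zero fix_opp fix_act.
Proof.
split=> T; intros; apply: coord_ext => k;
  rewrite ?(coord_add, coord_zero, coord_opp, coord_act).
- exact: addrA.
- exact: addrC.
- exact: add0r.
- exact: addNr.
- exact: mulrA.
- exact: mul1r.
- exact: mulrDr.
- exact: mulrDl.
Qed.

Definition fix_module_scheme : module_scheme R := ModuleScheme fix_laws.

End FixedVectors.

(** * Identification of M (x) A with the fixed vectors *)

Section Projective.
Variables (R : comPzRingType) (M : lmodType R) (n : nat).
Variables (w : 'I_n -> M) (lam : 'I_n -> {linear M -> R^o}).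
Hypothesis dual_basis : forall m, m = \sum_k lam k m *: w k.

(** The matrix of R^n -> M -> R^n, where [w] defines the first map and [lam] the second. The other
    composite is the identity of M, so the matrix is idempotent with image isomorphic to M. *)
Let E k l : R := lam k (w l).

Section Algebra.
Variable A : calg R.

Lemma tensor_coord_subproof k : exists g : {additive tensor M A -> A},
  forall m a, g (pure m a) = calg_str A (lam k m) * a.
Proof.
apply: (@tensor_lift _ _ _ _ (fun m a => calg_str A (lam k m) * a)) => [m m' a|m a a'|r m a].
- by rewrite linearD rmorphD mulrDl.
- by rewrite mulrDr.
- by rewrite linearZ /= rmorphM mulrCA mulrA.
Qed.

Definition tensor_coord k : {additive tensor M A -> A} :=
  projT1 (cid (tensor_coord_subproof k)).

Lemma tensor_coord_pure k m a : tensor_coord k (pure m a) = calg_str A (lam k m) * a.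
Proof. exact: (projT2 (cid (tensor_coord_subproof k))). Qed.

Lemma tensor_coord_sum (I : finType) (v : I -> M) (c : I -> A) k :
  tensor_coord k (\sum_i pure (v i) (c i)) = \sum_i calg_str A (lam k (v i)) * c i.
Proof. by rewrite raddf_sum; apply: eq_bigr => i _; exact: tensor_coord_pure. Qed.

Lemma tensor_coordZ k a x : tensor_coord k (a *: x) = a * tensor_coord k x.
Proof.
have [I [v [c ->]]] := tensor_pureP x.
rewrite scaler_sumr !raddf_sum mulr_sumr; apply: eq_bigr => i _.
by rewrite scale_pure !tensor_coord_pure mulrCA.
Qed.

Lemma tensor_coordK x : x = \sum_k pure (w k) (tensor_coord k x).
Proof.
have [I [v [c ->]]] := tensor_pureP x.
under [RHS]eq_bigr => k _ do rewrite tensor_coord_sum pure_sumr.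
rewrite exchange_big; apply: eq_bigr => i _ /=.
rewrite {1}(dual_basis (v i)) pure_suml; apply: eq_bigr => k _.
exact: pureZ.
Qed.

Lemma tensor_coord_fixed x : fixed E (fun k => tensor_coord k x).
Proof. by move=> k; rewrite {1}(tensor_coordK x) tensor_coord_sum. Qed.

Lemma fixed_tensor_coord (c : 'I_n -> A) k : fixed E c ->
  tensor_coord k (\sum_l pure (w l) (c l)) = c k.
Proof. by move=> fc; rewrite tensor_coord_sum (fc k). Qed.

End Algebra.

Lemma tensor_coord_map (A B : calg R) (phi : calg_hom A B) k x :
  tensor_coord B k (tensor_map phi x) = phi (tensor_coord A k x).
Proof.
have [I [v [c ->]]] := tensor_pureP x.
rewrite tensor_map_pure_sum !tensor_coord_sum rmorph_sum; apply: eq_bigr => i _.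
by rewrite rmorphM calg_funP.
Qed.

Lemma fixed_map (A B : calg R) (phi : calg_hom A B) (v : 'I_n -> A) :
  fixed E v -> fixed E (fun k => phi (v k)).
Proof.
by move=> fv k; rewrite fv rmorph_sum; apply: eq_bigr => l _; rewrite rmorphM calg_funP.
Qed.

Lemma const_hom_subproof (A : calg R) r :
  (@spec_const A : {rmorphism A ->
    rglob (rspec A)}) (calg_str A r) = calg_str (rglob (rspec A)) r.
Proof. exact: esym (pullback_spec_const (calg_str A) r). Qed.

Definition const_hom (A : calg R) : calg_hom A (rglob (rspec A)) :=
  @CalgHom R A (rglob (rspec A)) (@spec_const A) (@const_hom_subproof A).

Definition theta_fun (A : calg R) (x : tensor M A) : points (fix_module_scheme E) A :=
  of_coord (fixed_map (const_hom A) (tensor_coord_fixed x)).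

Lemma coord_theta A (x : tensor M A) k :
  coord (theta_fun x) k = spec_const (tensor_coord A k x).
Proof. exact: coord_of. Qed.

Lemma theta_linear A : linear (@theta_fun A).
Proof.
move=> a x y; apply: coord_ext => k; rewrite coord_theta.
apply: etrans (esym (coord_add _ _ k)); rewrite raddfD tensor_coordZ rmorphD rmorphM.
congr (_ + _); last exact: esym (coord_theta y k).
by apply: etrans (esym (coord_act _ _ k)); rewrite coord_theta.
Qed.

HB.instance Definition _ (A : calg R) := GRing.isLinear.Build A (tensor M A)
  (points (fix_module_scheme E) A) _ (@theta_fun A) (@theta_linear A).

Lemma theta_bij A : bijective (@theta_fun A).
Proof.
pose g (f : points (fix_module_scheme E) A) : tensor M A :=
  \sum_k pure (w k) (glob_spec (coord f k)).
exists g => [x|f].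
  rewrite /g {2}(tensor_coordK x); apply: eq_bigr => k _.
  by rewrite coord_theta spec_constK.
apply: coord_ext => k; rewrite coord_theta fixed_tensor_coord ?glob_specK //.
move=> l; apply: spec_const_inj; rewrite glob_specK (coord_fixed f l) rmorph_sum.
apply: eq_bigr => i _; rewrite rmorphM /= glob_specK; congr (_ * _).
exact: esym (const_hom_subproof A (E l i)).
Qed.

Lemma theta_nat (A B : calg R) (phi : calg_hom A B) x :
  theta_fun (tensor_map phi x) = points_map phi (theta_fun x).
Proof.
apply: coord_ext => k; rewrite coord_theta tensor_coord_map.
apply: esym; apply: etrans (coord_comp _ _ _) _; rewrite coord_theta.
exact: pullback_spec_const.
Qed.

Lemma dual_basis_representable : is_qcqs_module_scheme (quasi_coherent M).
Proof.
exists (fix_module_scheme E); split.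
- exact: Spec_quasi_compact.
- exact: Spec_quasi_separated.
by exists (fun A => @theta_fun A); split=> [A|A B phi x];
  [exact: theta_bij | exact: theta_nat].
Qed.

End Projective.

(** The generators give a surjection R^n -> M. Projectivity splits it, and the coordinates of the
    splitting are the forms [lam]. *)
Lemma projective_dual_basis (R : comPzRingType) (M : lmodType R) :
  finitely_generated M -> projective M ->
  exists (n : nat) (w : 'I_n -> M) (lam : 'I_n -> {linear M -> R^o}),
    forall m, m = \sum_k lam k m *: w k.
Proof.
move=> [n [v vgen]] proj; exists n, v.
pose g_fun (x : 'rV[R]_n) : M := \sum_k x 0 k *: v k.
have gL : linear g_fun.
  move=> a x y; rewrite /g_fun scaler_sumr -big_split; apply: eq_bigr => k _ /=.
  by rewrite !mxE scalerDl scalerA.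
pose gl := GRing.isLinear.Build R _ _ _ g_fun gL.
pose g : {linear 'rV[R]_n -> M} := HB.pack_for {linear 'rV[R]_n -> M} g_fun gl.
have [m|h hK] := proj _ _ g (idfun : {linear M -> M}).
  by have [c ->] := vgen m; exists (\row_k c k); apply: eq_bigr => k _; rewrite mxE.
have lamL k : linear (fun m : M => h m 0 k : R^o).
  by move=> a x y; rewrite linearP !mxE.
pose laml k := GRing.isLinear.Build R _ _ _ (fun m : M => h m 0 k : R^o) (lamL k).
by exists (fun k => HB.pack_for {linear M -> R^o} (fun m : M => h m 0 k : R^o) (laml k)) => m;
  rewrite -[LHS]hK.
Qed.

(** * Flatness *)

Section SquareZero.
Variables (R : comPzRingType) (N : lmodType R).

Definition sqz : Type := (R * N)%type.
HB.instance Definition _ := GRing.Zmodule.copy sqz (R * N)%type.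

Definition sqz_pair (r : R) (x : N) : sqz := (r, x).

Lemma sqz_ext (x y : sqz) : x.1 = y.1 -> x.2 = y.2 -> x = y.
Proof. by case: x y => [a x] [b y] /= -> ->. Qed.

Definition sqz_mul (x y : sqz) : sqz := (x.1 * y.1, x.1 *: y.2 + y.1 *: x.2).

Lemma sqz_mulA : associative sqz_mul.
Proof.
move=> [a x] [b y] [c z]; rewrite /sqz_mul /=; congr (_, _); first exact: mulrA.
by rewrite !scalerDr !scalerA addrA (mulrC c a) (mulrC c b).
Qed.

Lemma sqz_mulC : commutative sqz_mul.
Proof. by move=> [a x] [b y]; rewrite /sqz_mul /= mulrC addrC. Qed.

Lemma sqz_mul1 : left_id (1, 0) sqz_mul.
Proof. by move=> [a x]; rewrite /sqz_mul /= mul1r scale1r scaler0 addr0. Qed.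

Lemma sqz_mulDl : left_distributive sqz_mul +%R.
Proof.
move=> [a x] [b y] [c z]; rewrite /sqz_mul /=; congr (_, _); first exact: mulrDl.
by rewrite /= scalerDl scalerDr addrACA.
Qed.

HB.instance Definition _ := GRing.Zmodule_isComPzRing.Build sqz
  sqz_mulA sqz_mulC sqz_mul1 sqz_mulDl.

Definition sqz_in (r : R) : sqz := (r, 0).

Lemma sqz_in_zmod : zmod_morphism sqz_in.
Proof. by move=> r s; congr (_, _); rewrite /= subr0. Qed.

Lemma sqz_in_monoid : monoid_morphism sqz_in.
Proof. by split=> // r s; congr (_, _); rewrite /= !scaler0 addr0. Qed.

HB.instance Definition _ := GRing.isZmodMorphism.Build R sqz sqz_in sqz_in_zmod.
HB.instance Definition _ := GRing.isMonoidMorphism.Build R sqz sqz_in sqz_in_monoid.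

Definition sqz_alg : calg R := @Calg R sqz sqz_in.

Definition sqz_eps (x : N) : sqz_alg := (0, x).

Lemma sqz_epsD x y : sqz_eps (x + y) = sqz_eps x + sqz_eps y.
Proof. by congr (_, _); rewrite /= addr0. Qed.

Lemma sqz_epsZ r x : sqz_eps (r *: x) = calg_str sqz_alg r * sqz_eps x.
Proof. by congr (_, _); rewrite /= ?mulr0 // scale0r addr0. Qed.

End SquareZero.

Section SquareZeroMap.
Variables (R : comPzRingType) (N P : lmodType R) (g : {linear N -> P}).

Definition sqz_map_fun (x : sqz N) : sqz P := (x.1, g x.2).

Lemma sqz_map_zmod : zmod_morphism sqz_map_fun.
Proof. by move=> x y; congr (_, _); rewrite linearB. Qed.

Lemma sqz_map_monoid : monoid_morphism sqz_map_fun.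
Proof.
split=> [|x y]; congr (_, _); first by rewrite linear0.
by rewrite /= linearD !linearZ.
Qed.

HB.instance Definition _ := GRing.isZmodMorphism.Build (sqz N) (sqz P) sqz_map_fun
  sqz_map_zmod.
HB.instance Definition _ := GRing.isMonoidMorphism.Build (sqz N) (sqz P) sqz_map_fun
  sqz_map_monoid.

Lemma sqz_map_subproof r : (sqz_map_fun : {rmorphism sqz N ->
  sqz P}) (calg_str (sqz_alg N) r) =
  calg_str (sqz_alg P) r.
Proof. by congr (_, _); exact: linear0. Qed.

Definition sqz_map : calg_hom (sqz_alg N) (sqz_alg P) :=
  @CalgHom R (sqz_alg N) (sqz_alg P) sqz_map_fun sqz_map_subproof.

Hypothesis g_inj : injective g.

(* The primes of both extensions are those of R. *)
Lemma sqz_spec_surj (p : spec (sqz N)) : exists q : spec (sqz P), spec_fun sqz_map q = p.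
Proof.
have eps (x : N) : prime_set p (sqz_pair 0 x).
  have : prime_set p (sqz_pair 0 x * sqz_pair 0 x : sqz N).
    rewrite [_ * _](_ : _ = 0); first exact: prime0.
    by apply: sqz_ext; rewrite /= ?mul0r // !scale0r addr0.
  by case/primeP.
have pE (x : sqz N) : prime_set p x <-> prime_set p (sqz_pair x.1 (0 : N)).
  have e : x = sqz_pair x.1 0 + sqz_pair 0 x.2 by case: x => a y; apply: sqz_ext;
    rewrite /= ?addr0 ?add0r.
  have e' : sqz_pair x.1 0 = x + sqz_pair 0 (- x.2).
    by case: x {e} => a y; apply: sqz_ext; rewrite /= ?addr0 ?subrr.
  by split=> px; [rewrite e' | rewrite e]; apply: primeD.
have Q0 : prime_set p (sqz_pair (0 : sqz P).1 (0 : N)) by exact: prime0.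
have QD (a b : sqz P) : prime_set p (sqz_pair a.1 (0 : N)) ->
  prime_set p (sqz_pair b.1 (0 : N)) -> prime_set p (sqz_pair (a + b).1 (0 : N)).
  move=> pa pb; have := primeD pa pb; congr prime_set;  apply: sqz_ext => //=; exact: addr0.
have QME (a b : sqz P) : sqz_pair (a * b).1 (0 : N) = sqz_pair a.1 0 * sqz_pair b.1 0.
  by apply: sqz_ext; rewrite //= !scaler0 addr0.
have QM (a b : sqz P) : prime_set p (sqz_pair b.1 (0 : N)) ->
  prime_set p (sqz_pair (a * b).1 (0 : N)).
  by move=> pb; rewrite QME; exact: primeM.
have Q1 : ~ prime_set p (sqz_pair (1 : sqz P).1 (0 : N)) by exact: prime1.
have QP (a b : sqz P) : prime_set p (sqz_pair (a * b).1 (0 : N)) ->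
  prime_set p (sqz_pair a.1 (0 : N)) \/ prime_set p (sqz_pair b.1 (0 : N)).
  by rewrite QME; exact: primeP.
exists (@Prime (sqz P) [set x | prime_set p (sqz_pair x.1 (0 : N))] Q0 QD QM Q1 QP).
by apply: prime_ext => x; rewrite spec_funE /=; apply: iff_sym; exact: pE.
Qed.

Lemma sqz_loc_inj (p : spec (sqz N)) (q : spec (sqz P))
    (pq : forall a, ~ prime_set p a -> ~ prime_set q (sqz_map a)) :
  p = spec_fun sqz_map q -> injective (loc_map pq).
Proof.
move=> pE x y /eqP; rewrite -subr_eq0 -rmorphB => /eqP e; apply/eqP; rewrite -subr_eq0;
  apply/eqP.
elim/loc_ind: (x - y) e => a s ns; rewrite loc_mapE => /frac_eq0[u nu ua].
(* The factor u = (u1, u2) that kills the image of a = (a1, a2) need not come from [sqz N], but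
   (u1^2, 0) does. Its image differs from u^2 by a nilpotent, hence avoids [q]; and u1 a1 = 0 with
   u1 g(a2) + a1 u2 = 0 gives u1^2 g(a2) = 0. *)
apply/frac_eq0; exists (sqz_pair (u.1 * u.1) (0 : N)).
  rewrite pE spec_funE => h; apply: (prime_mul nu nu); move: h.
  have -> : u * u = sqz_map (sqz_pair (u.1 * u.1) (0 : N)) + sqz_pair 0 ((u.1 + u.1) *: u.2).
    by apply: sqz_ext; rewrite /= ?addr0 // linear0 add0r -scalerDl.
  move=> h; apply: primeD => //.
  have : prime_set q (sqz_pair 0 ((u.1 + u.1) *: u.2) * sqz_pair 0 ((u.1 + u.1) *: u.2) :
    sqz P).
    rewrite [_ * _](_ : _ = 0); first exact: prime0.
    by apply: sqz_ext; rewrite /= ?mul0r // !scale0r addr0.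
  by case/primeP.
have u1 : u.1 * a.1 = 0 by have := congr1 (fun z : sqz P => z.1) ua.
have /= u2 : u.1 *: g a.2 + a.1 *: u.2 = 0 by have := congr1 (fun z : sqz P => z.2) ua.
apply: sqz_ext; rewrite /= ?scaler0 ?addr0.
  by rewrite -mulrA u1 mulr0.
apply: g_inj; rewrite linear0 linearZ /= -scalerA.
move/(congr1 (fun z => u.1 *: z)): u2;
  rewrite scalerDr [X in _ + X]scalerA u1 scale0r addr0 => ->.
by rewrite scaler0.
Qed.

(** The map of spectra is surjective on points and injective on localizations, and sections over a
    spectrum are functions with values in the localizations. *)
Lemma sqz_epi (X : rspace) (f h : mor (Spec (sqz N)) X) :
  mor_comp f (Spec_map sqz_map) = mor_comp h (Spec_map sqz_map) -> f = h.
Proof.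
move=> e; have fh p : f p = h p.
  have [q <-] := sqz_spec_surj p.
  exact: (congr1 (fun k : mor (Spec (sqz P)) X => k q) e).
apply: mor_ext => // V k s; apply: regular_ext => p Vp.
have [q pE] := sqz_spec_surj p.
have pq a : ~ prime_set p a -> ~ prime_set q (sqz_map a) by rewrite -pE; exact: spec_fun_compl.
apply: (sqz_loc_inj (pq := pq)); first exact: esym.
pose O : opens (Spec (sqz P)) := preim (mor_cont (mor_comp f (Spec_map sqz_map))) V.
have hf : O `<=` preim (mor_cont (mor_comp f (Spec_map sqz_map))) V by [].
have hh : O `<=` preim (mor_cont (mor_comp h (Spec_map sqz_map))) V.
  by rewrite -e.
have Oq : opens_set O q by rewrite /= pE fh.
have {}e := congr1 (fun r : regular O => reg_fun r Oq) (pull_eq hf hh s e).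
apply: etrans (etrans _ e) _.
  exact: (loc_map_reg (mor_sh f V s) _ _ _ (@spec_fun_compl _ _ sqz_map q) (esym pE)).
exact: (loc_map_reg (mor_sh h V s) _ _ (@spec_fun_compl _ _ sqz_map q) _ pE).
Qed.

End SquareZeroMap.

(** Tensor products are formed with algebras only, so N enters through R + N, whose tensor product
    with M is the sum of M and M (x) N. The map is the identity on the summand M, so the condition
    is flatness of M. *)
Definition sqz_flat (R : comPzRingType) (M : lmodType R) : Prop :=
  forall (N P : lmodType R) (g : {linear N -> P}), injective g ->
    injective (tensor_map (M := M) (sqz_map g)).

Lemma representable_flat (R : comPzRingType) (M : lmodType R) (X : module_scheme R) :
  mf_iso (quasi_coherent M) (functor_of_points X) -> sqz_flat M.
Proof.
move=> [theta [theta_bij theta_nat]] N P g g_inj x y e.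
apply: (bij_inj (theta_bij (sqz_alg N))); apply: rhom_ext.
apply: (sqz_epi g_inj); have := congr1 (theta (sqz_alg P)) e.
move: (theta_nat _ _ (sqz_map g) x) (theta_nat _ _ (sqz_map g) y) => /= -> ->.
exact: (congr1 (fun f : rhom (rspec (sqz_alg P)) X => rhom_mor f)).
Qed.

(** * The equational criterion of flatness *)

Section Restriction.
Variables (R : comPzRingType) (C : calg R).

Definition calg_mod : Type := C.
HB.instance Definition _ := GRing.Zmodule.on calg_mod.

Definition calg_mod_scale (r : R) (x : calg_mod) : calg_mod := calg_str C r * (x : C).

Lemma calg_mod_scaleA a b x : calg_mod_scale a (calg_mod_scale b x) = calg_mod_scale (a * b) x.
Proof. by rewrite /calg_mod_scale rmorphM mulrA. Qed.

Lemma calg_mod_scale1 : left_id 1 calg_mod_scale.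
Proof. by move=> x; rewrite /calg_mod_scale rmorph1 mul1r. Qed.

Lemma calg_mod_scaleDr : right_distributive calg_mod_scale +%R.
Proof. by move=> a x y; exact: mulrDr. Qed.

Lemma calg_mod_scaleDl x : {morph calg_mod_scale^~ x : a b / a + b}.
Proof. by move=> a b; rewrite /calg_mod_scale rmorphD; exact: mulrDl. Qed.

HB.instance Definition _ := GRing.Zmodule_isLmodule.Build R calg_mod
  calg_mod_scaleA calg_mod_scale1 calg_mod_scaleDr calg_mod_scaleDl.

Section Span.
Variables (I : finType) (c : I -> C).

Definition comb (rho : I -> R) : C := \sum_a calg_str C (rho a) * c a.

Lemma combD rho sigma : comb (fun a => rho a + sigma a) = comb rho + comb sigma.
Proof. by rewrite -big_split; apply: eq_bigr => a _; rewrite rmorphD mulrDl. Qed.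

Lemma combB rho sigma : comb (fun a => rho a - sigma a) = comb rho - comb sigma.
Proof. by rewrite -sumrB; apply: eq_bigr => a _; rewrite rmorphB mulrBl. Qed.

Lemma combZ r rho : comb (fun a => r * rho a) = calg_str C r * comb rho.
Proof. by rewrite mulr_sumr; apply: eq_bigr => a _; rewrite rmorphM mulrA. Qed.

Lemma comb_delta a : comb (fun b => (b == a)%:R) = c a.
Proof.
rewrite /comb (bigD1 a) //= eqxx rmorph1 mul1r big1 ?addr0 // => b /negbTE ->.
by rewrite rmorph0 mul0r.
Qed.

Definition span_pred : {pred calg_mod} := fun x => `[< exists rho, x = comb rho >].

Lemma span_submod : submod_closed span_pred.
Proof.
split=> [|r x y /asboolP[rho ->] /asboolP[sigma ->]]; apply/asboolP.
  by exists (fun=> 0); rewrite /comb big1 // => a _; rewrite rmorph0 mul0r.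
by exists (fun a => r * rho a + sigma a); rewrite combD combZ.
Qed.

HB.instance Definition _ := GRing.isSubmodClosed.Build R calg_mod span_pred span_submod.

Record span := Span { span_val :> calg_mod; span_valP : span_val \in span_pred }.

HB.instance Definition _ := [isSub for span_val].
HB.instance Definition _ := [Choice of span by <:].
HB.instance Definition _ := [SubChoice_isSubLmodule of span by <:].

Lemma span_rep_exists (x : span) : exists rho, comb rho = span_val x.
Proof. by have /asboolP[rho e] := span_valP x; exists rho. Qed.

Definition span_rep (x : span) : I -> R := projT1 (cid (span_rep_exists x)).

Lemma span_repE x : comb (span_rep x) = span_val x.
Proof. exact: (projT2 (cid (span_rep_exists x))). Qed.

Lemma span_gen_subproof a : (c a : calg_mod) \in span_pred.
Proof. by apply/asboolP; exists (fun b => (b == a)%:R); rewrite comb_delta. Qed.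

Definition span_gen a : span := Span (span_gen_subproof a).

End Span.
End Restriction.

Section Criterion.
Variables (R : comPzRingType) (M : lmodType R).

(* [v] lies in M.K for a submodule K of R^I: it factors through the relations in K. *)
Definition factors (I : finType) (K : (I -> R) -> Prop) (v : I -> M) : Prop :=
  exists (J : finType) (w : J -> M) (r : J -> I -> R),
    (forall a, v a = \sum_l r l a *: w l) /\ forall l, K (r l).

Section Factors.
Variables (I : finType) (K : (I -> R) -> Prop).

Lemma factors_ext v v' : v =1 v' -> factors K v -> factors K v'.
Proof. by move=> e [J [w [r [vE rK]]]]; exists J, w, r; split=> // a; rewrite -e. Qed.

Lemma factors0 v : v =1 (fun=> 0) -> factors K v.
Proof.
move=> v0; exists void, (fun=> 0), (fun=> fun=> 0); split=> [a|[]].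
by rewrite v0 big_pred0 // => -[].
Qed.

Lemma factorsD v v' : factors K v -> factors K v' -> factors K (fun a => v a + v' a).
Proof.
move=> [J [w [r [vE rK]]]] [J' [w' [r' [vE' rK']]]].
exists (J + J')%type, (fun x => match x with inl l => w l | inr l => w' l end),
  (fun x => match x with inl l => r l | inr l => r' l end); split; last by case.
by move=> a; rewrite big_sumType /= vE vE'.
Qed.

Lemma factorsN v : factors K v -> factors K (fun a => - v a).
Proof.
move=> [J [w [r [vE rK]]]]; exists J, (fun l => - w l), r; split=> // a.
by rewrite vE -sumrN; apply: eq_bigr => l _; rewrite scalerN.
Qed.

Lemma factors1 rho m : K rho -> factors K (fun a => rho a *: m).
Proof.
move=> Krho; exists unit, (fun=> m), (fun=> rho); split=> // a.
by rewrite (big_pred1 tt) // => -[].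
Qed.

Lemma factors_sum (L : finType) (rho : L -> I -> R) (m : L -> M) :
  (forall l, K (rho l)) -> factors K (fun a => \sum_l rho l a *: m l).
Proof. by move=> Krho; exists L, m, rho. Qed.

End Factors.

(** The span N of the [c a] is R^I modulo the relations K, so M (x) N is M^I modulo M.K. By flatness
    the sum already vanishes in M (x) N, and so [v] lies in M.K. The quotient of M^I is replaced by
    the equivalence [eqE]. *)
Lemma flat_criterion (I : finType) (C : calg R) (v : I -> M) (c : I -> C) :
  sqz_flat M -> \sum_a pure (v a) (c a) = 0 ->
  factors (fun rho => comb c rho = 0) v.
Proof.
move=> flatM vc0; pose K := fun rho => comb c rho = 0.
pose z : tensor M (sqz_alg (span c)) := \sum_a pure (v a) (sqz_eps (span_gen c a)).
have z0 : z = 0.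
  apply: (flatM _ _ (\val : {linear span c -> calg_mod C}) val_inj).
  rewrite tensor_map0 tensor_map_pure_sum.
  (* [g] carries the vanishing sum from M (x) C to the square-zero extension by C, where flatness
     applies. *)
  have [|||g gE] := @tensor_lift R M C (tensor M (sqz_alg (calg_mod C)))
      (fun m x => pure m (sqz_eps (x : calg_mod C))).
  - by move=> m m' x; rewrite pureDl.
  - by move=> m x x'; rewrite sqz_epsD pureDr.
  - by move=> r m x; rewrite pureZ -sqz_epsZ.
  transitivity (g (\sum_a pure (v a) (c a))); last by rewrite vc0 raddf0.
  by rewrite raddf_sum; apply: eq_bigr => a _; rewrite gE.
pose s := [seq (v a, sqz_eps (span_gen c a)) | a <- enum I].
have {z0} : tensor_rel s [::].
  apply/tensor_eq; rewrite tensor_class0 -z0 tensor_classE.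
  rewrite -(big_tuple _ _ (in_tuple s) xpredT (fun p => pure p.1 p.2)) /= big_map big_enum.
  by [].
pose eqE (x y : I -> M) := factors K (fun a => x a - y a).
(* A pure tensor of [m] and [t] goes to rho m, for a chosen coefficient vector rho of the
   N-component of [t]. Another choice changes the result by an element of M.K. *)
pose f m (t : sqz_alg (span c)) : I -> M := fun a => span_rep t.2 a *: m.
move/(@tensor_rel_fold R M _ (I -> M) eqE (fun x y a => x a + y a) (fun=> 0) f).
set Phi := foldr _ _ s; case.
- by move=> x; apply: factors0 => a /=; rewrite subrr.
- by move=> x y xy; apply: factors_ext (factorsN xy) => a; rewrite opprB.
- by move=> x y t xy yt; apply: factors_ext (factorsD xy yt) => a /=; rewrite addrA subrK.
- by move=> x x' y y' xx yy; apply: factors_ext (factorsD xx yy) => a /=;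
    rewrite opprD addrACA.
- by move=> x y t; apply: factors0 => a /=; rewrite addrA subrr.
- by move=> x y; apply: factors0 => a /=; rewrite [y a + _]addrC subrr.
- by move=> x; apply: factors0 => a /=; rewrite add0r subrr.
- by move=> t; apply: factors0 => a /=; rewrite /f scaler0 subrr.
- by move=> m m' t; apply: factors0 => a /=; rewrite /f scalerDr subrr.
- move=> m t t'; rewrite /f.
  apply: factors_ext (@factors1 _ K (fun a =>
    span_rep (t + t').2 a - (span_rep t.2 a + span_rep t'.2 a)) m _).
    by move=> a; rewrite scalerBl scalerDl.
  by rewrite /K combB combD !span_repE /= subrr.
- move=> r m t; rewrite /f.
  apply: factors_ext (@factors1 _ K
    (fun a => r * span_rep t.2 a - span_rep (calg_str (sqz_alg _) r * t).2 a) m _).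
    by move=> a; rewrite scalerBl scalerA mulrC.
  rewrite /K combB combZ !span_repE /= scaler0 addr0 subrr.
  by [].
move=> J [w [r [PhiE rK]]].
have PhiE' a : Phi a = \sum_b span_rep (span_gen c b) a *: v b.
  rewrite /Phi /s -big_enum /=; elim: (enum I) => [|b t IHt] /=; first by rewrite big_nil.
  by rewrite big_cons IHt.
(* The vector chosen for the generator [c b] need not be the unit vector at [b], but differs from it
   by a relation. *)
have dK b : K (fun a => (a == b)%:R - span_rep (span_gen c b) a).
  by rewrite /K combB comb_delta span_repE subrr.
apply: factors_ext (factorsD (factors_sum v dK) (ex_intro _ J (ex_intro _ w (ex_intro _ r
  (conj PhiE rK))))).
move=> a; rewrite subr0 PhiE' -big_split /= (bigD1 a) //= eqxx.
rewrite -scalerDl subrK scale1r big1 ?addr0 // => b; rewrite eq_sym => /negbTE ->.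
by rewrite -scalerDl subrK scale0r.
Qed.

End Criterion.

(** * Charts and gluing *)

Section ClosedPoint.
Variables (A : comPzRingType) (p : spec A).

Lemma frac_unitP a s (ns : ~ prime_set p s) :
  (exists y, frac a ns * y = 1) <-> ~ prime_set p a.
Proof.
split=> [[y]|na]; first exact: frac_unit.
by exists (frac s na); rewrite -(fracM _ _ _ _ (prime_mul ns na)) mulrC frac1.
Qed.

(** The maximal ideal of A_p. Localizing A_p there changes nothing, so a function on Spec A_p is
    read off as an element of A_p at this point; [germ] uses it to identify a stalk map. *)
Lemma closed_point_subproof : exists m : spec (loc p),
  forall x, prime_set m x <-> ~ exists y, x * y = 1.
Proof.
pose m := [set x : loc p | ~ exists y, x * y = 1].
have m0 : m 0 by rewrite /m /= -(frac0 (@prime1 _ p)) frac_unitP; apply; exact: prime0.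
have mD x y : m x -> m y -> m (x + y).
  rewrite /m /=; elim/loc_ind: x => a s ns; elim/loc_ind: y => b t nt.
  rewrite -(fracD _ _ _ _ (prime_mul ns nt)) !frac_unitP !notK => pa pb.
  by apply: primeD; rewrite mulrC; exact: primeM.
have mM x y : m y -> m (x * y).
  by move=> my [z xyz]; apply: my; exists (x * z); rewrite -xyz; ring.
have m1 : ~ m 1 by apply; exists 1; rewrite mulr1.
have mP x y : m (x * y) -> m x \/ m y.
  move=> mxy; apply/not_andP => -[[z xz] [t yt]]; apply: mxy; exists (z * t).
  by rewrite mulrACA xz yt mulr1.
by exists (@Prime (loc p) m m0 mD mM m1 mP).
Qed.

Definition closed_point : spec (loc p) := projT1 (cid closed_point_subproof).

Lemma closed_pointP x : prime_set closed_point x <-> ~ exists y, x * y = 1.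
Proof. exact: (projT2 (cid closed_point_subproof)). Qed.

Lemma spec_fun_closed_point : spec_fun (@loc_in A p) closed_point = p.
Proof. by apply: prime_ext => a; rewrite spec_funE closed_pointP frac_unitP notK. Qed.

Lemma loc_map_closed_point (h : forall a, ~ prime_set p a ->
  ~ prime_set closed_point (loc_in p a)) x :
  loc_map h x = loc_in closed_point x.
Proof.
elim/loc_ind: x => a s ns; rewrite loc_mapE; apply: frac_eqI.
by rewrite mulr1 mulrC; exact/esym/loc_in_frac.
Qed.

Lemma loc_in_closed_point_inj : injective (@loc_in (loc p) closed_point).
Proof.
move=> x y e; apply/eqP; rewrite -subr_eq0; apply/eqP.
have /loc_in_eq0[u] : loc_in closed_point (x - y) = 0 by rewrite rmorphB; apply/eqP;
  rewrite subr_eq0; apply/eqP.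
rewrite closed_pointP notK => -[z uz] uxy.
by rewrite -[x - y]mul1r -uz mulrAC uxy mul0r.
Qed.

Lemma spec_loc_generic (U : set (spec A)) (q : spec (loc p)) :
  open U -> U p -> U (spec_fun (@loc_in A p) q).
Proof.
move=> Uo Up; have [f nf fU] := basicP Uo Up; apply: fU.
rewrite /= spec_funE => qf; have [y fy] := loc_in_unit nf.
by apply: (@prime1 _ q); rewrite -fy mulrC; exact: primeM.
Qed.

End ClosedPoint.

Section Charts.
Variables (R : comPzRingType) (M : lmodType R) (X : rscheme R).
Variable tau : forall A : calg R, rhom (rspec A) X -> tensor M A.
Hypothesis tau_nat : forall (A B : calg R) (phi : calg_hom A B) (f : rhom (rspec A) X),
  tau (rhom_comp f (rspec_map phi)) = tensor_map phi (tau f).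

Record chart := Chart {
  ch_ring : comPzRingType;
  ch_mor : mor (Spec ch_ring) X;
  ch_open : open_immersion ch_mor }.

Section OneChart.
Variable c : chart.

Definition ch_str : {rmorphism R -> ch_ring c} :=
  s2val (cid2 (affine_full (mor_comp (rsch_str X) (ch_mor c)))).

Lemma ch_strE : mor_comp (rsch_str X) (ch_mor c) = Spec_map ch_str.
Proof. exact: (s2valP (cid2 (affine_full (mor_comp (rsch_str X) (ch_mor c))))). Qed.

Definition ch_alg : calg R := Calg ch_str.
Definition ch_point : rhom (rspec ch_alg) X := @Rhom R (rspec ch_alg) X (ch_mor c) ch_strE.
Definition ch_xi : tensor M ch_alg := tau ch_point.
Definition ch_dom : opens X := chart_set (ch_open c).
Definition ch_sec (b : ch_alg) : \O_X ch_dom := chart_section (ch_open c) b.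

Lemma ch_dom_compact : cover_compact ch_dom.
Proof. by apply: cover_compact_image; [exact: mor_cont | exact: Spec_quasi_compact]. Qed.

(** Every open neighbourhood of p contains the image of Spec A_p, so [f] restricted to Spec A_p
    factors through the chart by some [chi]. Naturality of [tau] gives the tensor at p, and
    evaluation at the closed point identifies [chi] with the stalk map. *)
Lemma germ (A : calg R) (f : rhom (rspec A) X) (p : Spec A)
    (Up : opens_set (preim (mor_cont f) ch_dom) p) :
  exists2 chi : calg_hom ch_alg (loc_alg p),
    tensor_map (loc_hom p) (tau f) = tensor_map chi ch_xi &
    forall b, chi b = reg_fun (mor_sh f ch_dom (ch_sec b)) Up.
Proof.
pose g := mor_comp f (Spec_map (@loc_in A p)).
have hg : opensT (Spec (loc p)) `<=` preim (mor_cont g) ch_dom.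
  by move=> q _; apply: (spec_loc_generic q (opens_open (preim (mor_cont f) ch_dom))).
have [chi gE chiE] := affine_factor hg.
have chiP r : chi (calg_str ch_alg r) = calg_str (loc_alg p) r.
  apply: spec_const_inj; rewrite -[LHS]pullback_spec_const.
  rewrite -[X in pullback _ X](pullback_spec_const ch_str r) -ch_strE.
  rewrite -[LHS]pullback_comp -mor_compA -gE /g mor_compA rhomP.
  by rewrite pullback_comp !pullback_spec_const.
pose chi' : calg_hom ch_alg (loc_alg p) := @CalgHom R ch_alg (loc_alg p) chi chiP.
exists chi'.
  rewrite -!tau_nat; congr tau; apply: rhom_ext; exact: gE.
move=> b; apply: loc_in_closed_point_inj.
pose m := closed_point p.
have mp : spec_fun (@loc_in A p) m = p := spec_fun_closed_point p.
have hm a : ~ prime_set p a -> ~ prime_set m (loc_in p a).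
  by rewrite -{1}mp; exact: spec_fun_compl.
have e := congr1 (fun s : regular (opensT (spec (loc p))) =>
  reg_fun s (I : opens_set (opensT (spec (loc p))) m)) (chiE b).
apply: etrans (esym e) _; apply: etrans _ (loc_map_closed_point hm _).
exact: (loc_map_reg (mor_sh f ch_dom (ch_sec b)) _ Up (@spec_fun_compl _ _ (@loc_in A p) m)
  hm mp).
Qed.

End OneChart.

End Charts.

(** * Simultaneous refinement of the coefficients *)

Section Refinement.
Variables (R : comPzRingType) (M : lmodType R) (I : finType) (v : I -> M).
Implicit Types K : (I -> R) -> Prop.

(* The quantification over all expressions of [v] makes this property stable under
   finite intersections. *)
Definition refinable K : Prop :=
  forall (J : finType) (w : J -> M) (r : J -> I -> R), (forall a, v a = \sum_l r l a *: w l) ->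
  exists (J' : finType) (w' : J' -> M) (s : J' -> J -> R),
    (forall l, w l = \sum_k s k l *: w' k) /\ forall k, K (fun a => \sum_l s k l * r l a).

Definition lin_closed K : Prop := forall (J : finType) (r : J -> I -> R) (s : J -> R),
  (forall l, K (r l)) -> K (fun a => \sum_l s l * r l a).

Lemma refine_comp (J J' : finType) (w : J -> M) (w' : J' -> M) (r : J -> I -> R) (s : J' ->
  J -> R) :
  (forall a, v a = \sum_l r l a *: w l) -> (forall l, w l = \sum_k s k l *: w' k) ->
  forall a, v a = \sum_k (\sum_l s k l * r l a) *: w' k.
Proof.
move=> vE wE a; under [RHS]eq_bigr => k _ do rewrite scaler_suml.
rewrite exchange_big vE; apply: eq_bigr => l _; rewrite wE scaler_sumr.
by apply: eq_bigr => k _; rewrite scalerA mulrC.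
Qed.

Lemma refinable_sub K K' : (forall rho, K rho -> K' rho) -> refinable K -> refinable K'.
Proof.
move=> KK' sK J w r vE; have [J' [w' [s [wE rK]]]] := sK J w r vE.
by exists J', w', s; split=> // k; exact: KK'.
Qed.

Lemma refinableT : refinable (fun=> True).
Proof.
move=> J w r vE; exists J, w, (fun k l => (k == l)%:R); split=> // l.
rewrite (bigD1 l) //= eqxx scale1r big1 ?addr0 // => k /negbTE ->.
by rewrite scale0r.
Qed.

(** After a refinement for [K], one for [K'] replaces the coefficient vectors by linear combinations
    of vectors in [K], which stay in [K]. *)
Lemma refinableI K K' : lin_closed K -> refinable K -> refinable K' ->
  refinable (fun rho => K rho /\ K' rho).
Proof.
move=> linK sK sK' J w r vE; have [J1 [w1 [s1 [wE rK]]]] := sK J w r vE.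
have [J2 [w2 [s2 [w1E rK']]]] := sK' _ _ _ (refine_comp vE wE).
exists J2, w2, (fun k l => \sum_i s2 k i * s1 i l); split.
  move=> l; under [RHS]eq_bigr => k _ do rewrite scaler_suml.
  rewrite exchange_big wE; apply: eq_bigr => i _; rewrite w1E scaler_sumr.
  by apply: eq_bigr => k _; rewrite scalerA mulrC.
move=> k; have e : (fun a => \sum_l (\sum_i s2 k i * s1 i l) * r l a) =
    (fun a => \sum_i s2 k i * (\sum_l s1 i l * r l a)).
  apply: funext => a; under [LHS]eq_bigr => l _ do rewrite mulr_suml.
  rewrite exchange_big; apply: eq_bigr => i _; rewrite mulr_sumr.
  by apply: eq_bigr => l _; rewrite mulrA.
by rewrite e; split; [exact: linK | exact: rK'].
Qed.

Lemma refinable_all (T : finType) (K : T -> (I -> R) -> Prop) :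
  (forall t, lin_closed (K t)) -> (forall t, refinable (K t)) ->
  refinable (fun rho => forall t, K t rho).
Proof.
move=> linK sK; suff sub (s : seq T) : refinable (fun rho => forall t, t \in s -> K t rho).
  by apply: refinable_sub (sub (enum T)) => rho h t; apply: h; rewrite mem_enum.
elim: s => [|t s IHs]; first by apply: refinable_sub refinableT.
apply: refinable_sub (refinableI (linK t) (sK t) IHs) => rho [h1 h2] u.
by rewrite inE => /orP[/eqP -> //|/h2].
Qed.

Lemma comb_lin (C : calg R) (c : I -> C) (J : finType) (r : J -> I -> R) (s : J -> R) :
  comb c (fun a => \sum_l s l * r l a) = \sum_l calg_str C (s l) * comb c (r l).
Proof.
rewrite /comb; under [LHS]eq_bigr => a _ do rewrite rmorph_sum mulr_suml.
rewrite exchange_big; apply: eq_bigr => l _; rewrite mulr_sumr.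
by apply: eq_bigr => a _; rewrite rmorphM mulrA.
Qed.

Lemma comb_hom (C D : calg R) (phi : calg_hom C D) (c : I -> C) rho :
  phi (comb c rho) = comb (fun a => phi (c a)) rho.
Proof. by rewrite rmorph_sum; apply: eq_bigr => a _; rewrite rmorphM calg_funP. Qed.

Lemma pure_comb (C : calg R) (c : I -> C) (J : finType) (w : J -> M) (r : J -> I -> R) :
  (forall a, v a = \sum_l r l a *: w l) ->
  \sum_a pure (v a) (c a) = \sum_l pure (w l) (comb c (r l)).
Proof.
move=> vE; under [RHS]eq_bigr => l _ do rewrite pure_sumr.
rewrite exchange_big; apply: eq_bigr => a _; rewrite vE pure_suml.
by apply: eq_bigr => l _; rewrite pureZ.
Qed.

(** Rewritten in the given [w], the vanishing sum falls under the equational criterion for [w]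
    itself. *)
Lemma refinable_flat (C : calg R) (c : I -> C) : sqz_flat M ->
  \sum_a pure (v a) (c a) = 0 -> refinable (fun rho => comb c rho = 0).
Proof.
move=> flatM vc0 J w r vE; rewrite (pure_comb _ vE) in vc0.
have [J' [w' [s [wE sK]]]] := flat_criterion flatM vc0.
by exists J', w', s; split=> // k; rewrite comb_lin; exact: sK.
Qed.

End Refinement.

Section Overlap.
Variables (R : comPzRingType) (M : lmodType R) (X : rscheme R).
Variable tau : forall A : calg R, rhom (rspec A) X -> tensor M A.
Hypothesis tau_nat : forall (A B : calg R) (phi : calg_hom A B) (f : rhom (rspec A) X),
  tau (rhom_comp f (rspec_map phi)) = tensor_map phi (tau f).
Hypothesis flatM : sqz_flat M.
Hypothesis qsX : quasi_separated X.

Variables (c d : chart X) (I : finType) (v : I -> M).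
Variables (x : I -> ch_alg c) (y : I -> ch_alg d).
Hypothesis xE : ch_xi tau c = \sum_a pure (v a) (x a).
Hypothesis yE : ch_xi tau d = \sum_a pure (v a) (y a).

(** The comparison is made stalkwise at the points of chart [c] that fall into chart [d]. The set
    [W] is a parameter for the induction over the compact overlap. *)
Definition agree (W : set X) (rho : I -> R) : Prop :=
  forall (q : spec (ch_alg c)) (Uq : opens_set (preim (mor_cont (ch_mor c)) (ch_dom d)) q),
    W (ch_mor c q) ->
    reg_fun (mor_sh (ch_mor c) (ch_dom d) (ch_sec (comb y rho))) Uq = loc_in q (comb x rho).

(** In this form the condition is visibly linear in [rho]: the elements that are combined do not
    depend on it. *)
Lemma agreeP W rho : agree W rho <->
  forall (q : spec (ch_alg c)) (Uq : opens_set (preim (mor_cont (ch_mor c)) (ch_dom d)) q),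
    W (ch_mor c q) ->
    comb (C := @loc_alg R (ch_alg c) q) (fun a =>
      reg_fun (mor_sh (ch_mor c) (ch_dom d) (ch_sec (y a))) Uq - loc_in q (x a)) rho = 0.
Proof.
suff e (q : spec (ch_alg c)) (Uq : opens_set (preim (mor_cont (ch_mor c)) (ch_dom d)) q) :
    comb (C := @loc_alg R (ch_alg c) q) (fun a =>
      reg_fun (mor_sh (ch_mor c) (ch_dom d) (ch_sec (y a))) Uq - loc_in q (x a)) rho =
    reg_fun (mor_sh (ch_mor c) (ch_dom d) (ch_sec (comb y rho))) Uq - loc_in q (comb x rho).
  split=> h q Uq Wq; first by rewrite e h // subrr.
  by apply/eqP; rewrite -subr_eq0 -e; apply/eqP/h.
have [chi _ chiE] := germ tau_nat (f := ch_point c) Uq.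
rewrite -chiE [loc_in q _](comb_hom (@loc_hom R (ch_alg c) q)) comb_hom -sumrB.
by apply: eq_bigr => a _; rewrite -mulrBr chiE.
Qed.

Lemma agree_lin W : lin_closed (agree W).
Proof.
move=> J r s rK; apply/agreeP => q Uq Wq; rewrite comb_lin big1 // => l _.
by have /agreeP -> := rK l; rewrite ?mulr0.
Qed.

Lemma agree_local z : opens_set (ch_dom c) z -> opens_set (ch_dom d) z ->
  exists U : set X, [/\ open U, U z & refinable v (agree U)].
Proof.
move=> [q0 _ <-] Uq; pose q : spec (ch_alg c) := q0; rewrite -[q0]/q in Uq *.
pose sig a := mor_sh (ch_mor c) (ch_dom d) (ch_sec (y a)).
have /choice[f /choice[b fbE]] a := reg_local (sig a) Uq.
pose kappa := \prod_a f a.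
(* Near [q] the pullback of y_a is b_a / f_a. The product [kappa] clears all denominators at once,
   and [e a] is kappa (y_a - x_a) as an element of the ring of [c]. *)
pose e a : ch_alg c := (\prod_(i | i != a) f i) * (b a - f a * x a).
have kappaE a : kappa = (\prod_(i | i != a) f i) * f a by rewrite /kappa (bigD1 a) //= mulrC.
have nkappa : ~ prime_set q kappa.
  rewrite /kappa; elim/big_ind: _ => [|s t|a _]; [exact: prime1 | exact: prime_mul|].
  by have [] := fbE a.
have eE (p : spec (ch_alg c)) (np : ~ prime_set p kappa) (Up : opens_set (preim (mor_cont
  (ch_mor c)) (ch_dom d)) p) a :
    loc_in p (e a) = loc_in p kappa * (reg_fun (sig a) Up - loc_in p (x a)).
  have nfa : ~ prime_set p (f a) by move: np; rewrite (kappaE a) => /primeM_r.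
  have [_ _ /(_ p nfa Up) ->] := fbE a.
  by rewrite /e (kappaE a) !rmorphM -mulrA mulrBr loc_in_frac rmorphB rmorphM.
pose Z := \sum_a pure (v a) (e a).
(* At [q] both families express the same tensor, so [Z] vanishes in the localization and is killed
   by some [u] outside [q]. On D(u kappa), where [u] and [kappa] are invertible, a relation among
   the [u * e a] is agreement of the combinations. *)
have [u nu uZ] : exists2 u, ~ prime_set q u & u *: Z = 0.
  apply: tensor_loc_eq0; rewrite tensor_map_pure_sum.
  have [chi chi_xi chiE] := germ tau_nat (f := ch_point c) Uq.
  move: chi_xi; rewrite -[tau _]/(ch_xi tau c) xE yE !tensor_map_pure_sum => chi_xi.
  transitivity ((loc_in q kappa : @loc_alg R (ch_alg c) q) *:
    (\sum_a pure (v a) (chi (y a)) - \sum_a pure (v a) (@loc_hom R (ch_alg c) q (x a)))).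
    rewrite -sumrB scaler_sumr; apply: eq_bigr => a _.
    by rewrite -pureBr scale_pure; congr pure; rewrite [LHS](eE q nkappa Uq) chiE.
  by rewrite chi_xi subrr scaler0.
exists (chart_image (ch_open c) (basic (u * kappa))); split.
- exact: opens_open.
- by exists q => //; exact: prime_mul.
have uZ' : \sum_a pure (v a) (u * e a) = 0.
  by rewrite -[RHS]uZ /Z scaler_sumr; apply: eq_bigr => a _; rewrite scale_pure.
apply: refinable_sub (refinable_flat flatM uZ') => rho rho0; apply/agreeP => p Up [p' np' e'].
have {e'} ep : p' = p by have [ij _ _] := ch_open c; exact: ij.
rewrite {p'}ep in np'.
apply: (@loc_in_reg _ p (u * kappa)) => //; rewrite mulr0.
move/(congr1 (loc_in p)): rho0; rewrite rmorph0 => rho0; rewrite -[RHS]rho0.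
rewrite [RHS](comb_hom (@loc_hom R (ch_alg c) p)) mulr_sumr; apply: eq_bigr => a _.
rewrite mulrCA; congr (_ * _).
rewrite [loc_in p (u * kappa)](rmorphM (@loc_in _ p)) -mulrA -(eE p (primeM_r np') Up).
exact/esym/(rmorphM (@loc_in _ p)).
Qed.

Lemma agree_refinable : refinable v (agree setT).
Proof.
have : refinable v (agree (ch_dom c `&` ch_dom d)).
  have cI : cover_compact (ch_dom c `&` ch_dom d).
    by apply: qsX; [exact: opens_open | exact: opens_open | exact: ch_dom_compact..].
  apply: (cover_compact_ind cI (P := fun W => refinable v (agree W))).
  - by apply: (@refinable_sub R M I v _ _ _ (@refinableT R M I v)) => rho _ q Uq [].
  - move=> U V /= sU sV; apply: refinable_sub (refinableI (@agree_lin U) sU sV) =>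
      rho [hU hV] q Uq.
    by case=> [/hU|/hV].
  - by move=> U V UV /=; apply: refinable_sub => rho h q Uq /UV; exact: h.
  - by move=> z [cz dz]; exact: agree_local.
apply: refinable_sub => rho h q Uq _; apply: h; split=> //.
by exists q.
Qed.

End Overlap.

(** * Global functions that express every point *)

Section Representable.
Variables (R : comPzRingType) (M : lmodType R) (X : rscheme R).
Variable tau : forall A : calg R, rhom (rspec A) X -> tensor M A.
Hypothesis tau_nat : forall (A B : calg R) (phi : calg_hom A B) (f : rhom (rspec A) X),
  tau (rhom_comp f (rspec_map phi)) = tensor_map phi (tau f).
Hypothesis tau_surj : forall (A : calg R) (x : tensor M A), exists f, tau f = x.
Hypothesis flatM : sqz_flat M.
Hypothesis qcX : quasi_compact X.
Hypothesis qsX : quasi_separated X.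

Lemma finite_atlas : exists (T : finType) (c : T -> chart X),
  forall x, exists t, opens_set (ch_dom (c t)) x.
Proof.
suff [T [c cP]] : exists (T : finType) (c : T -> chart X),
    forall x, [set: X] x -> exists t, opens_set (ch_dom (c t)) x.
  by exists T, c => x; exact: cP.
apply: (cover_compact_ind qcX (P := fun W => exists (T : finType) (c : T -> chart X),
    forall x, W x -> exists t, opens_set (ch_dom (c t)) x)) => /=.
- by exists void, (fun t : void => match t with end).
- move=> U V [T [c cP]] [T' [c' cP']].
  exists (T + T')%type, (fun t => match t with inl t => c t | inr t => c' t end) => x.
  by case=> [/cP[t ct]|/cP'[t ct]]; [exists (inl t) | exists (inr t)].
- by move=> U V UV [T [c cP]]; exists T, c => x /UV; exact: cP.
move=> x _; have [B [j [jo [q _ jq]]]] := rsch_scheme x.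
exists (ch_dom (Chart jo)); split; [exact: opens_open | by exists q |].
by exists unit, (fun=> Chart jo) => y; exists tt.
Qed.

(** The families for the single charts are concatenated, with coefficient 0 at the elements that
    belong to other charts. *)
Lemma common_family (T : finType) (c : T -> chart X) :
  exists (I : finType) (v : I -> M), forall t, exists x : I -> ch_alg (c t),
    ch_xi tau (c t) = \sum_a pure (v a) (x a).
Proof.
suff [I [v vP]] : exists (I : finType) (v : I -> M), forall t, t \in enum T ->
    exists x : I -> ch_alg (c t), ch_xi tau (c t) = \sum_a pure (v a) (x a).
  by exists I, v => t; apply: vP; rewrite mem_enum.
elim: (enum T) => [|t s [I [v vP]]]; first by exists void, (fun=> 0).
have [J [w [y yE]]] := tensor_pureP (ch_xi tau (c t)).
exists (J + I)%type, (fun x => match x with inl b => w b | inr a => v a end) => u.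
rewrite inE => /orP[/eqP ->|/vP[x xE]].
  exists (fun x => match x with inl b => y b | inr _ => 0 end).
  rewrite big_sumType /= yE [X in _ + X]big1 ?addr0 // => a _; exact: pure0r.
exists (fun z => match z with inl _ => 0 | inr a => x a end).
rewrite big_sumType /= xE [X in X + _]big1 ?add0r // => a _; exact: pure0r.
Qed.

Lemma universal_expression : exists (J : finType) (w : J -> M) (Y : J -> glob X),
  forall (A : calg R) (f : rhom (rspec A) X),
    tau f = \sum_k pure (w k) (glob_spec (pullback f (Y k)) : A).
Proof.
have [T [c cP]] := finite_atlas.
have [L [v vP]] := common_family c.
pose x t : L -> ch_alg (c t) := projT1 (cid (vP t)).
have xE t : ch_xi tau (c t) = \sum_a pure (v a) (x t a) := projT2 (cid (vP t)).
have agr : refinable v (fun rho => forall tu : T * T, agree (x tu.1) (x tu.2) setT rho).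
  apply: refinable_all => -[t u] /=; first exact: (@agree_lin R M X tau tau_nat).
  exact: (@agree_refinable R M X tau tau_nat flatM qsX _ _ _ _ _ _ (xE t) (xE u)).
(* The expression of [v] by itself, from which the refinement starts. *)
have vE a : v a = \sum_l (l == a)%:R *: v l.
  by rewrite (bigD1 a) //= eqxx scale1r big1 ?addr0 // => l /negbTE ->; rewrite scale0r.
have [J [w [s [wE sK]]]] := agr L v (fun l a => (l == a)%:R) vE.
have {vE} := refine_comp vE wE; move: sK.
set r := fun k a => \sum_l s k l * (l == a)%:R; rewrite -/r => rK vE.
pose y t k : ch_alg (c t) := comb (x t) (r k).
have yE t : ch_xi tau (c t) = \sum_k pure (w k) (y t k) by rewrite xE (pure_comb _ vE).
have domT t : ch_dom (c t) `<=` opensT X by [].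
have /choice[Y YE] k : exists Y : glob X, forall t, res \O_X (domT t) Y = ch_sec (y t k).
  have [|t u hi hj|Y [YE _]] := rs_shP domT _ (s := fun t => ch_sec (y t k)).
  - by move=> z _; have [t ct] := cP z; exists t.
  - pose O := preim (mor_cont (ch_mor (c t))) (opensI (ch_dom (c t)) (ch_dom (c u))).
    have h : O `<=` preim (mor_cont (ch_mor (c t))) (opensI (ch_dom (c t)) (ch_dom (c u)))
      by [].
    have ht : O `<=` preim (mor_cont (ch_mor (c t))) (ch_dom (c t)) by move=> q /h[].
    have hu : O `<=` preim (mor_cont (ch_mor (c t))) (ch_dom (c u)) by move=> q /h[].
    apply: (pull_chart_inj (ch_open (c t)) (h := h)).
      by move=> z [[q _ <-] ctq]; exists q => //; split=> //; exists q.
    rewrite (pull_res hi h ht) (pull_res hj h hu) pull_chart_section.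
    apply: regular_ext => q Oq; apply: esym.
    exact: (rK k (t, u) q (hu q Oq) I).
  by exists Y.
(* The equality is checked in the localizations at the primes p of A: f(p) lies in some chart, where
   [germ] computes both sides. *)
exists J, w, Y => A f; apply/eqP; rewrite -subr_eq0; apply/eqP.
set d := _ - _; rewrite -[d]scale1r.
apply: (ideal_full (ideal_ann d)) => p.
suff d0 : tensor_map (loc_hom p) d = 0 by have [u nu ud] := tensor_loc_eq0 d0; exists u.
have [t ct] := cP (f p).
have Up : opens_set (preim (mor_cont f) (ch_dom (c t))) p by [].
have [chi chi_xi chiE] := germ tau_nat Up.
have mapB (u z : tensor M A) : tensor_map (loc_hom p) (u - z) =
    tensor_map (loc_hom p) u - tensor_map (loc_hom p) z.
  by apply: (addIr (tensor_map (loc_hom p) z)); rewrite -tensor_mapD !subrK.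
rewrite /d mapB chi_xi yE !tensor_map_pure_sum -sumrB big1 // => k _.
rewrite chiE -YE; apply/eqP; rewrite subr_eq0; apply/eqP; congr pure.
have e := congr1 (fun s : regular (opensT (spec A)) => reg_fun s (I : opens_set (opensT _) p))
  (glob_specK (pullback f (Y k))).
apply: etrans _ (esym e).
rewrite -(mor_nat f (domT t)).
exact: (@reg_irr A _ (mor_sh f (opensT X) (Y k)) p).
Qed.

(** * Derivatives at 0 and the dual basis *)

Section DualBasis.
Variables (J : finType) (w : J -> M) (Y : J -> glob X).
Hypothesis tauE : forall (A : calg R) (f : rhom (rspec A) X),
  tau f = \sum_k pure (w k) (glob_spec (pullback f (Y k)) : A).
Hypothesis tau_inj : forall A : calg R, injective (@tau A).

Definition value (k : J) (A : calg R) (f : rhom (rspec A) X) : A :=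
  glob_spec (pullback f (Y k)).

Lemma value_nat k (A B : calg R) (phi : calg_hom A B) f :
  value k (rhom_comp f (rspec_map phi)) = phi (value k f).
Proof.
apply: spec_const_inj; rewrite glob_specK pullback_comp -[RHS]pullback_spec_const.
by rewrite glob_specK.
Qed.

Definition point_of (A : calg R) (x : tensor M A) : rhom (rspec A) X :=
  projT1 (cid (tau_surj x)).

Lemma tau_point_of A (x : tensor M A) : tau (point_of x) = x.
Proof. exact: (projT2 (cid (tau_surj x))). Qed.

Lemma value_point_of k (A B : calg R) (phi : calg_hom A B) x :
  value k (point_of (tensor_map phi x)) = phi (value k (point_of x)).
Proof.
by rewrite -value_nat; congr value; apply: tau_inj; rewrite tau_nat !tau_point_of.
Qed.

(* The derivative at 0 of the function [Y k] along m, computed at the point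
   [m (x) eps] with values in the dual numbers. *)
Definition form (k : J) (m : M) : R^o :=
  (value k (point_of (pure m (sqz_eps (1 : R^o))))).2.

Definition pair_form (a b : R) (u : R^o * R^o) : R^o := a * u.1 + b * u.2.

Lemma pair_form_linear a b : linear (pair_form a b).
Proof.
move=> r [u1 u2] [z1 z2]; rewrite /pair_form.
have : forall r' x y s t : R, a * (r' * x + s) + b * (r' * y + t) =
  r' * (a * x + b * y) + (a * s + b * t) by move=> *; ring.
exact.
Qed.

HB.instance Definition _ a b := GRing.isLinear.Build R (R^o * R^o)%type R^o _
  (pair_form a b) (pair_form_linear a b).

(** Over R + R^2, the map (u1, u2) -> b u1 + c u2 carries z = m (x) eps_1 + m' (x) eps_2 to (b m + c
    m') (x) eps. By naturality the derivative along b m + c m' is the same combination of the two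
    eps-components of [Y k] at [z]. *)
Lemma form_linear k : linear (form k).
Proof.
move=> a m m'.
pose z : tensor M (sqz_alg (R^o * R^o)%type) :=
  pure m (sqz_eps ((1, 0) : R^o * R^o)) + pure m' (sqz_eps ((0, 1) : R^o * R^o)).
have formE (b c : R) : form k (b *: m + c *: m') = pair_form b c (value k (point_of z)).2.
  rewrite /form -[RHS]/((sqz_map (pair_form b c) (value k (point_of z))).2) -value_point_of.
  suff -> : tensor_map (sqz_map (pair_form b c)) z =
    pure (b *: m + c *: m') (sqz_eps (1 : R^o)) by [].
  rewrite /z tensor_mapD !tensor_map_pure pureDl !pureZ -!sqz_epsZ.
  congr (pure _ _ + pure _ _); apply: sqz_ext => //=; rewrite /pair_form /=.
    by rewrite mulr0 addr0.
  by rewrite mulr0 add0r.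
have := formE a 1; have := formE 1 0; have := formE 0 1.
rewrite !scale0r !scale1r addr0 add0r => -> -> ->.
by rewrite /pair_form !mul0r !mul1r addr0 add0r.
Qed.

(** The map [g] sends m (x) (r + s eps) to s m. Applied to the expression of the point m (x) eps, it
    gives m on one side and keeps only the derivatives of the [Y k] on the other. *)
Lemma form_basis m : m = \sum_k form k m *: w k.
Proof.
have [|||g gE] := @tensor_lift R M (sqz_alg R^o) M (fun m t => t.2 *: m).
- by move=> u u' t; exact: scalerDr.
- by move=> u t t'; exact: scalerDl.
- by move=> r u t; rewrite scalerA /= scaler0 addr0 mulrC.
have := congr1 g (tauE (point_of (pure m (sqz_eps (1 : R^o))))).
by rewrite tau_point_of gE scale1r raddf_sum => {1}->; apply: eq_bigr => k _; rewrite gE.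
Qed.

End DualBasis.
End Representable.

Lemma dual_basis_fg_projective (R : comPzRingType) (M : lmodType R) (J : finType)
    (w : J -> M) (lam : J -> {linear M -> R^o}) :
  (forall m, m = \sum_k lam k m *: w k) -> finitely_generated M /\ projective M.
Proof.
move=> basis; split.
  exists #|J|, (fun i => w (enum_val i)) => m; exists (fun i => lam (enum_val i) m).
  by rewrite {1}(basis m) (reindex _ (onW_bij _ (@enum_val_bij J))).
(* Lifts of the f(w_k) extend to a lift on M through the forms [lam]. *)
move=> N P g f gsurj; have /choice[n nE] k := gsurj (f (w k)).
pose h m := \sum_k lam k m *: n k.
have hL : linear h.
  move=> a x y; rewrite /h scaler_sumr -big_split; apply: eq_bigr => k _ /=.
  by rewrite linearP scalerDl -scalerA.
exists (HB.pack_for {linear M -> N} h (GRing.isLinear.Build _ _ _ _ h hL)) => m.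
rewrite {2}(basis m) !linear_sum; apply: eq_bigr => k _.
by rewrite !linearZ nE.
Qed.

Lemma representable_fg_projective (R : comPzRingType) (M : lmodType R) :
  is_qcqs_module_scheme (quasi_coherent M) -> finitely_generated M /\ projective M.
Proof.
move=> [X [qcX qsX iso]]; have flatM := representable_flat iso.
have [theta [theta_bij theta_nat]] := iso.
have theta_surj (A : calg R) (f : rhom (rspec A) X) : exists x, theta A x = f.
  by have [g _ gK] := theta_bij A; exists (g f); exact: gK.
pose tau A (f : rhom (rspec A) X) : tensor M A := projT1 (cid (theta_surj A f)).
have tauK A f : theta A (tau A f) = f := projT2 (cid (theta_surj A f)).
have thetaK A x : tau A (theta A x) = x by apply: (bij_inj (theta_bij A)); exact: tauK.
have tau_nat (A B : calg R) (phi : calg_hom A B) (f : rhom (rspec A) X) :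
    tau B (rhom_comp f (rspec_map phi)) = tensor_map phi (tau A f).
  apply: (bij_inj (theta_bij B)); rewrite tauK;
    apply: etrans (esym (theta_nat A B phi (tau A f))).
  by rewrite tauK.
have tau_surj A x : exists f, tau A f = x by exists (theta A x).
have tau_inj A : injective (tau A) by apply: can_inj (tauK A).
have [J [w [Y tauE]]] := universal_expression tau_nat flatM qcX qsX.
pose laml k := GRing.isLinear.Build R M R^o _ (form tau_surj Y k)
  (form_linear tau_nat tau_surj Y tau_inj k).
pose lam k : {linear M -> R^o} := HB.pack_for {linear M -> R^o} (form tau_surj Y k) (laml k).
apply: (dual_basis_fg_projective (w := w) (lam := lam)) => m.
exact: form_basis.
Qed.

Theorem corollary2p4 (R : comPzRingType) (M : lmodType R) :
  is_qcqs_module_scheme (quasi_coherent M) <->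
  finitely_generated M /\ projective M.
Proof.
split; first exact: representable_fg_projective.
case=> fg proj; have [n [w [lam basis]]] := projective_dual_basis fg proj.
exact: dual_basis_representable basis.
Qed.
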